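(* Let $G$ be a maximal outerplanar graph. Then $G$ is in $B_1$ if and only if $G$ is $M$-free.
   Context: A graph is maximal outerplanar if it is outerplanar and adding any single new edge yields a non-outerplanar graph. $S_3$ is the graph with vertices $x_1,x_2,x_3,y_1,y_2,y_3$ and edges $\{x_1,x_2\},\{x_1,x_3\},\{x_2,x_3\},\{x_1,y_1\},\{x_2,y_1\},\{x_2,y_2\},\{x_3,y_2\},\{x_3,y_3\},\{x_1,y_3\}$; its central vertices are $x_1,x_2,x_3$ and central edges the three edges among them. The reduced graph $\widetilde{G}$ is obtained by coloring, for every induced subgraph of $G$ isomorphic to $S_3$, its central vertices and central edges, and deleting all uncolored vertices and edges. $M_1$ is the graph on $d_1,\dots,d_5$ with edges $d_1d_2,d_1d_3,d_2d_3,d_3d_4,d_2d_4,d_4d_5,d_2d_5$. For $\ell\ge 0$, $M_1^{\ell}$ is any graph consisting of: a 4-cycle $a_1a_2a_3a_4$ plus exactly one chord ($a_1a_3$ or $a_2a_4$); a 4-cycle $b_1b_2b_3b_4$ plus exactly one chord ($b_1b_3$ or $b_2b_4$); and vertices $c_0=a_1,c_1,\dots,c_{2\ell}=b_1$ such that $c_{2i-2},c_{2i-1},c_{2i}$ form a triangle for $1\le i\le\ell$, with no further edges (for $\ell=0$, $a_1=b_1$). $G$ is $M$-free if $\widetilde{G}$ contains neither $M_1$ nor $M_1^{\ell}$ (for any $\ell\ge 0$) as an induced subgraph. $B_1$ is the class of graphs having an EPG representation (paths on a rectangular grid, one per vertex, two vertices adjacent iff their paths share a grid edge) in which every path has at most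 one bend. *)

(* Defs.v *)
From mathcomp Require Import all_boot all_order all_algebra.
Set Implicit Arguments.
Unset Strict Implicit.
Unset Printing Implicit Defensive.
Import GRing.Theory Num.Theory.

(* A simple graph is a symmetric irreflexive relation e on a finite type T. *)

Section Graphs.
Variable T : finType.

(* Outerplanar = admits a drawing with all vertices on a circle (the outer
   face) and edges as non-crossing chords.  With the vertices placed on the
   circle in the order given by the injective position map [pos], two chords
   ab and cd cross iff their endpoints interleave. *)
Definition outerplanar (e : rel T) : Prop :=
  exists pos : T -> nat, injective pos /\
    forall a b c d, e a b -> e c d ->
      ~ ((pos a < pos c)%N /\ (pos c < pos b)%N /\ (pos b < pos d)%N).

Definition add_edge (e : rel T) (x y : T) : rel T :=
  fun u v => e u v || ((u == x) && (v == y)) || ((u == y) && (v == x)).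

Definition maximal_outerplanar (e : rel T) : Prop :=
  outerplanar e /\
  forall x y, x != y -> ~~ e x y -> ~ outerplanar (add_edge e x y).

Definition gpoint := (int * int)%type.

Definition grid_adj (p q : gpoint) : bool :=
  ((p.1 == q.1) && ((p.2 == q.2 + 1)%R || (q.2 == p.2 + 1)%R)) ||
  ((p.2 == q.2) && ((p.1 == q.1 + 1)%R || (q.1 == p.1 + 1)%R)).

Definition grid_path (s : seq gpoint) : bool :=
  if s is x :: s' then path grid_adj x s' && uniq s else false.

Definition horiz (p q : gpoint) : bool := p.2 == q.2.

Definition nbends (s : seq gpoint) : nat :=
  let x0 := (0%R, 0%R) : gpoint in
  count (fun i => horiz (nth x0 s i) (nth x0 s i.+1)
                  != horiz (nth x0 s i.+1) (nth x0 s i.+2))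
        (iota 0 (size s - 2)).

Definition share_grid_edge (s t : seq gpoint) : Prop :=
  let x0 := (0%R, 0%R) : gpoint in
  exists i j, (i.+1 < size s)%N /\ (j.+1 < size t)%N /\
    ((nth x0 s i = nth x0 t j /\ nth x0 s i.+1 = nth x0 t j.+1) \/
     (nth x0 s i = nth x0 t j.+1 /\ nth x0 s i.+1 = nth x0 t j)).

Definition in_B1 (e : rel T) : Prop :=
  exists P : T -> seq gpoint,
    (forall v, grid_path (P v) /\ (nbends (P v) <= 1)%N) /\
    (forall u v, u != v -> (e u v <-> share_grid_edge (P u) (P v))).

End Graphs.

Definition rel_of_edges (n : nat) (s : seq (nat * nat)) : rel 'I_n :=
  fun u v => ((nat_of_ord u, nat_of_ord v) \in s) || ((nat_of_ord v, nat_of_ord u) \in s).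
Arguments rel_of_edges : clear implicits.

(* S_3 : x1,x2,x3 = 0,1,2 ; y1,y2,y3 = 3,4,5 *)
Definition S3 : rel 'I_6 :=
  rel_of_edges 6 [:: (0,1); (0,2); (1,2); (0,3); (1,3); (1,4); (2,4); (2,5); (0,5)]%N.

Definition M1 : rel 'I_5 :=
  rel_of_edges 5 [:: (0,1); (0,2); (1,2); (2,3); (1,3); (3,4); (1,4)]%N.

(* M_1^l on 'I_(2l+7): a1..a4 = 0..3, b2,b3,b4 = 4,5,6,
   c_0 = a1 = 0, c_k = k+6 for 1 <= k <= 2l, and b1 = c_(2l)
   (so b1 = a1 = 0 when l = 0).  [ca] chooses the chord a1a3 (true) or a2a4
   (false); [cb] chooses b1b3 (true) or b2b4 (false). *)
Definition cidx (k : nat) : nat := if k == 0%N then 0%N else (k + 6)%N.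

Definition M1l_edges (l : nat) (ca cb : bool) : seq (nat * nat) :=
  let b1 := cidx (2 * l) in
  [:: (0,1); (1,2); (2,3); (3,0); (if ca then (0,2) else (1,3))]%N ++
  [:: (b1,4); (4,5); (5,6); (6,b1); (if cb then (b1,5) else (4,6))]%N ++
  flatten [seq [:: (cidx (2 * i - 2), cidx (2 * i - 1));
                   (cidx (2 * i - 1), cidx (2 * i));
                   (cidx (2 * i - 2), cidx (2 * i))]%N | i <- iota 1 l].

Definition M1l (l : nat) (ca cb : bool) : rel 'I_(2 * l + 7) :=
  rel_of_edges (2 * l + 7) (M1l_edges l ca cb).
Arguments M1l : clear implicits.

Section Reduced.
Variable T : finType.
Variable e : rel T.

Definition S3_copy (f : 'I_6 -> T) : Prop :=
  injective f /\ forall i j, i != j -> S3 i j = e (f i) (f j).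

Definition colored_vertex (v : T) : Prop :=
  exists f, S3_copy f /\ exists i : 'I_6, (i < 3)%N /\ v = f i.

Definition colored_edge (u v : T) : Prop :=
  e u v /\ exists f, S3_copy f /\
    exists i j : 'I_6, (i < 3)%N /\ (j < 3)%N /\ u = f i /\ v = f j.

(* the reduced graph ~G has vertex set [colored_vertex] and edge relation
   [colored_edge]; H on 'I_n is an induced subgraph of ~G *)
Definition induced_in_reduced (n : nat) (h : rel 'I_n) : Prop :=
  exists f : 'I_n -> T, injective f /\ (forall i, colored_vertex (f i)) /\
    forall i j, i != j -> (h i j <-> colored_edge (f i) (f j)).

Definition M_free : Prop :=
  ~ induced_in_reduced M1 /\
  forall (l : nat) (ca cb : bool), ~ induced_in_reduced (M1l l ca cb).
End Reduced.

(* Main.v *)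
(* A maximal outerplanar graph is a triangulated polygon, and the central triangles
   of its induced copies of S_3 are its internal triangles, those without an outer
   edge.  Both properties are equivalent to a third one, [claiming]: one can let each
   internal triangle claim two of its vertices so that no vertex is claimed twice.

   B_1 gives a claiming: the three paths of an internal triangle cannot share a grid
   edge, so they form a claw, in which two of the paths bend; since there is neither
   a K_4 nor a 4-wheel, a bend serves only one claw.

   A claiming gives M-freeness by counting: M_1 has 3 triangles on 5 vertices and
   M_1^l has l + 4 triangles on 2l + 7 vertices.

   M-freeness gives a claiming: the reduced graph is a tree of triangles and diamonds
   glued at vertices, with at most one diamond per component.  Root each component,
   at its diamond if it has one; a triangle claims its two vertices away from the
   root, and the two triangles of a diamond claim its four vertices.

   A claiming gives B_1: insert the vertices one at a time, each across an outer edge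
   uv of the part already represented, keeping for every outer edge that will be
   crossed later a free grid edge at which the paths of u and v, and no other path,
   end.  A branching, that is an internal triangle, needs a claw with two new bends,
   which are provided by the vertices claimed by this triangle. *)

From Stdlib Require Import ZArith Lia.
Require Import Defs.
From mathcomp Require Import all_boot all_order all_algebra zify ssrZ.
Set Implicit Arguments.
Unset Strict Implicit.
Unset Printing Implicit Defensive.
Import Order.TTheory GRing.Theory Num.Theory.

(** * Contacts of paths with one bend *)

(** Counting explains why one diamond per component is the limit. A component of the reduced graph
    with t isolated triangles and d diamonds, glued as a tree, has 2t + 3d + 1 vertices and needs 2t
    + 4d claims; so d is at most 1, and without a diamond exactly one vertex, the root, is spared.
    The main obstacle is the tree structure itself: M-freeness excludes induced subgraphs only, so a
    chain of blocks must be shown to have no unexpected edges. This comes from the circular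
    positions: once the edges of a block are removed, its vertices lie in different components. On
    the side of the grid, a path with at most one bend is stored as six integers, which turns
    statements about contacts into linear arithmetic. Each insertion refines the grid by the factor
    4, so that a single grid edge has room for the end of a path, a new corner and a remaining free
    edge. *)

Section LPaths.
Local Open Scope Z_scope.

(* A path with at most one bend: the horizontal part lies on row lr between columns la
   and lb, the vertical part on column lc between rows ld and le; a part is absent
   when its two ends agree. *)
Record lpath := LPath { lr : Z; la : Z; lb : Z; lc : Z; ld : Z; le : Z }.

Definition wf (L : lpath) : Prop :=
  la L <= lb L /\ ld L <= le L /\
  (la L = lb L \/ ld L = le L \/
   (lc L = la L \/ lc L = lb L) /\ (lr L = ld L \/ lr L = le L)).

(* The grid edge from (x, y) to (x + 1, y) (resp. to (x, y + 1)) lies on L. *)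
Definition hE (L : lpath) (x y : Z) : Prop := lr L = y /\ la L <= x < lb L.
Definition vE (L : lpath) (x y : Z) : Prop := lc L = x /\ ld L <= y < le L.

Definition hadj (L M : lpath) : Prop :=
  lr L = lr M /\ la L < lb L /\ la M < lb M /\ la L < lb M /\ la M < lb L.
Definition vadj (L M : lpath) : Prop :=
  lc L = lc M /\ ld L < le L /\ ld M < le M /\ ld L < le M /\ ld M < le L.
Definition ladj (L M : lpath) : Prop := hadj L M \/ vadj L M.

Definition bent (L : lpath) : Prop := la L < lb L /\ ld L < le L.
(* The horizontal (resp. vertical) edge of L at its bend belongs to M. *)
Definition hasH (L M : lpath) : Prop :=
  lc L = la L /\ hE M (lc L) (lr L) \/ lc L <> la L /\ hE M (lc L - 1) (lr L).
Definition hasV (L M : lpath) : Prop :=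
  lr L = ld L /\ vE M (lc L) (lr L) \/ lr L <> ld L /\ vE M (lc L) (lr L - 1).
Definition lclaw (L M N : lpath) : Prop :=
  bent L /\ (hasH L M /\ ~ hasV L M /\ hasV L N /\ ~ hasH L N \/
             hasH L N /\ ~ hasV L N /\ hasV L M /\ ~ hasH L M).

(* Y meets L on the right (resp. left) of the grid edge between columns x and x + 1, in
   the situation where L, but not Y, contains this edge. *)
Definition onR (x : Z) (Y L : lpath) : Prop :=
  hadj Y L /\ x < la Y \/ vadj Y L /\ x < lc L.
Definition onL (x : Z) (Y L : lpath) : Prop :=
  hadj Y L /\ lb Y <= x \/ vadj Y L /\ lc L <= x.

End LPaths.

Ltac lunf := rewrite /wf /onR /onL /ladj /lclaw /bent /hasH /hasV /hE /vE /hadj /vadj /=.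
Ltac lpath_lia := lunf; lia.

Section LPathLemmas.
Local Open Scope Z_scope.

Lemma contact_side (x y : Z) (L Y : lpath) :
  hE L x y -> ~ hE Y x y -> ladj Y L -> onR x Y L \/ onL x Y L.
Proof. move: L Y => [r1 a1 b1 c1 d1 e1] [r a b c d e]. lpath_lia. Qed.

(** The horizontal and the vertical part of [Y] meet at its bend, so they cannot lie beyond opposite
    ends of the common edge. *)
Lemma contact_one_side (x y : Z) (L M Y : lpath) :
  wf L -> wf M -> wf Y -> hE L x y -> hE M x y -> ~ hE Y x y ->
  onR x Y L -> onL x Y M -> False.
Proof.
move: L M Y => [r1 a1 b1 c1 d1 e1] [r2 a2 b2 c2 d2 e2] [r a b c d e].
lpath_lia.
Qed.

(** The vertical parts of [L1] and [L3] overlap while their horizontal parts do not, so both turn at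
    one grid point, with horizontal arms in opposite directions; [L2], meeting both arms, runs
    straight through this point. *)
Lemma claw_of_adj (L1 L2 L3 : lpath) :
  wf L1 -> wf L2 -> wf L3 -> hadj L1 L2 -> hadj L2 L3 -> vadj L1 L3 -> ~ hadj L1 L3 ->
  lclaw L1 L2 L3 /\ lclaw L3 L1 L2.
Proof.
move: L1 L2 L3 => [r1 a1 b1 c1 d1 e1] [r2 a2 b2 c2 d2 e2] [r3 a3 b3 c3 d3 e3].
lunf => W1 W2 W3 A12 A23 V13 N13.
have ? : r1 = r2 by lia. have ? : r3 = r2 by lia. have ? : c3 = c1 by lia. subst.
have {}N13 : b3 <= a1 \/ b1 <= a3 by lia.
have {}W1 : (c1 = a1 \/ c1 = b1) /\ (r2 = d1 \/ r2 = e1) by lia.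
have {}W3 : (c1 = a3 \/ c1 = b3) /\ (r2 = d3 \/ r2 = e3) by lia.
have {}N13 : c1 = a1 /\ c1 = b3 \/ c1 = b1 /\ c1 = a3 by lia.
have {}W2 : d2 < e2 -> c2 <> c1 by lia.
split; split; [lia | left | lia | right]; repeat split; lia.
Qed.

Definition corner_end (x : Z) (Y L : lpath) : Prop :=
  [/\ x < lc L, lc L = lb L, lr L = ld L \/ lr L = le L & vadj Y L].

Lemma corner_endP (x y : Z) (L Y : lpath) :
  wf L -> hE L x y -> vadj Y L -> x < lc L -> corner_end x Y L.
Proof.
move: L Y => [r1 a1 b1 c1 d1 e1] [r a b c d e].
rewrite /corner_end; lunf => W h v l; split; lia.
Qed.

(* The ways in which a path may meet two out of three paths on the right of a
   common edge while avoiding the third. *)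
Definition right_pair (x : Z) (L M N Y : lpath) : Prop :=
  [\/ lb N < lb L /\ lb N < lb M,
      [/\ corner_end x Y L, lb N <= lb L < lb M, lr Y = lr L & la Y = lb L /\ lb L < lb Y],
      [/\ corner_end x Y M, lb N <= lb M < lb L, lr Y = lr M & la Y = lb M /\ lb M < lb Y] |
      corner_end x Y L /\ corner_end x Y M].

Lemma right_pairP (x y : Z) (L M N Y : lpath) :
  wf L -> wf M -> wf N -> wf Y -> hE L x y -> hE M x y -> hE N x y ->
  ~ ladj Y N -> onR x Y L -> onR x Y M -> right_pair x L M N Y.
Proof.
move=> WL WM WN WY hL hM hN nN; rewrite /right_pair.
have row (P Q : lpath) : hE P x y -> hE Q x y -> wf Q -> hadj Y P -> x < la Y -> vadj Y Q ->
  x < lc Q ->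
    lb N < lb P /\ lb N < lb Q \/
    [/\ corner_end x Y Q, lb N <= lb Q < lb P, lr Y = lr Q & la Y = lb Q /\ lb Q < lb Y].
  move=> hP hQ WQ A1 B1 A2 B2; have C := corner_endP WQ hQ A2 B2.
  have {WQ}CQ : lc Q = lb Q by case: C.
  move: A1 A2 WY B1 nN hP hQ hN C; lunf=> A1 A2 WY B1 nN hP hQ hN C.
  have cc : lc Y = lc Q by lia.
  have {}nN : lb N <= la Y by lia.
  have {}WY : lc Y = la Y \/ lc Y = lb Y by lia.
  by case: WY => cY; [right; split=> //; lia | left; lia].
case=> [[A1 B1]|[A1 B1]] [[A2 B2]|[A2 B2]].
- apply: Or41.
  by move: A1 A2 B1 B2 nN hL hM hN; lunf; lia.
- by case: (row L M) => // ?; [exact: Or41 | exact: Or43].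
- by case: (row M L) => // [[? ?]|?]; [apply: Or41 | apply: Or42].
- by apply: Or44; split; apply: corner_endP; eauto.
Qed.

Lemma ladjC (P Q : lpath) : ladj P Q -> ladj Q P.
Proof. by rewrite /ladj /hadj /vadj; lia. Qed.

Lemma vnadj (P Q : lpath) : ~ ladj P Q -> lc P = lc Q -> ld P < le P -> ld Q < le Q ->
  le P <= ld Q \/ le Q <= ld P.
Proof. move: P Q => [r1 a1 b1 c1 d1 e1] [r a b c d e]; lunf; lia. Qed.

(** Comparing the right ends of the three paths leaves only cases where some of them turn on a
    common column. There either [Y] and [Y'] share an edge, or the two vertical directions at a
    corner cannot accommodate the prescribed contacts and non-contacts. *)
Lemma side_once (x y : Z) (L M N Y Y' : lpath) :
  wf L -> wf M -> wf N -> wf Y -> wf Y' -> hE L x y -> hE M x y -> hE N x y ->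
  ~ ladj Y N -> ~ ladj Y' M -> ~ ladj Y Y' ->
  onR x Y L -> onR x Y M -> onR x Y' L -> onR x Y' N -> False.
Proof.
move=> WL WM WN WY WY' hL hM hN nYN nY'M nYY' R1 R2 R3 R4.
have rM : lr M = lr L by case: hL hM => -> _ [].
have rN : lr N = lr L by case: hL hN => -> _ [].
have := right_pairP WL WM WN WY hL hM hN nYN R1 R2.
have := right_pairP WL WN WM WY' hL hN hM nY'M R3 R4.
rewrite /right_pair /corner_end.
have col P Q : vadj P Q -> lc P = lc Q by case.
(* [A] and [P] leave the row in the same vertical direction, [Q] in the other one; [B], touching [P]
   and [Q], passes through the row and runs into [A]. *)
have two_up P Q A B : lr P = lr A -> lr Q = lr A -> lc A = lc P -> lc A = lc Q -> lc B = lc P ->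
    lr P = ld P \/ lr P = le P -> lr Q = ld Q \/ lr Q = le Q -> lr A = ld A \/ lr A = le A ->
    vadj A P -> vadj B P -> vadj B Q -> ~ ladj A Q -> ~ ladj B A -> False.
  move=> e1 e2 e3 e4 e5 k1 k2 k3 v1 v2 v3 /vnadj n1 /vnadj n2.
  have {}n1 : le A <= ld Q \/ le Q <= ld A by case: v1 v3 => [? ?] [? ?]; lia.
  have {}n2 : le A <= ld B \/ le B <= ld A by case: v1 v3 => [? ?] [? ?]; lia.
  by case: v1 v2 v3 => [? ?] [? ?] [? ?]; lia.
have endY P Q : wf P -> lr P = lr Q -> la P = lb Q /\ lb Q < lb P -> vadj P Q ->
    lr P = ld P \/ lr P = le P.
  by move=> W e1 [e2 e3] [? ?]; move: W; rewrite /wf; lia.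
case=> [[u v]|[[u1 u2 u3 u4] u5 u6 u7]|[[u1 u2 u3 u4] u5 u6 u7]|[[u1 u2 u3 u4] [v1 v2 v3 v4]]];
case=> [[u' v']|[[u1' u2' u3' u4'] u5' u6' u7']|[[u1' u2' u3' u4'] u5' u6' u7']|[[u1' u2' u3'
  u4'] [v1' v2' v3' v4']]];
repeat match goal with H : vadj ?A ?B |- _ =>
  lazymatch goal with E : lc A = lc B |- _ => fail | _ => have ? := col _ _ H end end;
try lia.
- by apply: (two_up L M Y' Y) => //; try lia; exact: (endY Y' L).
- by apply: nYY'; left; rewrite /hadj; lia.
- by apply: (two_up L N Y Y') => //; try lia; [exact: (endY Y L) | move/ladjC].
case: u4 v4 u4' v4' => _ i1 [_ i2] [_ i3] [_ i4].
have n1 : le Y <= ld N \/ le N <= ld Y by apply: vnadj => //; lia.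
have n2 : le Y' <= ld M \/ le M <= ld Y' by apply: vnadj => //; lia.
lia.
Qed.

End LPathLemmas.
Section LPathSymmetries.
Local Open Scope Z_scope.

(** Reflections in the diagonal and in the vertical axis: they reduce columns to rows and the left
    side of an edge to its right side. The edge from [x] to [x + 1] is reflected to the one from
    [- x - 1] to [- x]. *)
Definition tr (L : lpath) := LPath (lc L) (ld L) (le L) (lr L) (la L) (lb L).
Definition fx (L : lpath) := LPath (lr L) (- lb L) (- la L) (- lc L) (ld L) (le L).

Lemma wf_tr L : wf L -> wf (tr L). Proof. rewrite /wf /=; lia. Qed.
Lemma wf_fx L : wf L -> wf (fx L). Proof. rewrite /wf /=; lia. Qed.
Lemma ladj_tr L M : ladj (tr L) (tr M) <-> ladj L M.
Proof. rewrite /ladj /hadj /vadj /=; tauto. Qed.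
Lemma ladj_fx L M : ladj (fx L) (fx M) <-> ladj L M.
Proof. rewrite /ladj /hadj /vadj /=; lia. Qed.
Lemma hE_fx L x y : hE L x y -> hE (fx L) (- x - 1) y.
Proof. rewrite /hE /=; lia. Qed.
Lemma onL_fx x Y L : onL x Y L -> onR (- x - 1) (fx Y) (fx L).
Proof. rewrite /onL /onR /hadj /vadj /=; lia. Qed.
Lemma lclaw_tr L M N : lclaw (tr L) (tr M) (tr N) <-> lclaw L M N.
Proof.
by rewrite /lclaw /bent /hasH /hasV /hE /vE /=; tauto.
Qed.
Lemma lclawC L M N : lclaw L M N -> lclaw L N M.
Proof. rewrite /lclaw; tauto. Qed.

Lemma no_row_clique (x y : Z) (L1 L2 L3 Y12 Y23 Y13 : lpath) :
  wf L1 -> wf L2 -> wf L3 -> wf Y12 -> wf Y23 -> wf Y13 ->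
  hE L1 x y -> hE L2 x y -> hE L3 x y ->
  ladj Y12 L1 -> ladj Y12 L2 -> ~ ladj Y12 L3 ->
  ladj Y23 L2 -> ladj Y23 L3 -> ~ ladj Y23 L1 ->
  ladj Y13 L1 -> ladj Y13 L3 -> ~ ladj Y13 L2 ->
  ~ ladj Y12 Y23 -> ~ ladj Y12 Y13 -> ~ ladj Y23 Y13 -> False.
Proof.
move=> W1 W2 W3 W12 W23 W13 h1 h2 h3 a1 a2 n3 b2 b3 m1 c1 c3 k2 z1 z2 z3.
have side L M N Y : wf L -> wf M -> wf Y -> hE L x y -> hE M x y -> hE N x y ->
    ladj Y L -> ladj Y M -> ~ ladj Y N ->
    onR x Y L /\ onR x Y M \/ onR (- x - 1) (fx Y) (fx L) /\ onR (- x - 1) (fx Y) (fx M).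
  move=> WL WM WY hL hM hN aL aM nN.
  have nY : ~ hE Y x y.
    by move: nN hN; rewrite /ladj /hadj /hE; lia.
  case: (contact_side hL nY aL) (contact_side hM nY aM) => [r|l] [r'|l'].
  - by left.
  - by case: (contact_one_side WL WM WY hL hM nY r l').
  - by case: (contact_one_side WM WL WY hM hL nY r' l).
  - by right; split; apply: onL_fx.
have nC P Q : ~ ladj P Q -> ~ ladj Q P by move=> n /ladjC.
have nf P Q : ~ ladj P Q -> ~ ladj (fx P) (fx Q) by move=> n /ladj_fx.
case: (side _ _ _ _ W1 W2 W12 h1 h2 h3 a1 a2 n3) => [] [u1 u2];
case: (side _ _ _ _ W2 W3 W23 h2 h3 h1 b2 b3 m1) => [] [v1 v2];
case: (side _ _ _ _ W1 W3 W13 h1 h3 h2 c1 c3 k2) => [] [w1 w2].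
- by apply: (side_once W1 W2 W3 W12 W13 h1 h2 h3).
- by apply: (side_once W2 W1 W3 W12 W23 h2 h1 h3).
- by apply: (side_once W1 W2 W3 W12 W13 h1 h2 h3).
- by apply: (side_once (wf_fx W3) (wf_fx W2) (wf_fx W1) (wf_fx W23) (wf_fx W13) (hE_fx h3) (hE_fx
  h2) (hE_fx h1)); auto.
- by apply: (side_once W3 W2 W1 W23 W13 h3 h2 h1); auto.
- by apply: (side_once (wf_fx W1) (wf_fx W2) (wf_fx W3) (wf_fx W12) (wf_fx W13) (hE_fx h1) (hE_fx
  h2) (hE_fx h3)); auto.
- by apply: (side_once (wf_fx W2) (wf_fx W1) (wf_fx W3) (wf_fx W12) (wf_fx W23) (hE_fx h2) (hE_fx
  h1) (hE_fx h3)); auto.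
- by apply: (side_once (wf_fx W1) (wf_fx W2) (wf_fx W3) (wf_fx W12) (wf_fx W13) (hE_fx h1) (hE_fx
  h2) (hE_fx h3)); auto.
Qed.

Lemma hadj_helly (L1 L2 L3 : lpath) : hadj L1 L2 -> hadj L2 L3 -> hadj L1 L3 ->
  exists x y, [/\ hE L1 x y, hE L2 x y & hE L3 x y].
Proof.
rewrite /hadj /hE => A B C.
by exists (Z.max (la L1) (Z.max (la L2) (la L3))), (lr L1); split; lia.
Qed.

(* A central triangle of an S_3 cannot have its three paths share a grid edge:
   each outer vertex would leave the common edge on one of its two sides, and
   each side can serve only one of the three outer vertices.  Hence its paths
   form a claw, two of them bending at the same grid point. *)
Lemma sun_claw (L1 L2 L3 Y12 Y23 Y13 : lpath) :
  wf L1 -> wf L2 -> wf L3 -> wf Y12 -> wf Y23 -> wf Y13 ->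
  ladj L1 L2 -> ladj L2 L3 -> ladj L1 L3 ->
  ladj Y12 L1 -> ladj Y12 L2 -> ~ ladj Y12 L3 ->
  ladj Y23 L2 -> ladj Y23 L3 -> ~ ladj Y23 L1 ->
  ladj Y13 L1 -> ladj Y13 L3 -> ~ ladj Y13 L2 ->
  ~ ladj Y12 Y23 -> ~ ladj Y12 Y13 -> ~ ladj Y23 Y13 ->
  [\/ lclaw L1 L2 L3 /\ lclaw L2 L1 L3, lclaw L1 L2 L3 /\ lclaw L3 L1 L2
    | lclaw L2 L1 L3 /\ lclaw L3 L1 L2].
Proof.
move=> W1 W2 W3 W12 W23 W13 e12 e23 e13 a1 a2 n3 b2 b3 m1 c1 c3 k2 z1 z2 z3.
have hC P Q : hadj P Q -> hadj Q P by rewrite /hadj; lia.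
have nh : ~ [/\ hadj L1 L2, hadj L2 L3 & hadj L1 L3].
  move=> [h12 h23 h13]; have [x [y [h1 h2 h3]]] := hadj_helly h12 h23 h13.
  exact: (no_row_clique W1 W2 W3 W12 W23 W13 h1 h2 h3).
have nv : ~ [/\ vadj L1 L2, vadj L2 L3 & vadj L1 L3].
  move=> [h12 h23 h13].
  have [x [y [h1 h2 h3]]] := @hadj_helly (tr L1) (tr L2) (tr L3) h12 h23 h13.
  by apply: (no_row_clique (wf_tr W1) (wf_tr W2) (wf_tr W3) (wf_tr W12) (wf_tr W23)
            (wf_tr W13) h1 h2 h3); rewrite ladj_tr.
have vclaw P Q R : wf P -> wf Q -> wf R -> vadj P Q -> vadj Q R -> hadj P R -> ~ vadj P R ->
    lclaw P Q R /\ lclaw R P Q.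
  move=> WP WQ WR v1 v2 h n.
  have := @claw_of_adj (tr P) (tr Q) (tr R) (wf_tr WP) (wf_tr WQ) (wf_tr WR) v1 v2 h n.
  by rewrite !lclaw_tr.
have vC P Q : vadj P Q -> vadj Q P by rewrite /vadj; lia.
have C := lclawC.
have dec P Q : hadj P Q \/ ~ hadj P Q by rewrite /hadj; lia.
have H P Q R : wf P -> wf Q -> wf R -> hadj P Q -> hadj Q R -> vadj P R -> ~ hadj P R ->
   lclaw P Q R /\ lclaw R P Q by exact: claw_of_adj.
(* Since neither kind of contact holds for all three pairs, one kind serves two pairs and the other
   kind alone the third, as [claw_of_adj] requires. *)
case: (dec L1 L2) => [h12|h12]; case: (dec L2 L3) => [h23|h23]; case: (dec L1 L3) => [h13|h13].
- by case: nh.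
- case: e13 => // v13; apply: Or32; by have [] := H _ _ _ W1 W2 W3 h12 h23 v13 h13.
- case: e23 => // v23; apply: Or33.
  by have [] := H _ _ _ W2 W1 W3 (hC _ _ h12) h13 v23 h23; auto.
- case: e23 => // v23; case: e13 => // v13.
  have nv12 : ~ vadj L1 L2 by move=> v12; apply: nv.
  by have [] := vclaw _ _ _ W1 W3 W2 v13 (vC _ _ v23) h12 nv12; auto using Or31.
- case: e12 => // v12.
  have [] := H _ _ _ W1 W3 W2 h13 (hC _ _ h23) v12 h12; auto using Or31.
- case: e12 => // v12; case: e13 => // v13.
  have nv23 : ~ vadj L2 L3 by move=> v23; apply: nv.
  by have [] := vclaw _ _ _ W2 W1 W3 (vC _ _ v12) v13 h23 nv23; auto using Or33.
- case: e12 => // v12; case: e23 => // v23.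
  have nv13 : ~ vadj L1 L3 by move=> v13; apply: nv.
  by have [] := vclaw _ _ _ W1 W2 W3 v12 v23 h13 nv13; auto using Or32.
- by case: e12 => // v12; case: e23 => // v23; case: e13 => // v13; case: nv.
Qed.

End LPathSymmetries.

(** * Grid paths *)

Section GridPaths.
Local Open Scope Z_scope.

Section Runs.
Variables (n : nat) (X Y : nat -> Z).

Definition gridfun : Prop :=
  (forall i, (i.+1 < n)%N ->
     X i = X i.+1 /\ (Y i.+1 = Y i + 1 \/ Y i = Y i.+1 + 1) \/
     Y i = Y i.+1 /\ (X i.+1 = X i + 1 \/ X i = X i.+1 + 1)) /\
  (forall i j, (i < n)%N -> (j < n)%N -> X i = X j -> Y i = Y j -> i = j).

Definition stepH (x y : Z) : Prop := exists i, [/\ (i.+1 < n)%N, Y i = y, Y i.+1 = y &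
  X i = x /\ X i.+1 = x + 1 \/ X i.+1 = x /\ X i = x + 1].

(** A reversal of direction would return to the point visited two steps earlier, against
    injectivity. *)
Lemma straight_run (j k : nat) : gridfun -> (k < n)%N -> (j <= k)%N ->
  (forall i, (j <= i < k)%N -> Y i = Y i.+1) ->
  exists s, (s = 1 \/ s = -1) /\
    forall i, (j <= i <= k)%N -> X i = X j + s * Z.of_nat (i - j) /\ Y i = Y j.
Proof.
move=> [adj inj]; elim: k => [|k IH] kn jk flat.
  exists 1; split=> [|i ik]; first by left.
  have -> : i = j by lia.
  by rewrite subnn; lia.
have [jk'|jk'] : j = k.+1 \/ (j <= k)%N by lia.
  exists 1; split=> [|i ik]; first by left.
  have -> : i = j by lia.
  by rewrite subnn; lia.
have [|//|i ik|s [s1 run]] := IH; [lia | by apply: flat; lia|].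
have fk : Y k = Y k.+1 by apply: flat; lia.
have [Xk Yk] : X k = X j + s * Z.of_nat (k - j) /\ Y k = Y j by apply: run; lia.
have Xs : X k.+1 = X k + 1 \/ X k = X k.+1 + 1 by case: (adj k kn); lia.
have [kj|kj] : k = j \/ (j < k)%N by lia.
  exists (X k.+1 - X k); split; first lia.
  move=> i ik; have [-> | ->] : i = j \/ i = k.+1 by lia.
    by rewrite subnn; lia.
  by subst k; rewrite subSnn; lia.
have [Xk1 Yk1] : X k.-1 = X j + s * Z.of_nat (k.-1 - j) /\ Y k.-1 = Y j by apply: run; lia.
have ne : X k.+1 = X k.-1 -> False by move=> e; have := inj k.+1 k.-1; lia.
exists s; split=> // i ik; have [-> | ik'] : i = k.+1 \/ (j <= i <= k)%N by lia.
  by case: s1 => ?; subst s; lia.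
exact: run.
Qed.

End Runs.

Definition gx (s : seq gpoint) (i : nat) : Z := Z_of_int (nth (0%R, 0%R) s i).1.
Definition gy (s : seq gpoint) (i : nat) : Z := Z_of_int (nth (0%R, 0%R) s i).2.

Definition traces (s : seq gpoint) (L : lpath) : Prop :=
  forall x y, (stepH (size s) (gx s) (gy s) x y <-> hE L x y) /\
              (stepH (size s) (gy s) (gx s) y x <-> vE L x y).

Lemma grid_pathP (s : seq gpoint) :
  grid_path s <-> (0 < size s)%N /\ gridfun (size s) (gx s) (gy s).
Proof.
split.
  case: s => [//|p s] /andP[/(pathP (0%R, 0%R)) ps us]; split=> //; split=> [i il|i j il jl ex ey].
    have {ps}:= ps i il; rewrite /grid_adj /gx /gy.
    have -> : nth (0%R, 0%R) s i = nth (0%R, 0%R) (p :: s) i.+1 by [].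
    case: (nth _ _ i) => a b; case: (nth _ _ i.+1) => c d /=; lia.
  apply/eqP; rewrite -(nth_uniq (0%R, 0%R) il jl us); apply/eqP.
  move: ex ey; rewrite /gx /gy; case: (nth _ _ i) => a b; case: (nth _ _ j) => c d /=.
  by move=> ? ?; congr pair; lia.
case: s => [[]//|p s] [_ [adj inj]]; apply/andP; split.
  apply/(pathP (0%R, 0%R)) => i il; have := adj i il; rewrite /grid_adj /gx /gy.
  have -> : nth (0%R, 0%R) s i = nth (0%R, 0%R) (p :: s) i.+1 by [].
  case: (nth _ _ i) => a b; case: (nth _ _ i.+1) => c d /=; lia.
apply/(uniqP (0%R, 0%R)) => i j il jl e.
by apply: inj => //; rewrite /gx /gy e.
Qed.

Lemma horiz_gy (s : seq gpoint) (i : nat) :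
  horiz (nth (0%R, 0%R) s i) (nth (0%R, 0%R) s i.+1) = (gy s i == gy s i.+1).
Proof. by rewrite /horiz /gy; case: (nth _ _ i) => a b; case: (nth _ _ i.+1) => c d /=; lia. Qed.

Lemma count_le1P (P : pred nat) (n : nat) : (count P (iota 0 n) <= 1)%N <->
  exists2 m, (m <= n)%N & forall i, (i < n)%N -> P i -> i = m.
Proof.
split.
  elim: n => [|n IH]; first by exists 0%N.
  rewrite -addn1 iotaD count_cat /= addn0 add0n => c1.
  have [|m mn Pm] := IH; first lia.
  have [Pn|nPn] := boolP (P n).
    exists n => [|i il Pi]; first lia.
    have : ~~ has P (iota 0 n) by rewrite has_count; lia.
    have [//|ne] := eqVneq i n; move/hasPn/(_ i).
    by rewrite mem_iota Pi /= add0n (_ : (i < n)%N) => [/(_ isT)|]; lia.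
  have [mn'|mn'] := eqVneq m n; last by exists m => [|i il Pi]; [lia | apply: Pm => //;
    have [e|?] := eqVneq i n; [by rewrite e (negPf nPn) in Pi | lia]].
  exists n.+1 => [|i il Pi]; first lia.
  have [e|ne] := eqVneq i n; first by rewrite e (negPf nPn) in Pi.
  have : i = m by apply: Pm => //; lia.
  lia.
move=> [m _ Pm]; rewrite -size_filter; apply: (@uniq_leq_size _ _ [:: m]).
  by rewrite filter_uniq // iota_uniq.
by move=> i; rewrite mem_filter mem_iota inE => /andP[Pi il]; apply/eqP/Pm.
Qed.

Lemma share_traces (s t : seq gpoint) (L M : lpath) :
  grid_path s -> grid_path t -> traces s L -> traces t M -> (share_grid_edge s t <-> ladj L M).
Proof.
move=> /grid_pathP[_ [adjs _]] /grid_pathP[_ [adjt _]] rs rt.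
have pE i j : gx s i = gx t j -> gy s i = gy t j -> nth (0%R, 0%R) s i = nth (0%R, 0%R) t j.
  by rewrite /gx /gy; case: (nth _ s i) (nth _ t j) => [a b] [c d] /= ? ?; congr pair; lia.
split.
  move=> [i [j [il [jl E]]]].
  suff : exists x y, hE L x y /\ hE M x y \/ vE L x y /\ vE M x y.
    by move=> [x [y]]; rewrite /ladj /hadj /vadj /hE /vE; lia.
  have {}E : gx s i = gx t j /\ gx s i.+1 = gx t j.+1 /\ gy s i = gy t j /\ gy s i.+1 = gy t j.+1
      \/ gx s i = gx t j.+1 /\ gx s i.+1 = gx t j /\ gy s i = gy t j.+1 /\ gy s i.+1 = gy t j.
    by rewrite /gx /gy; case: E => -[-> ->]; [left|right].
  case: (adjs i il) => [[ex ey]|[ey ex]].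
    exists (gx s i), (Z.min (gy s i) (gy s i.+1)); right; split.
      by apply/(rs _ _).2; exists i; split=> //; lia.
    by apply/(rt _ _).2; exists j; split=> //; lia.
  exists (Z.min (gx s i) (gx s i.+1)), (gy s i); left; split.
    by apply/(rs _ _).1; exists i; split=> //; lia.
  by apply/(rt _ _).1; exists j; split=> //; lia.
move=> a.
have {a} [x [y]] : exists x y, hE L x y /\ hE M x y \/ vE L x y /\ vE M x y.
  case: a; rewrite /hadj /vadj /hE /vE => a.
    by exists (Z.max (la L) (la M)), (lr L); lia.
  by exists (lc L), (Z.max (ld L) (ld M)); lia.
case=> -[].
  move=> /(rs _ _).1 [i [il y1 y2 E]] /(rt _ _).1 [j [jl z1 z2 F]].
  exists i, j; split=> //; split=> //.
  by case: E F => [] [E1 E2] [] [F1 F2]; [left|right|right|left]; split; apply: pE; lia.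
move=> /(rs _ _).2 [i [il y1 y2 E]] /(rt _ _).2 [j [jl z1 z2 F]].
exists i, j; split=> //; split=> //.
by case: E F => [] [E1 E2] [] [F1 F2]; [left|right|right|left]; split; apply: pE; lia.
Qed.

(* From (x, y), n steps in the horizontal direction s, then m in the vertical direction t. *)
Definition corner_path (x y s n t m : Z) : lpath :=
  LPath y (Z.min x (x + s * n)) (Z.max x (x + s * n)) (x + s * n)
        (Z.min y (y + t * m)) (Z.max y (y + t * m)).

Lemma corner_steps (X Y : nat -> Z) (x y s t : Z) (n m : nat) :
  (s = 1 \/ s = -1) -> (t = 1 \/ t = -1) ->
  (forall i, (i <= n)%N -> X i = x + s * Z.of_nat i /\ Y i = y) ->
  (forall i, (n <= i <= n + m)%N -> X i = x + s * Z.of_nat n /\ Y i = y + t * Z.of_nat (i - n)) ->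
  forall u v, (stepH (n + m).+1 X Y u v <-> hE (corner_path x y s (Z.of_nat n) t (Z.of_nat m)) u
    v) /\
              (stepH (n + m).+1 Y X v u <-> vE (corner_path x y s (Z.of_nat n) t (Z.of_nat m)) u v).
Proof.
move=> s1 t1 run1 run2 u v; split; split.
- move=> [i [il Y1 Y2 E]]; rewrite /hE /=.
  have [ik|ik] : (i < n)%N \/ (n <= i)%N by lia.
    have [] := run1 i (ltnW ik); have [] := run1 i.+1 ik.
    by case: s1 => ?; subst s; lia.
  have [] : X i = x + s * Z.of_nat n /\ Y i = y + t * Z.of_nat (i - n) by apply: run2; lia.
  have [] : X i.+1 = x + s * Z.of_nat n /\ Y i.+1 = y + t * Z.of_nat (i.+1 - n) by apply: run2; lia.
  by lia.
- rewrite /hE /= => h.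
  have [i [il ei]] : exists i,
    (i < n)%N /\ (s = 1 /\ Z.of_nat i = u - x \/ s = -1 /\ Z.of_nat i = x - u - 1).
    case: s1 h => ? h; subst s; [exists (Z.to_nat (u - x)) | exists (Z.to_nat (x - u - 1))]; lia.
  exists i; split; first lia.
  + by have [] := run1 i (ltnW il); lia.
  + by have [] := run1 i.+1 il; lia.
  have [-> _] := run1 i (ltnW il); have [-> _] := run1 i.+1 il.
  by case: ei => -[? ?]; subst s; lia.
- move=> [i [il Y1 Y2 E]]; rewrite /vE /=.
  have [ik|ik] : (i < n)%N \/ (n <= i)%N by lia.
    have [] := run1 i (ltnW ik); have [] := run1 i.+1 ik.
    by case: s1 => ?; subst s; lia.
  have [] : X i = x + s * Z.of_nat n /\ Y i = y + t * Z.of_nat (i - n) by apply: run2; lia.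
  have [] : X i.+1 = x + s * Z.of_nat n /\ Y i.+1 = y + t * Z.of_nat (i.+1 - n) by apply: run2; lia.
  by case: t1 => ?; subst t; lia.
- rewrite /vE /= => h.
  have [i [il ei]] : exists i,
    (i < m)%N /\ (t = 1 /\ Z.of_nat i = v - y \/ t = -1 /\ Z.of_nat i = y - v - 1).
    case: t1 h => ? h; subst t; [exists (Z.to_nat (v - y)) | exists (Z.to_nat (y - v - 1))]; lia.
  have [] : X (n + i)%N = x + s * Z.of_nat n /\ Y (n + i)%N = y + t * Z.of_nat (n + i - n) by
    apply: run2; lia.
  have [] : X (n + i).+1 = x + s * Z.of_nat n /\ Y (n + i).+1 = y + t * Z.of_nat ((n + i).+1 - n)
    by apply: run2; lia.
  move=> X1 Y1 X2 Y2.
  exists (n + i)%N; split; [lia..|].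
  by rewrite Y1 Y2; case: ei => -[? ?]; subst t; lia.
Qed.

Lemma corner_path_wf x y s (n : nat) t (m : nat) : s = 1 \/ s = -1 -> t = 1 \/ t = -1 ->
  wf (corner_path x y s (Z.of_nat n) t (Z.of_nat m)).
Proof. by rewrite /wf /=; case=> ->; case=> ->; lia. Qed.

Lemma gridfunC n X Y : gridfun n X Y -> gridfun n Y X.
Proof.
case=> [adj inj]; split=> [i il|i j il jl e1 e2]; last exact: inj.
by case: (adj i il); [right|left].
Qed.

Lemma lpath_of_gridfun (n k : nat) (X Y : nat -> Z) : gridfun n X Y -> (k < n)%N ->
  (forall i, (i < k)%N -> Y i = Y i.+1) ->
  (forall i, (k <= i)%N -> (i.+1 < n)%N -> X i = X i.+1) ->
  exists2 L, wf L &
    forall x y, (stepH n X Y x y <-> hE L x y) /\ (stepH n Y X y x <-> vE L x y).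
Proof.
move=> gs kn flat1 flat2.
have [|i ik|s [s1 run1]] := straight_run (j := 0) gs kn; [lia | by apply: flat1; lia |].
have [||i ik|t [t1 run2]] := straight_run (j := k) (k := n.-1) (gridfunC gs);
  [lia.. | by apply: flat2; lia |].
exists (corner_path (X 0%N) (Y 0%N) s (Z.of_nat k) t (Z.of_nat (n.-1 - k))).
  exact: corner_path_wf.
have Xk : X k = X 0%N + s * Z.of_nat k /\ Y k = Y 0%N by rewrite -[k in Z.of_nat k]subn0;
  apply: run1; lia.
have := @corner_steps X Y (X 0%N) (Y 0%N) s t k (n.-1 - k) s1 t1.
rewrite (_ : (k + (n.-1 - k)).+1 = n); last lia.
apply=> i ik.
  by rewrite -[i in Z.of_nat i]subn0; apply: run1; lia.
by have [|-> ->] := run2 i; [lia | rewrite Xk.1 Xk.2].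
Qed.

Lemma lpath_of_seq (s : seq gpoint) : grid_path s -> (nbends s <= 1)%N ->
  exists2 L, wf L & traces s L.
Proof.
move=> /grid_pathP[s0 gs] /count_le1P[m mn bm].
have [s1|s1] : size s = 1%N \/ (1 < size s)%N by lia.
  exists (LPath 0 0 0 0 0 0); first by rewrite /wf /=; lia.
  by move=> x y; rewrite /stepH /hE /vE s1 /=; split; split=> [[i []]|]; lia.
pose same i := (gy s i == gy s i.+1) = (gy s i.+1 == gy s i.+2).
(* [k] is the index of the corner, or the last index if there is no bend. *)
have {mn bm} [k [k0 kn sameP turn]] : exists k, [/\ (0 < k)%N, (k < size s)%N,
    forall i, (i.+2 < size s)%N -> i.+1 <> k -> same i & (k.+1 < size s)%N -> ~ same k.-1].
  pose bend i := (gy s i == gy s i.+1) != (gy s i.+1 == gy s i.+2).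
  have bE i : (i.+2 < size s)%N -> bend i -> i = m.
    by move=> il bi; apply: bm; [lia | rewrite !horiz_gy].
  have nb i : ~~ bend i -> same i by move/negPn/eqP.
  have [/andP[bm1 ml]|nbm] := boolP (bend m && (m.+2 < size s)%N).
    exists m.+1; split; [lia|lia| |by move=> _ sm; move: bm1; rewrite /bend sm eqxx].
    by move=> i il im; apply: nb; apply/negP => /(bE i il) im'; lia.
  exists (size s).-1; split; [lia|lia| |lia].
  move=> i il _; apply: nb; apply: contraNN nbm => bi.
  by rewrite -(bE i il bi) bi.
have first_run : forall i, (i < k)%N -> (gy s i == gy s i.+1) = (gy s 0 == gy s 1).
  elim=> [//|i IH] ik; rewrite -sameP; [apply: IH|..]; lia.
have last_run : forall i, (k <= i)%N -> (i.+1 < size s)%N ->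
  (gy s i == gy s i.+1) = ~~ (gy s 0 == gy s 1).
  elim=> [|i IH] ki il; first by lia.
  have [e|ne] := eqVneq k i.+1.
    have := turn; rewrite /same e /= => /(_ il).
    by rewrite first_run; [do 2 case: (_ == _)|]; lia.
  by rewrite -sameP; [apply: IH|..]; lia.
have vert i : (i.+1 < size s)%N -> gy s i != gy s i.+1 -> gx s i = gx s i.+1.
  by move=> il /eqP ne; case: gs => [adj _]; case: (adj i il); lia.
have [h|h] := boolP (gy s 0 == gy s 1).
  have [||L WL tL] := lpath_of_gridfun gs kn; last by exists L.
    by move=> i ik; apply/eqP; rewrite first_run.
  by move=> i ki il; apply: vert => //; rewrite last_run // h.
(* A path that starts vertically is treated with its coordinates exchanged. *)
have [||L WL tL] := lpath_of_gridfun (gridfunC gs) kn.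
- by move=> i ik; apply: vert; [lia|rewrite first_run].
- by move=> i ki il; apply/eqP; rewrite last_run.
exists (tr L); first exact: wf_tr.
by move=> x y; have [] := tL y x; split.
Qed.

Lemma traces_ext s L M : (forall x y, (hE L x y <-> hE M x y) /\ (vE L x y <-> vE M x y)) ->
  traces s L -> traces s M.
Proof. by move=> LM tL x y; have := LM x y; have := tL x y; tauto. Qed.

Lemma seq_of_corner (x y s t : Z) (n m : nat) : s = 1 \/ s = -1 -> t = 1 \/ t = -1 ->
  exists p : seq gpoint, [/\ grid_path p, (nbends p <= 1)%N &
    traces p (corner_path x y s (Z.of_nat n) t (Z.of_nat m))].
Proof.
move=> s1 t1.
pose X i := x + s * Z.of_nat (minn i n); pose Y i := y + t * Z.of_nat (i - n).
pose p : seq gpoint := mkseq (fun i => (int_of_Z (X i), int_of_Z (Y i))) (n + m).+1.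
have sp : size p = (n + m).+1 by rewrite size_mkseq.
have pX i : (i < (n + m).+1)%N -> gx p i = X i by move=> il; rewrite /gx nth_mkseq //= int_of_ZK.
have pY i : (i < (n + m).+1)%N -> gy p i = Y i by move=> il; rewrite /gy nth_mkseq //= int_of_ZK.
exists p; split.
- apply/grid_pathP; rewrite sp; split=> //; split=> [i il|i j il jl].
    rewrite (pX i) ?(pX i.+1) ?(pY i) ?(pY i.+1); [|lia..].
    by rewrite /X /Y; case: s1 => ->; case: t1 => ->; lia.
  by rewrite !pX ?pY /X /Y //; case: s1 => ->; case: t1 => ->; lia.
- apply/count_le1P; exists (minn n.-1 (size p - 2)); first lia.
  move=> i il; rewrite !horiz_gy (pY i) ?(pY i.+1) ?(pY i.+2) /Y; [|lia..].
  by case: t1 => ->; lia.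
rewrite /traces sp; apply: corner_steps => // i ik.
  by rewrite pX ?pY /X /Y; lia.
by rewrite pX ?pY /X /Y; lia.
Qed.

Lemma seq_of_lpath (L : lpath) : wf L ->
  exists p : seq gpoint, [/\ grid_path p, (nbends p <= 1)%N & traces p L].
Proof.
move: L => [r a b c d e] W.
suff [x [y [s [n [t [m [s1 t1 E]]]]]]] : exists x y s (n : nat) t (m : nat),
   [/\ s = 1 \/ s = -1, t = 1 \/ t = -1 & forall u v,
    (hE (corner_path x y s (Z.of_nat n) t (Z.of_nat m)) u v <-> hE (LPath r a b c d e) u v) /\
    (vE (corner_path x y s (Z.of_nat n) t (Z.of_nat m)) u v <-> vE (LPath r a b c d e) u v)].
  have [p [gp bp tp]] := seq_of_corner x y n m s1 t1.
  by exists p; split=> //; apply: traces_ext tp.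
move: W; rewrite /wf /hE /vE /= => -[ab [de W]].
pose n := Z.to_nat (b - a); pose m := Z.to_nat (e - d).
(* With both parts present, the walk starts at the end of the horizontal part away from the bend;
   the last four cases are the four positions of the bend. *)
have [ad|[bc|[[h|h] [v|v]]]] : d = e \/ a = b \/ (c = a \/ c = b) /\ (r = d \/ r = e) by lia.
- by exists a, r, 1, n, 1, 0%N; split; [left..|] => // u w; rewrite /n; lia.
- by exists c, d, 1, 0%N, 1, m; split; [left..|] => // u w; rewrite /m; lia.
- by exists b, r, (-1), n, 1, m; split; [right|left|] => // u w; rewrite /n /m; lia.
- by exists b, r, (-1), n, (-1), m; split; [right|right|] => // u w; rewrite /n /m; lia.
- by exists a, r, 1, n, 1, m; split; [left|left|] => // u w; rewrite /n /m; lia.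
- by exists a, r, 1, n, (-1), m; split; [left|right|] => // u w; rewrite /n /m; lia.
Qed.

End GridPaths.

(** * Outerplanar embeddings *)

Section Embedding.
Variables (T : finType) (e : rel T).
Hypotheses (e_sym : symmetric e) (e_irr : irreflexive e).

(** With the positions read around a circle, the two truth values are the two sides of the chord
    from [u] to [v]. *)
Definition btw (pos : T -> nat) (u v p : T) : bool :=
  (pos u < pos p < pos v)%N || (pos v < pos p < pos u)%N.

Definition embedding (pos : T -> nat) : Prop :=
  injective pos /\ forall a b c d, e a b -> e c d ->
    ~ ((pos a < pos c)%N /\ (pos c < pos b)%N /\ (pos b < pos d)%N).

Lemma edge_neq x y : e x y -> x <> y.
Proof. by move=> exy xy; rewrite xy e_irr in exy. Qed.

Section FixedEmbedding.
Variable pos : T -> nat.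
Hypothesis embP : embedding pos.

Lemma pos_neq x y : x <> y -> pos x <> pos y.
Proof. by move=> xy /embP.1. Qed.

Lemma btwC u v p : btw pos u v p = btw pos v u p.
Proof. exact: orbC. Qed.

Lemma same_side u v p q : e u v -> e p q -> p <> u -> p <> v -> q <> u -> q <> v ->
  btw pos u v p = btw pos u v q.
Proof.
move=> euv epq /pos_neq pu /pos_neq pv /pos_neq qu /pos_neq qv; have [_ nc] := embP.
have evu : e v u by rewrite e_sym.
have eqp : e q p by rewrite e_sym.
have := nc _ _ _ _ euv epq; have := nc _ _ _ _ euv eqp.
have := nc _ _ _ _ evu epq; have := nc _ _ _ _ evu eqp.
have := nc _ _ _ _ epq euv; have := nc _ _ _ _ eqp euv.
have := nc _ _ _ _ epq evu; have := nc _ _ _ _ eqp evu.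
rewrite /btw; lia.
Qed.

(** Of two distinct apexes on the same side of [uv], one would send to an end of [uv] an edge
    crossing an edge of the other. *)
Lemma apex_uniq u v p q : e u v -> e u p -> e v p -> e u q -> e v q ->
  btw pos u v p = btw pos u v q -> p = q.
Proof.
move=> euv eup evp euq evq; have [//|/eqP pq] := eqVneq p q.
have up := edge_neq eup; have vp := edge_neq evp; have uq := edge_neq euq.
have vq := edge_neq evq; have uv := edge_neq euv.
have := same_side eup evq (nesym uv) vp (nesym uq) (nesym pq).
have := same_side evp euq uv up (nesym vq) (nesym pq).
move: up vp uq vq uv pq => /pos_neq up /pos_neq vp /pos_neq uq /pos_neq vq /pos_neq uv /pos_neq pq.
rewrite /btw; lia.
Qed.

Lemma no_K4 a b c d : e a b -> e a c -> e a d -> e b c -> e b d -> e c d -> False.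
Proof.
move=> ab ac ad bc bd cd; apply: (edge_neq cd).
have ne x y : e x y -> y <> x by move/edge_neq/nesym.
by apply: (@apex_uniq a b) => //; apply: same_side; auto.
Qed.

(** The rim path [v], [w], [z] avoids both ends of the spoke [xu], so [v] and [z] are apexes of [xu]
    on the same side. *)
Lemma no_W4 x u v w z : e x u -> e x v -> e x w -> e x z ->
  e u v -> e v w -> e w z -> e z u -> u <> w -> v <> z -> False.
Proof.
move=> xu xv xw xz uv vw wz zu nuw; apply; apply: (@apex_uniq x u) => //; first by rewrite e_sym.
have nx y : e x y -> y <> x by move/edge_neq/nesym.
have := edge_neq uv; have := edge_neq zu => nzu /nesym nvu.
by rewrite (same_side xu vw); try apply: (same_side xu wz); auto.
Qed.

End FixedEmbedding.

Hypothesis emax : maximal_outerplanar e.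

(** If no edge crossed the chord [xy], the positions [pos] would still be an embedding after the
    addition of [xy], against maximality. *)
Lemma crossing_edge pos x y : embedding pos -> x <> y -> ~~ e x y ->
  exists c d, [/\ e c d, c <> x /\ c <> y, d <> x /\ d <> y & btw pos x y c /\ ~~ btw pos x y d].
Proof.
move=> emb xy nexy; have /eqP xy' := xy; have := emax.2 x y xy' nexy => no.
have [/existsP[c /existsP[d /and5P[ecd /andP[cx cy] /andP[dx dy] bc bd]]]|none] :=
  boolP [exists c, exists d, [&& e c d, (c != x) && (c != y), (d != x) && (d != y),
     btw pos x y c & ~~ btw pos x y d]].
  by exists c, d; split=> //; split; apply/eqP.
case: no; exists pos; split; first exact: emb.1.
have noc c d : e c d -> c <> x -> c <> y -> d <> x -> d <> y -> btw pos x y c -> btw pos x y d.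
  move=> ecd /eqP cx /eqP cy /eqP dx /eqP dy bc; apply/negPn/negP => bd.
  by case/negP: none; apply/existsP; exists c; apply/existsP; exists d;
    rewrite ecd cx cy dx dy bc bd.
have side c d : e c d -> c <> x -> c <> y -> d <> x -> d <> y -> btw pos x y c = btw pos x y d.
  by move=> ecd cx cy dx dy; apply/idP/idP; apply: noc => //; rewrite e_sym.
have main c d a b : e c d -> (a = x /\ b = y) \/ (a = y /\ b = x) ->
    ~ ((pos a < pos c)%N /\ (pos c < pos b)%N /\ (pos b < pos d)%N) /\
    ~ ((pos c < pos a)%N /\ (pos a < pos d)%N /\ (pos d < pos b)%N).
  move=> ecd ab.
  have neq p q : (pos p < pos q)%N -> p <> q by move=> lt epq; rewrite epq ltnn in lt.
  by split=> -[l1 [l2 l3]]; have := side c d ecd; rewrite /btw;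
    case: ab => -[? ?]; subst a b; move=> H; have {}H := H
     (fun k => ltac:(subst c; lia)) (fun k => ltac:(subst c; lia))
     (fun k => ltac:(subst d; lia)) (fun k => ltac:(subst d; lia)); lia.
move=> a b c d; rewrite /add_edge => /orP[/orP[eab|/andP[/eqP-> /eqP->]]|/andP[/eqP-> /eqP->]]
  /orP[/orP[ecd|/andP[/eqP-> /eqP->]]|/andP[/eqP-> /eqP->]]; try lia.
- exact: emb.2.
- by apply: (main _ _ _ _ eab _).2; left.
- by apply: (main _ _ _ _ eab _).2; right.
- by apply: (main _ _ _ _ ecd _).1; left.
- by apply: (main _ _ _ _ ecd _).1; right.
Qed.

(** Take for [q] the last neighbour of [u] between [u] and [v]: an edge crossing the chord [qv]
    would end at [u], against this choice, or cross [uq] or [uv]. *)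
Lemma inside_apex pos u v p : embedding pos -> e u v -> (pos u < pos p < pos v)%N ->
  exists q, [/\ (pos u < pos q < pos v)%N, e u q & e v q].
Proof.
move=> emb euv upv.
pose A q := e u q && (pos u < pos q < pos v)%N.
have [q0 Aq0] : exists q, A q.
  (* The vertex following [u] is adjacent to [u], since no vertex between them can carry a crossing
     edge. *)
  have [s us smin] : exists2 s, (pos u < pos s < pos v)%N & forall q,
    (pos u < pos q < pos v)%N -> (pos s <= pos q)%N.
    by case: (@arg_minnP _ p (fun q => pos u < pos q < pos v)%N pos upv) => s; exists s.
  exists s; rewrite /A us andbT; apply/negPn/negP => nes.
  have us' : u <> s by move=> us'; rewrite us' ltnn in us.
  have [c [d [_ _ _ [bc _]]]] := crossing_edge emb us' nes.
  have := smin c; move: bc; rewrite /btw; lia.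
have [q /andP[euq uq] qmax] : exists2 q, A q & forall r, A r -> (pos r <= pos q)%N.
  by case: (@arg_maxnP _ q0 A pos Aq0) => q; exists q.
exists q; split=> //; rewrite e_sym; apply/negPn/negP => neqv.
have qv : q <> v by move=> qv; rewrite qv ltnn andbF in uq.
have [c [d [ecd [cq cv] [dq dv] [bc bd]]]] := crossing_edge emb qv neqv.
have [du|du] := eqVneq d u.
  rewrite du in ecd; have : A c by rewrite /A e_sym ecd; move: bc uq; rewrite /btw; lia.
  by move/qmax; move: bc uq; rewrite /btw; lia.
have cu : c <> u by move=> cu; move: bc uq; rewrite cu /btw; lia.
have := same_side emb euv ecd cu cv (elimN eqP du) dv.
move: uq; have := same_side emb euq ecd cu cq (elimN eqP du) dq.
have := pos_neq emb (elimN eqP du); have := pos_neq emb dq; have := pos_neq emb dv.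
move: bc bd; rewrite /btw; lia.
Qed.

(** The circle is cut open at [k]: positions below [k] move past all others. *)
Definition rotate (pos : T -> nat) (k : nat) (x : T) : nat :=
  if (pos x < k)%N then (pos x + (\max_(y : T) pos y).+1)%N else pos x.

Lemma rotate_embedding pos k : embedding pos -> embedding (rotate pos k).
Proof.
move=> [inj nc]; have bnd x : (pos x <= \max_(y : T) pos y)%N by exact: leq_bigmax.
split=> [x y|a b c d eab ecd].
  have := bnd x; have := bnd y; rewrite /rotate => bx by' E; apply: inj; move: E.
  by case: (ltnP (pos x) k); case: (ltnP (pos y) k); lia.
have eba : e b a by rewrite e_sym. have edc : e d c by rewrite e_sym.
have := nc _ _ _ _ eab ecd; have := nc _ _ _ _ ecd eba.
have := nc _ _ _ _ eba edc; have := nc _ _ _ _ edc eab.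
have := bnd a; have := bnd b; have := bnd c; have := bnd d.
rewrite /rotate.
by case: (ltnP (pos a) k); case: (ltnP (pos b) k); case: (ltnP (pos c) k);
  case: (ltnP (pos d) k); lia.
Qed.

(** If [u] precedes [v], cutting the circle open at [v] turns the outer side of [uv] into the
    vertices between [v] and [u], where [inside_apex] applies. *)
Lemma side_apex pos u v p : embedding pos -> e u v -> p <> u -> p <> v ->
  exists q, [/\ e u q, e v q & btw pos u v q = btw pos u v p].
Proof.
move=> emb euv pu pv; have pn := pos_neq emb.
have puv := pn _ _ (edge_neq euv); have ppu := pn _ _ pu; have ppv := pn _ _ pv.
have evu : e v u by rewrite e_sym.
wlog uv : u v euv evu pu pv puv ppu ppv / (pos u < pos v)%N.
  move=> W; have [uv|vu] : (pos u < pos v)%N \/ (pos v < pos u)%N by lia.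
    exact: W.
  have [q [? ? bq]] := W v u evu euv pv pu (nesym puv) ppv ppu vu.
    by exists q; rewrite btwC bq btwC.
have [bp|bp] := boolP (btw pos u v p).
  have [|q [bq uq vq]] := inside_apex (p := p) emb euv; first by move: bp; rewrite /btw; lia.
  by exists q; split=> //; rewrite /btw bq.
have bnd x : (pos x <= \max_(y : T) pos y)%N by exact: leq_bigmax.
have bp' : (rotate pos (pos v) v < rotate pos (pos v) p < rotate pos (pos v) u)%N.
  by move: bp (bnd u) (bnd v) (bnd p); rewrite /btw /rotate;
     case: (ltnP (pos u) (pos v)); case: (ltnP (pos v) (pos v)); case: (ltnP (pos p) (pos v)); lia.
have [q [bq vq uq]] := inside_apex (rotate_embedding (pos v) emb) evu bp'.
exists q; split=> //.
by move: bq (bnd u) (bnd v) (bnd q); rewrite /btw /rotate;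
     case: (ltnP (pos u) (pos v)); case: (ltnP (pos v) (pos v)); case: (ltnP (pos q) (pos v)); lia.
Qed.

End Embedding.

(** * Internal triangles *)

Definition linked (s : seq (nat * nat)) (i j : nat) : bool := ((i, j) \in s) || ((j, i) \in s).

Definition S3_edges : seq (nat * nat) :=
  [:: (0,1); (0,2); (1,2); (0,3); (1,3); (1,4); (2,4); (2,5); (0,5)]%N.

Lemma sun_adj (T : finType) (e : rel T) (f : 'I_6 -> T) i j : S3_copy e f ->
  (i < 6)%N -> (j < 6)%N -> i != j -> e (f (inord i)) (f (inord j)) = linked S3_edges i j.
Proof.
move=> [_ fe] il jl ij; rewrite -fe; first by rewrite /S3 /rel_of_edges !inordK.
by rewrite -(inj_eq val_inj) /= !inordK.
Qed.

Lemma sun_neq (T : finType) (e : rel T) (f : 'I_6 -> T) i j : S3_copy e f ->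
  (i < 6)%N -> (j < 6)%N -> i != j -> f (inord i) <> f (inord j).
Proof. by move=> [inj _] il jl /eqP ij /inj/(congr1 val); rewrite /= !inordK. Qed.

Section InternalTriangles.
Variables (T : finType) (e : rel T) (pos : T -> nat).
Hypotheses (e_sym : symmetric e) (e_irr : irreflexive e) (emb : embedding e pos).

Definition inner (u v : T) : bool :=
  e u v && [exists p, exists q, [&& e u p, e v p, e u q, e v q & btw pos u v p != btw pos u v q]].

(* In a maximal outerplanar graph these are the central triangles of the copies of S_3,
   see sun_of_itri and itri_of_sun; ired is then the edge relation of the reduced graph. *)
Definition itri (u v w : T) : bool :=
  [&& e u v, e u w, e v w, inner u v, inner u w & inner v w].

Definition ired (u v : T) : bool := [exists w, itri u v w].

Lemma innerP u v p q : e u v -> e u p -> e v p -> e u q -> e v q ->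
  btw pos u v p != btw pos u v q -> inner u v.
Proof.
move=> uv up vp uq vq b; rewrite /inner uv; apply/existsP; exists p; apply/existsP; exists q.
by rewrite up vp uq vq b.
Qed.

Lemma inner_apexes u v p q : e u v -> e u p -> e v p -> e u q -> e v q -> p <> q -> inner u v.
Proof.
move=> uv up vp uq vq pq; apply: (innerP uv up vp uq vq); apply/eqP => b.
by apply: pq; apply: (apex_uniq e_sym e_irr emb uv).
Qed.

Lemma innerC u v : inner u v = inner v u.
Proof.
rewrite /inner e_sym; congr (_ && _); apply: eq_existsb => p; apply: eq_existsb => q.
by rewrite !(btwC pos u v) andbCA; congr [&& _, _ & _]; rewrite andbCA.
Qed.

Lemma inner_edge u v : inner u v -> e u v. Proof. by case/andP. Qed.

Lemma opposite_apex u v w : inner u v -> e u w -> e v w ->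
  exists y, [/\ e u y, e v y & btw pos u v y != btw pos u v w].
Proof.
case/andP=> _ /existsP[p /existsP[q /and5P[up vp uq vq b]]] uw vw.
have [bp|bp] := eqVneq (btw pos u v p) (btw pos u v w).
  by exists q; split=> //; rewrite -bp eq_sym.
by exists p.
Qed.

Lemma itri_swap12 u v w : itri u v w -> itri v u w.
Proof. by case/and5P=> a b c d /andP[x y]; rewrite /itri e_sym a c b innerC d y x. Qed.

Lemma itri_swap23 u v w : itri u v w -> itri u w v.
Proof. by case/and5P=> a b c d /andP[x y]; rewrite /itri b a e_sym c x d innerC y. Qed.

Lemma itri_edges u v w : itri u v w -> [/\ e u v, e u w & e v w].
Proof. by case/and5P. Qed.

Lemma itri_inner u v w : itri u v w -> [/\ inner u v, inner u w & inner v w].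
Proof. by case/and5P=> _ _ _ ? /andP[]. Qed.

Lemma ired_itri u v w : itri u v w -> ired u v.
Proof. by move=> t; apply/existsP; exists w. Qed.

Lemma ired_inner u v : ired u v -> inner u v.
Proof. by case/existsP=> w /itri_inner[]. Qed.

Lemma ired_edge u v : ired u v -> e u v.
Proof. by move/ired_inner/inner_edge. Qed.

Lemma iredC u v : ired u v = ired v u.
Proof. by apply: eq_existsb => w; apply/idP/idP; apply: itri_swap12. Qed.

Lemma itri_of_ired u v w : ired u v -> ired u w -> ired v w -> itri u v w.
Proof.
by move=> /ired_inner a /ired_inner b /ired_inner c; rewrite /itri a b c !inner_edge.
Qed.

(** Being adjacent to [w], the vertex [z] lies on its side of [uv], and [uv] separates this side
    from [y]. *)
Lemma apex_far u v w y z : e u v -> btw pos u v y != btw pos u v w -> e u y -> e v y ->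
  e u w -> e v w -> e w z -> z <> u -> z <> v -> ~~ e y z /\ y <> z.
Proof.
move=> uv /eqP b uy vy uw vw wz zu zv.
have ne a c : e a c -> c <> a by move/(edge_neq e_irr)/nesym.
have wzs : btw pos u v w = btw pos u v z by apply: (same_side e_sym emb uv wz); auto.
split; last by move=> yz; apply: b; rewrite wzs yz.
by apply/negP => yz; apply: b; rewrite wzs; apply: (same_side e_sym emb uv yz); auto.
Qed.

(** The outer vertices are the apexes across the three sides; each side separates its apex from the
    other vertices, so no unwanted edges arise. *)
Lemma sun_of_itri u v w : itri u v w -> exists f : 'I_6 -> T, S3_copy e f /\
  [/\ f (inord 0) = u, f (inord 1) = v & f (inord 2) = w].
Proof.
move=> t; have [uv uw vw] := itri_edges t; have [iuv iuw ivw] := itri_inner t.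
have vu : e v u by rewrite e_sym. have wu : e w u by rewrite e_sym. have wv : e w v by rewrite
  e_sym.
have [y1 [uy1 vy1 b1]] := opposite_apex iuv uw vw.
have [y2 [vy2 wy2 b2]] := opposite_apex ivw vu wu.
have [y3 [uy3 wy3 b3]] := opposite_apex iuw uv wv.
have ne a c : e a c -> c <> a by move/(edge_neq e_irr)/nesym.
have yw : ~~ e y1 w /\ y1 <> w.
  by split; [apply/negP => yw; case/eqP: b1; apply: (same_side e_sym emb uv yw); auto
    | move=> E; rewrite E eqxx in b1].
have yu : ~~ e y2 u /\ y2 <> u.
  by split; [apply/negP => yw'; case/eqP: b2; apply: (same_side e_sym emb vw yw'); auto
    | move=> E; rewrite E eqxx in b2].
have yv : ~~ e y3 v /\ y3 <> v.
  by split; [apply/negP => yw'; case/eqP: b3; apply: (same_side e_sym emb uw yw'); auto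
    | move=> E; rewrite E eqxx in b3].
have y12 : ~~ e y1 y2 /\ y1 <> y2.
  by apply: (apex_far uv b1) => //; [exact: yu.2 | exact: ne].
have y13 : ~~ e y1 y3 /\ y1 <> y3.
  by apply: (apex_far uv b1) => //; [exact: ne | exact: yv.2].
have y23 : ~~ e y2 y3 /\ y2 <> y3.
  by apply: (apex_far vw b2) => //; [exact: yv.2 | exact: ne].
pose s := [:: u; v; w; y1; y2; y3].
exists (fun i : 'I_6 => nth u s i); split; last by rewrite !inordK.
have us : uniq s.
  case: yw yu yv y12 y13 y23 => [_ n1] [_ n2] [_ n3] [_ n4] [_ n5] [_ n6].
  have n a c : e a c -> a <> c by exact: edge_neq.
  by rewrite /= !inE !negb_or; do ?[apply/andP; split] => //; apply/eqP; auto.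
split=> [i j E|].
  by apply/val_inj/eqP; rewrite -(nth_uniq u _ _ us) //=; apply/eqP.
move=> i j; have : (i < 6)%N && (j < 6)%N by rewrite !ltn_ord.
rewrite /S3 /rel_of_edges -(inj_eq val_inj) /=.
case: (nat_of_ord i) => [|[|[|[|[|[|//]]]]]]; case: (nat_of_ord j) => [|[|[|[|[|[|//]]]]]] //= _ _;
  rewrite ?[in RHS]e_irr ?uv ?uw ?vw ?vu ?wu ?wv ?uy1 ?vy1 ?vy2 ?wy2 ?uy3 ?wy3 //;
  rewrite 1?e_sym ?uv ?uw ?vw ?vu ?wu ?wv ?uy1 ?vy1 ?vy2 ?wy2 ?uy3 ?wy3 //;
  case: yw yu yv y12 y13 y23 =>
    [/negPf E1 _] [/negPf E2 _] [/negPf E3 _] [/negPf E4 _] [/negPf E5 _] [/negPf E6 _];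
  by rewrite ?E1 ?E2 ?E3 ?E4 ?E5 ?E6 // 1?e_sym ?E1 ?E2 ?E3 ?E4 ?E5 ?E6.
Qed.

Lemma itri_of_sun (f : 'I_6 -> T) : S3_copy e f -> itri (f (inord 0)) (f (inord 1)) (f (inord 2)).
Proof.
move=> Sf; have E i j := @sun_adj _ e f i j Sf; have neq i j := @sun_neq _ e f i j Sf.
rewrite /itri !E //=; apply/and3P; split.
- by apply: (inner_apexes (p := f (inord 2)) (q := f (inord 3))); rewrite ?E //; exact: neq.
- by apply: (inner_apexes (p := f (inord 1)) (q := f (inord 5))); rewrite ?E //; exact: neq.
- by apply: (inner_apexes (p := f (inord 0)) (q := f (inord 4))); rewrite ?E //; exact: neq.
Qed.

Lemma colored_edgeP u v : colored_edge e u v <-> ired u v.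
Proof.
split.
  move=> [euv [f [/itri_of_sun t [i [j [i3 [j3 [ui vj]]]]]]]].
  have fin (k : 'I_6) : f k = f (inord k) by rewrite inord_val.
  have := euv; rewrite ui vj (fin i) (fin j).
  have t1 := itri_swap12 t; have t2 := itri_swap23 t.
  case: (nat_of_ord i) i3 => [|[|[|//]]] _; case: (nat_of_ord j) j3 => [|[|[|//]]] _;
    rewrite ?e_irr // => _.
  - exact: (ired_itri t).
  - exact: (ired_itri t2).
  - exact: (ired_itri t1).
  - exact: (ired_itri (itri_swap23 t1)).
  - by rewrite iredC; exact: (ired_itri t2).
  - by rewrite iredC; exact: (ired_itri (itri_swap23 t1)).
case/existsP=> w t; have [uv _ _] := itri_edges t; split=> //.
have [f [Sf [fu fv _]]] := sun_of_itri t; exists f; split=> //.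
by exists (inord 0), (inord 1); rewrite !inordK.
Qed.

Lemma colored_vertexP u : colored_vertex e u <-> exists v w, itri u v w.
Proof.
split.
  move=> [f [/itri_of_sun t [i [i3 ->]]]]; rewrite -(inord_val i).
  case: (nat_of_ord i) i3 => [|[|[|//]]] _; do 2 eexists; first exact: t.
    exact: itri_swap12 t.
  exact: itri_swap12 (itri_swap23 t).
move=> [v [w t]]; have [f [Sf [fu fv _]]] := sun_of_itri t; exists f; split=> //.
by exists (inord 0); rewrite inordK.
Qed.

(* On the outer side of a side of an internal triangle that does not bound a
   further internal triangle, one of its two ends has no edge of the reduced graph. *)
Lemma one_owner u w v p p' : maximal_outerplanar e -> inner u w -> v <> u -> v <> w ->
  ired u p -> ired w p' -> p <> w -> p' <> u ->
  btw pos u w p != btw pos u w v -> btw pos u w p' != btw pos u w v ->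
  exists2 q, itri u w q & btw pos u w q != btw pos u w v.
Proof.
move=> emax iuw vu vw up wp' pw p'u bp bp'.
have uw := inner_edge iuw; have eup := ired_edge up; have ewp' := ired_edge wp'.
have ne a c : e a c -> c <> a by move/(edge_neq e_irr)/nesym.
have pu := ne _ _ eup; have p'w := ne _ _ ewp'.
have [q [uq wq bq]] := side_apex e_sym e_irr emax emb uw pu pw.
exists q; last by rewrite bq.
have bqp' : btw pos u w q = btw pos u w p'.
  by rewrite bq; move: bp bp'; do 3 case: (btw _ _ _ _).
(* The edge [ar] cannot cross [cq], so [r], if different from [q], lies beyond [aq] as seen from
   [c]; this gives [aq] an apex on that side. *)
have half a c r : inner a c -> e a q -> e c q -> ired a r -> r <> c ->
  btw pos a c q = btw pos a c r -> inner a q.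
  move=> iac aq cq ar rc bqr; have ear := ired_edge ar.
  have [<-|/eqP rq] := eqVneq r q; first exact: ired_inner.
  have ac := inner_edge iac; have ca : e c a by rewrite e_sym.
  have ra := ne _ _ ear; have ca' := ne _ _ ac; have cq' := ne _ _ cq; have aq' := ne _ _ aq.
  have [x [ax qx bx]] := side_apex e_sym e_irr emax emb aq ra rq.
  apply: (innerP aq ax qx ac); first by rewrite e_sym.
  rewrite bx; have := same_side e_sym emb cq ear (nesym ca') (nesym aq') rc rq.
  move: bqr (pos_neq emb ra) (pos_neq emb rq) (pos_neq emb rc) (pos_neq emb ca') (pos_neq emb
    cq') (pos_neq emb aq').
  by rewrite /btw; clear; lia.
have iuq : inner u q by apply: (half u w p).
have iwq : inner w q.
  apply: (half w u p') => //; first by rewrite innerC.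
  by rewrite !(btwC pos w u).
by rewrite /itri uw uq wq iuw iuq iwq.
Qed.

End InternalTriangles.

(** * Claimings: from B_1, and to M-freeness *)

Section Claims.
Variables (T : finType) (e : rel T) (pos : T -> nat).
Hypotheses (e_sym : symmetric e) (e_irr : irreflexive e) (emb : embedding e pos).
Local Notation itri := (itri e pos).
Local Notation ired := (ired e pos).

(* cl x t: the bend of x is spent on the internal triangle t. *)
Definition claiming (cl : T -> {set T} -> Prop) : Prop :=
  (forall u v w, itri u v w ->
     [\/ cl u [set u; v; w] /\ cl v [set u; v; w], cl u [set u; v; w] /\ cl w [set u; v; w]
       | cl v [set u; v; w] /\ cl w [set u; v; w]]) /\
  (forall x t t', cl x t -> cl x t' -> t = t').

Lemma set3_swap12 (x y z : T) : [set x; y; z] = [set y; x; z].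
Proof. by rewrite (setUC [set x]). Qed.

Lemma set3_swap23 (x y z : T) : [set x; y; z] = [set x; z; y].
Proof. exact: setUAC. Qed.

Lemma claiming_of_B1 : in_B1 e -> exists cl, claiming cl.
Proof.
move=> [P [gP eP]].
have /fin_all_exists2[L WL tL] v : exists2 L, wf L & traces (P v) L by apply: lpath_of_seq;
  case: (gP v).
have eL u v : u <> v -> (e u v <-> ladj (L u) (L v)).
  move=> /eqP uv; rewrite (eP u v uv).
  by apply: share_traces; [case: (gP u) | case: (gP v) | |].
have eL1 u v : e u v -> ladj (L u) (L v) by move=> uv; apply/eL => //; apply: (edge_neq e_irr).
have eL2 u v : u <> v -> ~~ e u v -> ~ ladj (L u) (L v) by move=> uv /negP n /(eL u v uv).
pose cl x t := exists u v, t = [set x; u; v] /\ [/\ e x u, e x v, e u v & lclaw (L x) (L u) (L v)].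
exists cl; split=> [u v w t|x t t'].
  have [uv uw vw] := itri_edges t.
  suff [[c1 c2]|[c1 c2]|[c1 c2]] : [\/ lclaw (L u) (L v) (L w) /\ lclaw (L v) (L u) (L w),
       lclaw (L u) (L v) (L w) /\ lclaw (L w) (L u) (L v)
     | lclaw (L v) (L u) (L w) /\ lclaw (L w) (L u) (L v)].
  - by apply: Or31; split; [exists v, w | exists u, w; rewrite set3_swap12 e_sym].
  - by apply: Or32; split; [exists v, w | exists u, v; rewrite set3_swap23 set3_swap12 !(e_sym w)].
  - by apply: Or33; split; [exists u, w; rewrite set3_swap12 e_sym
                          | exists u, v; rewrite set3_swap23 set3_swap12 !(e_sym w)].
  have [f [Sf [<- <- <-]]] := sun_of_itri e_sym e_irr emb t.
  have yes i j : (i < 6)%N -> (j < 6)%N -> i != j -> linked S3_edges i j ->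
      ladj (L (f (inord i))) (L (f (inord j))).
    by move=> il jl ij; rewrite -(sun_adj Sf) //; apply: eL1.
  have no i j : (i < 6)%N -> (j < 6)%N -> i != j -> ~~ linked S3_edges i j ->
      ~ ladj (L (f (inord i))) (L (f (inord j))).
    by move=> il jl ij; rewrite -(sun_adj Sf) // => n; apply: eL2 => //; apply: (sun_neq Sf).
  by apply: (@sun_claw (L (f (inord 0))) (L (f (inord 1))) (L (f (inord 2)))
     (L (f (inord 3))) (L (f (inord 4))) (L (f (inord 5)))) => //; (exact: yes || exact: no).
(* The two neighbours are named so that the first has the horizontal edge at the bend of [x] and the
   second the vertical one. *)
have norm s : cl x s -> exists u v, s = [set x; u; v] /\
    [/\ e x u, e x v, e u v & [/\ hasH (L x) (L u), ~ hasV (L x) (L u),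
      hasV (L x) (L v) & ~ hasH (L x) (L v)]].
  move=> [u [v [-> [xu xv uv [_ [[a [b [c d]]]|[a [b [c d]]]]]]]]]; first by exists u, v.
  by exists v, u; rewrite set3_swap23 (e_sym v).
move=> /norm[u [v [-> [xu xv uv [hu nu hv nv]]]]] /norm[u' [v' [-> [xu' xv' uv' [hu' nu' hv'
  nv']]]]].
have hh : u = u' \/ e u u'.
  have [|/eqP ne] := eqVneq u u'; [by left | right; apply/eL => //; left].
  by move: hu hu'; rewrite /hasH /hE /hadj; clear; lia.
have vv : v = v' \/ e v v'.
  have [|/eqP ne] := eqVneq v v'; [by left | right; apply/eL => //; right].
  by move: hv hv'; rewrite /hasV /vE /vadj; clear; lia.
have uv'' : u <> v' by move=> E; apply: nu; rewrite E.
have u'v : u' <> v by move=> E; apply: nu'; rewrite E.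
(* If one neighbour differs, [x] and the three neighbours form a K_4; if both differ, the four
   neighbours are the rim of a wheel with hub [x]. *)
case: hh vv => [E|uu'] [E'|vv']; try subst u'; try subst v'; first by [].
- by case: (no_K4 e_sym e_irr emb xu xv xv' uv uv' vv').
- by case: (no_K4 e_sym e_irr emb xu xu' xv uu' uv) => //; rewrite e_sym.
- by case: (@no_W4 _ e e_sym e_irr pos emb x u u' v' v) => //; rewrite e_sym.
Qed.

Variable cl : T -> {set T} -> Prop.
Hypothesis clP : claiming cl.

(** Two triangles with a common side need four claims and have only four vertices together, so each
    of these is spent on one of the two. *)
Lemma diamond_claim u v w z x : itri u v w -> itri u v z -> w <> z -> x \in [set u; v; w; z] ->
  cl x [set u; v; w] \/ cl x [set u; v; z].
Proof.
move=> t1 t2 wz.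
have ne : [set u; v; w] <> [set u; v; z].
  move/setP/(_ w); rewrite !inE eqxx orbT /=.
  have [_ /(edge_neq e_irr)/nesym/eqP/negPf-> /(edge_neq e_irr)/nesym/eqP/negPf->] := itri_edges t1.
  by move/esym/eqP.
have un y : cl y [set u; v; w] -> cl y [set u; v; z] -> False by move=> a /(clP.2 _ _ _ a).
rewrite !inE => /orP[/orP[/orP[]|]|] /eqP->;
case: (clP.1 _ _ _ t1) => -[a1 a2]; case: (clP.1 _ _ _ t2) => -[b1 b2]; eauto;
  by [case: (un _ a1 b1) | case: (un _ a1 b2) | case: (un _ a2 b1) | case: (un _ a2 b2)].
Qed.

(** The second vertex [k] of [t] tells [t] apart from a triangle that meets the diamond in [a1]
    only. *)
Lemma claimed_in_diamond (c : bool) a1 a2 a3 a4 :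
  ired a1 a2 -> ired a2 a3 -> ired a3 a4 -> ired a4 a1 ->
  (if c then ired a1 a3 else ired a2 a4) -> a1 <> a3 -> a2 <> a4 ->
  exists t, [/\ cl a1 t, t \subset [set a1; a2; a3; a4] & exists2 k, k \in t & k \in [set a2; a3;
    a4]].
Proof.
move=> e12 e23 e34 e41 ch n13 n24.
have iC x y : ired x y -> ired y x by rewrite iredC.
have tri x y z : ired x y -> ired x z -> ired y z -> itri x y z by exact: itri_of_ired.
case: c ch => ch.
  have t1 := tri _ _ _ ch e12 (iC _ _ e23); have t2 := tri _ _ _ ch (iC _ _ e41) e34.
  have := @diamond_claim a1 a3 a2 a4 a1 t1 t2 n24; rewrite !inE eqxx => -[//|cc|cc].
    exists [set a1; a3; a2]; split=> //; last by exists a2; rewrite !inE eqxx ?orbT.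
    by apply/subsetP => y; rewrite !inE => /orP[/orP[]|] ->; rewrite ?orbT.
  exists [set a1; a3; a4]; split=> //; last by exists a4; rewrite !inE eqxx ?orbT.
  by apply/subsetP => y; rewrite !inE => /orP[/orP[]|] ->; rewrite ?orbT.
have t1 := tri _ _ _ ch (iC _ _ e12) e41; have t2 := tri _ _ _ ch e23 (iC _ _ e34).
have := @diamond_claim a2 a4 a1 a3 a1 t1 t2 n13; rewrite !inE eqxx !orbT => -[//|cc|cc].
  exists [set a2; a4; a1]; split=> //; last by exists a2; rewrite !inE eqxx ?orbT.
  by apply/subsetP => y; rewrite !inE => /orP[/orP[]|] ->; rewrite ?orbT.
exists [set a2; a4; a3]; split=> //; last by exists a2; rewrite !inE eqxx ?orbT.
by apply/subsetP => y; rewrite !inE => /orP[/orP[]|] ->; rewrite ?orbT.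
Qed.

(** The diamond on [d1] to [d4] uses up the claims of its vertices; the third triangle needs two
    claims and has only [d5] left. *)
Lemma claiming_M1_free : ~ induced_in_reduced e M1.
Proof.
move=> [f [inj [_ fe]]].
have ed i j : (i < 5)%N -> (j < 5)%N -> i != j ->
    ((i, j) \in [:: (0,1); (0,2); (1,2); (2,3); (1,3); (3,4); (1,4)]%N) ->
    ired (f (inord i)) (f (inord j)).
  move=> il jl ij h; apply/(colored_edgeP e_sym e_irr emb)/fe.
    by rewrite -(inj_eq val_inj) /= !inordK.
  by rewrite /M1 /rel_of_edges !inordK // h.
have neq i j : (i < 5)%N -> (j < 5)%N -> i != j -> f (inord i) <> f (inord j).
  by move=> il jl /eqP ij /inj/(congr1 val); rewrite /= !inordK.
have tri i j k := @itri_of_ired _ e pos (f (inord i)) (f (inord j)) (f (inord k)).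
have t0 := tri 1%N 2%N 0%N (ed 1%N 2%N isT isT isT isT)
  (etrans (iredC pos e_sym _ _) (ed 0%N 1%N isT isT isT isT)) (etrans (iredC pos e_sym _ _) (ed
    0%N 2%N isT isT isT isT)).
have t1 := tri 1%N 2%N 3%N (ed 1%N 2%N isT isT isT isT) (ed 1%N 3%N isT isT isT isT) (ed 2%N 3%N
  isT isT isT isT).
have t2 := tri 1%N 3%N 4%N (ed 1%N 3%N isT isT isT isT) (ed 1%N 4%N isT isT isT isT) (ed 3%N 4%N
  isT isT isT isT).
have dc x := diamond_claim (x := x) t0 t1 (neq 0%N 3%N isT isT isT).
have no x : x \in [set f (inord 1); f (inord 2); f (inord 0); f (inord 3)] ->
    cl x [set f (inord 1); f (inord 3); f (inord 4)] -> False.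
  move=> /dc cx cx'; case: cx => /(clP.2 _ _ _ cx')/setP/(_ (f (inord 4)));
  rewrite !inE eqxx orbT => /esym/orP[/orP[]|] /eqP; exact: neq.
by case: (clP.1 _ _ _ t2) => -[c1 c2]; [case: (no _ _ c1)|case: (no _ _ c1)|case: (no _ _ c1)];
  rewrite !inE eqxx ?orbT.
Qed.

(** Claims are forced along the chain: [a1] is spent on the first diamond, so each triangle is
    claimed by its two later vertices, and [b1] is already spent when the second diamond needs all
    four of its vertices. *)
Lemma claiming_M1l_free l ca cb : ~ induced_in_reduced e (M1l l ca cb).
Proof.
move=> [f [inj [_ fe]]].
have n0 : (0 < 2 * l + 7)%N by lia.
pose F k := f (insubd (Ordinal n0) k).
have FE k (kl : (k < 2 * l + 7)%N) : F k = f (Ordinal kl).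
  by rewrite /F; congr f; apply: val_inj; rewrite /= val_insubd kl.
have ed i j : (i < 2 * l + 7)%N -> (j < 2 * l + 7)%N -> i != j ->
    ((i, j) \in M1l_edges l ca cb) -> ired (F i) (F j).
  move=> il jl ij h; apply/(colored_edgeP e_sym e_irr emb); rewrite !FE; apply/fe.
    by rewrite -(inj_eq val_inj).
  by rewrite /M1l /rel_of_edges /= h.
have neq i j : (i < 2 * l + 7)%N -> (j < 2 * l + 7)%N -> i != j -> F i <> F j.
  by move=> il jl /eqP ij; rewrite !FE => /inj/(congr1 val).
have tri i j k := @itri_of_ired _ e pos (F i) (F j) (F k).
have cl_lt k : (k <= 2 * l)%N -> (cidx k < 2 * l + 7)%N by rewrite /cidx; case: eqP; lia.
have chain i : (i < l)%N -> itri (F (cidx (2 * i))) (F (2 * i + 7)%N) (F (2 * i + 8)%N).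
  move=> il.
  have E j k : (j, k) \in [:: (cidx (2 * i), (2 * i + 7)); ((2 * i + 7), (2 * i + 8));
       (cidx (2 * i), (2 * i + 8))]%N -> (j, k) \in M1l_edges l ca cb.
    move=> h; rewrite /M1l_edges !mem_cat; apply/orP; right; apply/orP; right.
    apply/flattenP; exists [:: (cidx (2 * i), (2 * i + 7)); ((2 * i + 7), (2 * i + 8));
       (cidx (2 * i), (2 * i + 8))]%N => //.
    apply/mapP; exists i.+1; first by rewrite mem_iota; lia.
    have -> : (2 * i.+1 - 2 = 2 * i)%N by lia.
    have -> : cidx (2 * i.+1 - 1) = (2 * i + 7)%N by rewrite /cidx; case: eqP; lia.
    by have -> : cidx (2 * i.+1) = (2 * i + 8)%N by rewrite /cidx; case: eqP; lia.
  have cv : cidx (2 * i) = (2 * i + 6)%N \/ cidx (2 * i) = 0%N by rewrite /cidx; case: eqP; lia.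
  by apply: tri; apply: ed; try lia; apply: E; rewrite !inE eqxx ?orbT.
(* The end of the chain after [i] triangles is spent on a set [t] that contains an earlier vertex
   [F k], so [t] is none of the later triangles. *)
have inv i : (i <= l)%N -> exists t k, [/\ cl (F (cidx (2 * i))) t, F k \in t &
    (0 < k < 4)%N || (7 <= k < cidx (2 * i))%N].
  elim: i => [|i IH] il.
    have A j k : (j, k) \in [:: (0,1); (1,2); (2,3); (3,0); (if ca then (0,2) else (1,3))]%N ->
       (j, k) \in M1l_edges l ca cb by move=> h; rewrite /M1l_edges !mem_cat h.
    have [|||||||t [ct _ [k kt]]] := @claimed_in_diamond ca (F 0%N) (F 1%N) (F 2%N) (F 3%N).
    - by apply: ed; [lia | lia | by [] | exact: A].
    - by apply: ed; [lia | lia | by [] | exact: A].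
    - by apply: ed; [lia | lia | by [] | exact: A].
    - by apply: ed; [lia | lia | by [] | exact: A].
    - by case E : ca; apply: ed; try lia; apply: A; rewrite E.
    - by apply: neq; lia.
    - by apply: neq; lia.
    rewrite !inE => /orP[/orP[]|] /eqP kE; rewrite kE in kt.
    + by exists t, 1%N.
    + by exists t, 2%N.
    + by exists t, 3%N.
  have [t [k [ct kt kv]]] := IH (ltnW il).
  have -> : cidx (2 * i.+1) = (2 * i + 8)%N by rewrite /cidx; case: eqP; lia.
  have cv : cidx (2 * i) = (2 * i + 6)%N \/ i = 0%N /\ cidx (2 * i) = 0%N by rewrite /cidx;
    case: eqP; lia.
  have no : cl (F (cidx (2 * i))) [set F (cidx (2 * i)); F (2 * i + 7)%N; F (2 * i + 8)%N] -> False.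
    move=> /(clP.2 _ _ _ ct) E; move: kt; rewrite E !inE => /orP[/orP[]|] /eqP; apply: neq; lia.
  exists [set F (cidx (2 * i)); F (2 * i + 7)%N; F (2 * i + 8)%N], (2 * i + 7)%N; split.
  - by case: (clP.1 _ _ _ (chain i il)) => -[].
  - by rewrite !inE eqxx orbT.
  - by lia.
have [t [k [ct kt kv]]] := inv l (leqnn l).
have B j m : (j, m) \in [:: (cidx (2 * l),4); (4,5); (5,6); (6,cidx (2 * l));
      (if cb then (cidx (2 * l),5) else (4,6))]%N ->
   (j, m) \in M1l_edges l ca cb by move=> h; rewrite /M1l_edges !mem_cat h orbT.
have cv : cidx (2 * l) = (2 * l + 6)%N /\ (0 < l)%N \/ l = 0%N /\ cidx (2 * l) = 0%N by rewrite
  /cidx; case: eqP; lia.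
have [|||||||t' [ct' /subsetP sub _]] := @claimed_in_diamond cb (F (cidx (2 * l))) (F 4%N) (F
  5%N) (F 6%N).
- by apply: ed; [lia | lia | lia | by apply: B; rewrite !inE eqxx].
- by apply: ed; [lia | lia | lia | by apply: B; rewrite !inE eqxx ?orbT].
- by apply: ed; [lia | lia | lia | by apply: B; rewrite !inE eqxx ?orbT].
- by apply: ed; [lia | lia | lia | by apply: B; rewrite !inE eqxx ?orbT].
- by case E : cb; apply: ed; try lia; apply: B; rewrite E !inE eqxx ?orbT.
- by apply: neq; lia.
- by apply: neq; lia.
move: (sub (F k)); rewrite -(clP.2 _ _ _ ct ct') !inE => /(_ kt).
by case/orP=> [/orP[/orP[]|]|] /eqP; apply: neq; lia.
Qed.

Lemma claiming_M_free : M_free e.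
Proof. by split; [exact: claiming_M1_free | exact: claiming_M1l_free]. Qed.

End Claims.

(** * Free ends of paths *)

Section Frontiers.
Local Arguments Z.mul : simpl never.
Local Arguments Z.add : simpl never.
Local Arguments Z.sub : simpl never.
Local Arguments Z.opp : simpl never.
Local Open Scope Z_scope.

(** Refinement makes room inside an edge: cuts and bends take place at [4 * x + 2], a column free of
    vertical parts of scaled paths, and the last quarter, from [4 * x + 3], takes over the role of
    the old edge. *)
Definition scale (L : lpath) : lpath :=
  LPath (4 * lr L) (4 * la L) (4 * lb L) (4 * lc L) (4 * ld L) (4 * le L).

(** These four symmetries bring each of the four grid directions to the right, so that free ends
    need a description for one direction only. *)
Definition act (s f : bool) (L : lpath) : lpath :=
  let M := if s then tr L else L in if f then fx M else M.

(* The grid edge from (x,y) to (x+1,y) is the last edge of L at a free end. *)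
Definition right_end (L : lpath) (x y : Z) : Prop :=
  [/\ lr L = y, la L <= x, lb L = x + 1 & ld L = le L \/ lc L = la L].

(* M is the scaled path L, altered only inside the scaled edge at (x,y) or along
   new grid lines. *)
Definition alters (x y : Z) (L M : lpath) : Prop :=
  [/\ wf M,
      forall K, ~ hE K x y -> (ladj (scale K) M <-> ladj K L),
      forall s f x' y', right_end (act s f L) x' y' ->
        [/\ s = false, f = false, x' = x & y' = y] \/
        right_end (act s f M) (4 * x' + 3) (4 * y') &
      forall s f x' y', hE (act s f M) (4 * x' + 3) (4 * y') -> hE (act s f L) x' y'].

Definition fresh (x y : Z) (M : lpath) : Prop :=
  [/\ wf M, forall K, ~ hE K x y -> ~ ladj (scale K) M &
      forall s f x' y', hE (act s f M) (4 * x' + 3) (4 * y') ->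
        forall K, hE K x y -> hE (act s f K) x' y'].

(* Some grid edge other than the scaled old ones is a common free end of L and M and
   avoids K. *)
Definition opens (x y : Z) (K L M : lpath) : Prop :=
  exists s f X Y, [/\ right_end (act s f L) X Y, right_end (act s f M) X Y, ~ hE (act s f K) X Y
    & forall N, hE (act s f (scale N)) X Y -> hE N x y].

Definition cut (x : Z) (L : lpath) : lpath :=
  LPath (4 * lr L) (4 * la L) (4 * x + 2) (4 * lc L) (4 * ld L) (4 * le L).
(** The lengths [d1] and [d2] reach below and above the row. A former vertical part is discarded,
    whence the restriction to unbent paths in [alters_bend]. *)
Definition bend (x d1 d2 : Z) (L : lpath) : lpath :=
  LPath (4 * lr L) (4 * la L) (4 * x + 2) (4 * x + 2) (4 * lr L - d1) (4 * lr L + d2).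

Lemma right_end_hE L x y : right_end L x y -> hE L x y.
Proof. by case=> *; rewrite /hE; lia. Qed.
Lemma bent_dec L : bent L \/ ~ bent L. Proof. rewrite /bent; lia. Qed.
Lemma wf_scale L : wf L -> wf (scale L). Proof. by rewrite /wf /=; lia. Qed.
Lemma bent_scale L : bent (scale L) -> bent L. Proof. by rewrite /bent /=; lia. Qed.
Lemma ladj_scale L M : ladj (scale L) (scale M) <-> ladj L M.
Proof. by rewrite /ladj /hadj /vadj /=; lia. Qed.

Lemma alters_scale x y L : wf L -> right_end L x y -> alters x y L (scale L).
Proof.
move: L => [r a b c d e] W R; split.
- by move: W; rewrite /wf /=; lia.
- by move=> [r' a' b' c' d' e']; rewrite /ladj /hadj /vadj /=; lia.
- by move=> [] [] x' y' E; right; move: E; rewrite /right_end /= => -[]; split; lia.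
- by move=> [] [] x' y'; rewrite /hE /=; lia.
Qed.

Lemma alters_cut x y L : wf L -> right_end L x y -> alters x y L (cut x L).
Proof.
move: L => [r a b c d e] W R; split.
- by move: W R; rewrite /wf /right_end /= => ? []; lia.
- move: R => [/= ? ? ? ?]; move=> [r' a' b' c' d' e']; rewrite /ladj /hadj /vadj /hE /=; lia.
- move: W R; rewrite /wf => W [/= R1 R2 R3 R4].
  move=> [] [] x' y' [/= E1 E2 E3 E4]; try by right; split=> /=; lia.
  by left; split=> //; lia.
- by move: R => [/= ? ? ? ?] [] [] x' y'; rewrite /hE /=; lia.
Qed.

Lemma alters_bend x y d1 d2 L : wf L -> ~ bent L -> right_end L x y ->
  d1 = 0 /\ d2 = 4 \/ d1 = 4 /\ d2 = 0 -> alters x y L (bend x d1 d2 L).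
Proof.
move: L => [r a b c d e] W B R D.
have de : d = e by move: W B R; rewrite /wf /bent /right_end /= => W B []; lia.
have {B}[/= R1 R2 R3 _] := R; split.
- by rewrite /wf /=; lia.
- by move=> [r' a' b' c' d' e']; rewrite /ladj /hadj /vadj /hE /=; lia.
- move=> [] [] x' y' [/= E1 E2 E3 E4]; try by right; split=> /=; lia.
  by left; split=> //; lia.
- by move=> [] [] x' y'; rewrite /hE /=; lia.
Qed.

Definition hline (r a b : Z) : lpath := LPath r a b a r r.

Lemma fresh_hline x y a : 0 <= a < 4 -> fresh x y (hline (4 * y) (4 * x + a) (4 * x + 4)).
Proof.
move=> a4; split.
- by rewrite /wf /=; lia.
- by move=> [r' a' b' c' d' e']; rewrite /ladj /hadj /vadj /hE /=; lia.
- by move=> [] [] x' y' + [r' a' b' c' d' e']; rewrite /hE /=; lia.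
Qed.

Lemma fresh_corner x y : fresh x y (LPath (4 * y) (4 * x + 2) (4 * x + 4) (4 * x + 2) (4 * y) (4
  * y + 4)).
Proof.
split.
- by rewrite /wf /=; lia.
- by move=> [r' a' b' c' d' e']; rewrite /ladj /hadj /vadj /hE /=; lia.
- by move=> [] [] x' y' + [r' a' b' c' d' e']; rewrite /hE /=; lia.
Qed.

Lemma fresh_vline x y : fresh x y (LPath (4 * y) (4 * x + 2) (4 * x + 2) (4 * x + 2) (4 * y - 4)
  (4 * y + 4)).
Proof.
split.
- by rewrite /wf /=; lia.
- by move=> [r' a' b' c' d' e']; rewrite /ladj /hadj /vadj /hE /=; lia.
- by move=> [] [] x' y' + [r' a' b' c' d' e']; rewrite /hE /=; lia.
Qed.

Lemma act_scale s f L x y : (hE (act s f (scale L)) (4 * x + 3) (4 * y) <-> hE (act s f L) x y)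
  /\ (right_end (act s f L) x y -> right_end (act s f (scale L)) (4 * x + 3) (4 * y)).
Proof.
move: L => [r a b c d e]; split; first by case: s f => [] []; rewrite /hE /=; lia.
by case: s f => [] [] [/= E1 E2 E3 E4]; split=> /=; lia.
Qed.

(* The possible continuations beyond a frontier edge of L and M: N is the path of the
   apex, L' and M' are the altered paths. *)
Definition extends (x y : Z) (L M : lpath) (toL toM : Prop) (L' M' N : lpath) : Prop :=
  [/\ alters x y L L', alters x y M M' & fresh x y N] /\
  [/\ ladj L' M', ladj L' N, ladj M' N, toL -> opens x y M' L' N & toM -> opens x y L' N M'].

Lemma opens_sym x y K L M : opens x y K L M -> opens x y K M L.
Proof. by move=> [s [f [X [Y []]]]] *; exists s, f, X, Y. Qed.

Lemma extends_sym x y L M (toL toM : Prop) L' M' N :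
  extends x y L M toL toM L' M' N -> extends x y M L toM toL M' L' N.
Proof.
move=> [[? ? ?] [? ? ? ? ?]]; split=> //; split=> //; first exact: ladjC.
  by move=> ?; apply: opens_sym; auto.
by move=> ?; apply: opens_sym; auto.
Qed.

(** [M] stops in the middle of the edge, after meeting [N]; the last quarter is left to [L] and [N],
    and no bend is used. *)
Lemma extends_one x y L M : wf L -> wf M -> right_end L x y -> right_end M x y ->
  exists M' N, extends x y L M True False (scale L) M' N /\
  (bent M' -> bent M) /\ ~ bent N.
Proof.
move=> WL WM RL RM.
exists (cut x M), (hline (4 * y) (4 * x + 1) (4 * x + 4)).
move: (alters_scale WL RL) (alters_cut WM RM) (@fresh_hline x y 1) => aL aM fN.
move: L M WL WM RL RM aL aM => [r1 a1 b1 c1 d1 e1] [r2 a2 b2 c2 d2 e2] WL WM.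
move=> [/= R1 R2 R3 R4] [/= S1 S2 S3 S4] aL aM.
split; last by rewrite /bent /=; lia.
split; first by split=> //; apply: fN; lia.
split=> //; rewrite ?/ladj ?/hadj /=; try lia.
move=> _; exists false, false, (4 * x + 3), (4 * y); split; try (split=> /=; lia).
  by rewrite /hE /=; lia.
by move=> [r a b c d e]; rewrite /hE /=; lia.
Qed.

Lemma extends_none x y L M : wf L -> wf M -> right_end L x y -> right_end M x y ->
  exists N, extends x y L M False False (scale L) (scale M) N /\ ~ bent N.
Proof.
move=> WL WM RL RM.
exists (hline (4 * y) (4 * x + 0) (4 * x + 4)).
move: (alters_scale WL RL) (alters_scale WM RM) (@fresh_hline x y 0) => aL aM fN.
move: L M WL WM RL RM aL aM => [r1 a1 b1 c1 d1 e1] [r2 a2 b2 c2 d2 e2] WL WM.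
move=> [/= R1 R2 R3 R4] [/= S1 S2 S3 S4] aL aM.
split; last by rewrite /bent /=; lia.
split; first by split=> //; apply: fN; lia.
by split=> //; rewrite ?/ladj ?/hadj /=; try lia.
Qed.

(** [L] turns upwards in the middle of the edge, [M] goes straight on, and [N] is a corner following
    both. The bends of [L] and [N] are used, and the free ends lie above and to the right. *)
Lemma extends_claw1 x y L M : wf L -> wf M -> right_end L x y -> right_end M x y ->
  ~ bent L -> exists L' N, extends x y L M True True L' (scale M) N.
Proof.
move=> WL WM RL RM BL.
exists (bend x 0 4 L), (LPath (4 * y) (4 * x + 2) (4 * x + 4) (4 * x + 2) (4 * y) (4 * y + 4)).
have := alters_bend WL BL RL (or_introl (conj erefl erefl)).
move: (alters_scale WM RM) (fresh_corner x y).
move: L M WL WM RL RM BL => [r1 a1 b1 c1 d1 e1] [r2 a2 b2 c2 d2 e2] WL WM.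
move=> [/= R1 R2 R3 R4] [/= S1 S2 S3 S4] BL aM fN aL.
split=> //; split=> //; rewrite ?/ladj ?/hadj ?/vadj /=; try lia.
  move=> _; exists true, false, (4 * y + 3), (4 * x + 2); split; try (split=> /=; lia).
    by rewrite /hE /=; lia.
  by move=> [r a b c d e]; rewrite /hE /=; lia.
move=> _; exists false, false, (4 * x + 3), (4 * y); split; try (split=> /=; lia).
  by rewrite /hE /=; lia.
by move=> [r a b c d e]; rewrite /hE /=; lia.
Qed.

(** [L] turns upwards and [M] downwards at the same point, and [N] follows both on a vertical line:
    the bends of [L] and [M] are used. *)
Lemma extends_claw2 x y L M : wf L -> wf M -> right_end L x y -> right_end M x y ->
  ~ bent L -> ~ bent M ->
  exists L' M' N, extends x y L M True True L' M' N /\ ~ bent N.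
Proof.
move=> WL WM RL RM BL BM.
exists (bend x 0 4 L), (bend x 4 0 M),
  (LPath (4 * y) (4 * x + 2) (4 * x + 2) (4 * x + 2) (4 * y - 4) (4 * y + 4)).
have := alters_bend WL BL RL (or_introl (conj erefl erefl)).
have := alters_bend WM BM RM (or_intror (conj erefl erefl)).
move: (fresh_vline x y).
move: L M WL WM RL RM BL BM => [r1 a1 b1 c1 d1 e1] [r2 a2 b2 c2 d2 e2] WL WM.
move=> [/= R1 R2 R3 R4] [/= S1 S2 S3 S4] BL BM fN aM aL.
split; last by rewrite /bent /=; lia.
split=> //; split=> //; rewrite ?/ladj ?/hadj ?/vadj /=; try lia.
  move=> _; exists true, false, (4 * y + 3), (4 * x + 2); split; try (split=> /=; lia).
    by rewrite /hE /=; lia.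
  by move=> [r a b c d e]; rewrite /hE /=; lia.
(* The lower free end, seen in the frame that brings downwards to the right: the edge above row
   [4 * y - 4] gets the coordinate [- (4 * y - 4) - 1]. *)
move=> _; exists true, true, (- (4 * y - 4) - 1), (4 * x + 2); split; try (split=> /=; lia).
  by rewrite /hE /=; lia.
by move=> [r a b c d e]; rewrite /hE /=; lia.
Qed.

Lemma act_tr s f L : act (~~ s) f (tr L) = act s f L.
Proof. by case: L => *; case: s. Qed.

(** The reflection turns a horizontal frame round; a vertical frame keeps its direction, and only
    the column of the edge changes sign. *)
Lemma act_fx s f y : exists s' f' y', forall L x,
  (right_end (act s' f' (fx L)) x y' <-> right_end (act s f L) x y) /\
  (hE (act s' f' (fx L)) x y' <-> hE (act s f L) x y).
Proof.
case: s; last first.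
  exists false, (~~ f), y => -[r a b c d e] x; rewrite /hE.
  by case: f; split; try (split=> -[/= ? ? ? ?]; split=> /=); rewrite /=; lia.
exists true, f, (- y) => -[r a b c d e] x; rewrite /hE.
by case: f; split; try (split=> -[/= ? ? ? ?]; split=> /=); rewrite /=; lia.
Qed.

End Frontiers.

(** * From a claiming to B_1 *)

Section Construction.
Local Open Scope Z_scope.
Variables (T : finType) (e : rel T) (pos : T -> nat) (cl : T -> {set T} -> Prop).
Hypotheses (e_sym : symmetric e) (e_irr : irreflexive e) (emb : embedding e pos).
Hypotheses (emax : maximal_outerplanar e) (clP : claiming e pos cl).
Local Notation itri := (itri e pos).

(* u and v are consecutive in W, and some vertices between them are still missing. *)
Definition gap (W : {set T}) (u v : T) : Prop :=
  [/\ u \in W, v \in W, (pos u < pos v)%N, forall z, z \in W -> ~ (pos u < pos z < pos v)%N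
    & exists p, (pos u < pos p < pos v)%N].

Definition frontier (P : T -> lpath) (W : {set T}) (u v : T) : Prop :=
  exists s f x y, [/\ right_end (act s f (P u)) x y, right_end (act s f (P v)) x y &
    forall z, z \in W -> hE (act s f (P z)) x y -> z = u \/ z = v].

(** The third clause keeps bends in reserve: a vertex bends only for a triangle that it claims and
    that is entirely present. The last one guarantees a place for each insertion still to come. *)
Definition represents (P : T -> lpath) (W : {set T}) : Prop :=
  [/\ forall u, u \in W -> wf (P u),
      forall u v, u \in W -> v \in W -> u <> v -> (e u v <-> ladj (P u) (P v)),
      forall u, u \in W -> bent (P u) -> exists2 t : {set T}, cl u t & t \subset W &
      forall u v, gap W u v -> e u v /\ frontier P W u v].

Lemma represents_tr P W : represents P W -> represents (fun z => tr (P z)) W.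
Proof.
move=> [wP aP bP fP]; split=> [u /wP/wf_tr //|u v uW vW uv|u uW|u v g].
- by rewrite ladj_tr; exact: aP.
- by move=> bu; apply: bP => //; move: bu; rewrite /bent /=; tauto.
have [euv [s [f [x [y [ru rv ex]]]]]] := fP u v g; split=> //.
exists (~~ s), f, x, y; rewrite !act_tr; split=> // z zW; rewrite act_tr; exact: ex.
Qed.

Lemma represents_fx P W : represents P W -> represents (fun z => fx (P z)) W.
Proof.
move=> [wP aP bP fP]; split=> [u /wP/wf_fx //|u v uW vW uv|u uW|u v g].
- by rewrite ladj_fx; exact: aP.
- by move=> bu; apply: bP => //; move: bu; rewrite /bent /=; lia.
have [euv [s [f [x [y [ru rv ex]]]]]] := fP u v g; split=> //.
have [s' [f' [y' E]]] := act_fx s f y.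
exists s', f', x, y'; split; [exact/(E _ _).1 | exact/(E _ _).1 |].
by move=> z zW /(E _ _).2; exact: ex.
Qed.

Lemma represents_act s f P W : represents P W -> represents (fun z => act s f (P z)) W.
Proof.
move=> R; case: s f => [] []; [apply: represents_fx | | exact: represents_fx | exact: R];
  exact: represents_tr.
Qed.

Section Insert.
Variables (P : T -> lpath) (W : {set T}) (u v w : T) (x y : Z).
Hypotheses (RP : represents P W) (guv : gap W u v) (uw : e u w) (vw : e v w).
Hypothesis wb : (pos u < pos w < pos v)%N.
Hypotheses (Ru : right_end (P u) x y) (Rv : right_end (P v) x y).
Hypothesis ex : forall z, z \in W -> hE (P z) x y -> z = u \/ z = v.

(** All changes are confined to the crossed edge and to new grid lines, so the old contacts and the
    frontiers of the other gaps survive. *)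
Lemma insert (L M N : lpath) :
  extends x y (P u) (P v) (exists p, (pos u < pos p < pos w)%N) (exists p,
    (pos w < pos p < pos v)%N) L M N ->
  (bent L -> ~ bent (P u) -> exists2 t : {set T}, cl u t & t \subset w |: W) ->
  (bent M -> ~ bent (P v) -> exists2 t : {set T}, cl v t & t \subset w |: W) ->
  (bent N -> exists2 t : {set T}, cl w t & t \subset w |: W) ->
  represents (fun z => if z == w then N else if z == u then L else if z == v then M else scale (P
    z)) (w |: W).
Proof.
move=> [[[wL aL rL hL] [wM aM rM hM] [wN aN hN]] [LM LN MN oL oM]] cu cv cw.
have [wP aP bP fP] := RP; have [uW vW uv noW _] := guv.
have euv : e u v by case: (fP u v guv).
have nwW : w \notin W by apply/negP => /noW; apply.
have wu : (u == w) = false by apply/eqP => E; rewrite E (negPf nwW) in uW.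
have wv : (v == w) = false by apply/eqP => E; rewrite E (negPf nwW) in vW.
have vu : (v == u) = false by apply/eqP => E; rewrite E ltnn in uv.
have hu := right_end_hE Ru.
have hv := right_end_hE Rv.
set P' := fun z => _.
have Pw : P' w = N by rewrite /P' eqxx.
have Pu : P' u = L by rewrite /P' wu eqxx.
have Pv : P' v = M by rewrite /P' wv vu eqxx.
have Po z : z \in W -> z <> u -> z <> v -> P' z = scale (P z).
  move=> zW /eqP/negPf zu /eqP/negPf zv; rewrite /P' zu zv.
  by case: eqP => // E; rewrite E (negPf nwW) in zW.
have cases z : z \in w |: W -> [\/ z = w, z = u, z = v | [/\ z \in W, z <> u & z <> v]].
  case/setU1P => [->|zW]; first exact: Or41.
  have [->|/eqP zu] := eqVneq z u; first exact: Or42.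
  have [->|/eqP zv] := eqVneq z v; first exact: Or43.
  exact: Or44.
have exo z : z \in W -> z <> u -> z <> v -> ~ hE (P z) x y by move=> zW zu zv /(ex zW)[].
have sub (t : {set T}) : t \subset W -> t \subset w |: W by move/subset_trans; apply;
  exact: subsetUr.
(* An edge from [w] does not cross [uv], so a further neighbour of [w] in [W] would lie inside the
   gap. *)
have ewo z : z \in W -> z <> u -> z <> v -> ~~ e w z.
  move=> zW zu zv; apply/negP => ewz.
  have := same_side e_sym emb euv ewz; rewrite {1}/btw wb /= => /(_ _ _ _ _)/esym.
  have := noW z zW; rewrite /btw => nz bz.
  have /orP[|] : (pos u < pos z < pos v)%N || (pos v < pos z < pos u)%N.
    by apply: bz => //; apply/eqP; rewrite eq_sym ?wu ?wv.
  - by move/nz.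
  - by move: uv; clear; lia.
split.
- move=> z /cases[->|->|->|[zW zu zv]]; rewrite ?Pw ?Pu ?Pv ?Po //.
  exact/wf_scale/wP.
- have sym a b : (e a b <-> ladj (P' a) (P' b)) -> (e b a <-> ladj (P' b) (P' a)).
    by rewrite e_sym => ->; split; apply: ladjC.
  have Hwu : e w u <-> ladj (P' w) (P' u) by rewrite Pw Pu e_sym; split=> // _; exact: ladjC.
  have Hwv : e w v <-> ladj (P' w) (P' v) by rewrite Pw Pv e_sym; split=> // _; exact: ladjC.
  have Huv : e u v <-> ladj (P' u) (P' v) by rewrite Pu Pv.
  have Hw z : z \in W -> z <> u -> z <> v -> (e w z <-> ladj (P' w) (P' z)).
    move=> zW zu zv; rewrite Pw Po //; split; first by move/negP: (ewo z zW zu zv).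
    by move/ladjC/aN; case; exact: exo.
  have Hu z : z \in W -> z <> u -> z <> v -> (e u z <-> ladj (P' u) (P' z)).
    move=> zW zu zv; apply: sym; rewrite Pu Po // aL; last exact: exo.
    exact: aP.
  have Hv z : z \in W -> z <> u -> z <> v -> (e v z <-> ladj (P' v) (P' z)).
    move=> zW zu zv; apply: sym; rewrite Pv Po // aM; last exact: exo.
    exact: aP.
  move=> a b /cases[->|->|->|[aW au av]] /cases[->|->|->|[bW bu bv]] // ab;
    try (by [apply: Hw | apply: Hu | apply: Hv | apply: sym; apply: Hw
      | apply: sym; apply: Hu | apply: sym; apply: Hv | apply: sym]).
  by rewrite !Po // ladj_scale; apply: aP.
- move=> z /cases[->|->|->|[zW zu zv]]; rewrite ?Pw ?Pu ?Pv ?Po //.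
  + move=> bL; have [bu|bu] := bent_dec (P u).
      by have [t ct tW] := bP u uW bu; exists t; auto.
    exact: cu.
  + move=> bM; have [bv|bv] := bent_dec (P v).
      by have [t ct tW] := bP v vW bv; exists t; auto.
    exact: cv.
  + by move=> /bent_scale/(bP z zW)[t ct tW]; exists t; auto.
move=> a b [aW bW ab noab [p pab]].
have newf (c d c' : T) K L1 L2 : P' c = L1 -> P' d = L2 -> P' c' = K ->
    (forall z, z \in w |: W -> z = c \/ z = d \/ z = c' \/ [/\ z \in W, z <> u & z <> v]) ->
    opens x y K L1 L2 -> frontier P' (w |: W) c d.
  move=> E1 E2 E3 all4 [s [f [X [Y [r1 r2 nK hK]]]]]; exists s, f, X, Y; rewrite E1 E2;
    split=> // z zW.
  case: (all4 z zW) => [->|[->|[->|[zW' zu zv]]]]; [by left | by right | by rewrite E3 => /nK |].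
  by rewrite Po // => /hK /(exo z zW' zu zv).
have all4 z : z \in w |: W -> [\/ z = w, z = u, z = v | [/\ z \in W, z <> u & z <> v]] := cases z.
have [abu|abu] := eqVneq b w.
  have au : a = u.
    have := noab u; have := noab; case/setU1P: aW => [aw|aW]; first by rewrite aw abu ltnn in ab.
    move=> _; rewrite in_setU1 uW orbT => /(_ isT) nu; rewrite abu in ab nu.
    have := noW a aW; case: (eqVneq a u) => // /eqP/(pos_neq emb); move: ab nu wb; clear; lia.
  rewrite abu au; split=> //.
  apply: (newf u w v _ _ _ Pu Pw Pv); last by apply: oL; exists p; rewrite -au -abu.
  by move=> z /all4[]; tauto.
have [aw|aw] := eqVneq a w.
  have bv : b = v.
    have := noab v; case/setU1P: bW => [bw|bW]; first by rewrite bw eqxx in abu.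
    rewrite in_setU1 vW orbT => /(_ isT) nv; rewrite aw in ab nv.
    have := noW b bW; case: (eqVneq b v) => // /eqP/(pos_neq emb); move: ab nv wb; clear; lia.
  rewrite aw bv; split; first by rewrite e_sym.
  apply: (newf w v u _ _ _ Pw Pv Pu); last by apply: oM; exists p; rewrite -bv -aw.
  by move=> z /all4[]; tauto.
have {}aW : a \in W by case/setU1P: aW => // E; rewrite E eqxx in aw.
have {}bW : b \in W by case/setU1P: bW => // E; rewrite E eqxx in abu.
have gab : gap W a b.
  by split=> //; [move=> z zW; apply: noab; rewrite in_setU1 zW orbT | exists p].
have [eab [s [f [x' [y' [ra rb exab]]]]]] := fP a b gab; split=> //.
(* If the paths of [u] and [v] both contained the frontier edge of the gap [ab], this gap would be
   [uv], which now has [w] inside. *)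
have both : hE (act s f (P u)) x' y' -> hE (act s f (P v)) x' y' -> False.
  move=> /(exab u uW) ua /(exab v vW) va; have := noab w; rewrite setU11 => /(_ isT).
  case: ua va => [E1|E1] [E2|E2]; try by rewrite E2 E1 eqxx in vu.
    by rewrite -E1 -E2; apply.
  by move: ab uv; rewrite -E1 -E2; clear; lia.
have endP z : z \in W -> right_end (act s f (P z)) x' y' ->
    right_end (act s f (P' z)) (4 * x' + 3) (4 * y').
  move=> zW rz; have zW' : z \in w |: W by rewrite in_setU1 zW orbT.
  case/cases: zW' rz => [E|->|->|[_ zu zv]] rz.
  - by rewrite E (negPf nwW) in zW.
  - by rewrite Pu; case: (rL _ _ _ _ rz) => // -[E1 E2 E3 E4]; subst s f x' y'; case: both.
  - by rewrite Pv; case: (rM _ _ _ _ rz) => // -[E1 E2 E3 E4]; subst s f x' y'; case: both.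
  - by rewrite Po //; apply: (act_scale s f (P z) x' y').2.
exists s, f, (4 * x' + 3), (4 * y'); split; [exact: endP | exact: endP |].
move=> z /cases[->|->|->|[zW zu zv]]; rewrite ?Pw ?Pu ?Pv ?Po //.
- by move=> /hN H; case: both; apply: H.
- by move/hL/(exab u uW).
- by move/hM/(exab v vW).
- by move/(act_scale s f (P z) x' y').1/(exab z zW).
Qed.

End Insert.

(** The apex [w] splits the gap into [uw] and [wv]. A claw is needed only if both still miss
    vertices; then [uvw] is internal, because [z0] lies beyond [uv]. *)
Lemma grow_right P (W : {set T}) u v z0 x y : represents P W -> gap W u v -> e u v ->
  z0 \in W -> z0 <> u -> z0 <> v -> right_end (P u) x y -> right_end (P v) x y ->
  (forall z, z \in W -> hE (P z) x y -> z = u \/ z = v) ->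
  exists P' w, w \notin W /\ represents P' (w |: W).
Proof.
move=> RP guv euv z0W z0u z0v Ru Rv ex; have [uW vW uv noW [p puv]] := guv.
have [wP _ bP _] := RP; have Wu := wP u uW; have Wv := wP v vW.
have [w [wb uw vw]] := inside_apex e_sym emax emb euv puv.
have nwW : w \notin W by apply/negP => /noW; apply.
have tW : [set u; v; w] \subset w |: W.
  by apply/subsetP => z; rewrite !inE => /orP[/orP[]|] /eqP->; rewrite ?uW ?vW ?eqxx ?orbT.
have ins := insert RP guv uw vw wb Ru Rv ex.
suff [L [M [N [E cu cv cw]]]] : exists L M N, [/\
    extends x y (P u) (P v) (exists p, (pos u < pos p < pos w)%N) (exists p,
      (pos w < pos p < pos v)%N) L M N,
    bent L -> ~ bent (P u) -> exists2 t : {set T}, cl u t & t \subset w |: W,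
    bent M -> ~ bent (P v) -> exists2 t : {set T}, cl v t & t \subset w |: W &
    bent N -> exists2 t : {set T}, cl w t & t \subset w |: W].
  by eexists; exists w; split; last exact: (ins L M N).
have weak (A B C D : Prop) L M N : (C -> A) -> (D -> B) ->
    extends x y (P u) (P v) A B L M N -> extends x y (P u) (P v) C D L M N.
  by move=> CA DB [? [? ? ? oA oB]]; split=> //; split; auto.
have dec q r : (exists p, (pos q < pos p < pos r)%N) \/ ~ (exists p, (pos q < pos p < pos r)%N).
  have [/existsP ?|/existsP ?] := boolP [exists p, (pos q < pos p < pos r)%N]; by [left|right].
case: (dec u w) (dec w v) => [[pub pb1]|npu] [[pvb pb2]|npv].
- have wu : e w u by rewrite e_sym.
  have wv : e w v by rewrite e_sym.
  have iuv : inner e pos u v.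
    have [q [uq vq bq]] := side_apex e_sym e_irr emax emb euv z0u z0v.
    apply: (innerP euv uw vw uq vq); rewrite bq; have := noW z0 z0W.
    by move: wb; rewrite /btw; clear; lia.
  have iuw : inner e pos u w.
    have nu : pub <> u by move=> E; move: pb1; rewrite E; clear; lia.
    have nw : pub <> w by move=> E; move: pb1; rewrite E; clear; lia.
    have [q [uq wq bq]] := side_apex e_sym e_irr emax emb uw nu nw.
    by apply: (innerP uw uq wq euv wv); rewrite bq /btw; move: pb1 wb; clear; lia.
  have ivw : inner e pos v w.
    have nv : pvb <> v by move=> E; move: pb2; rewrite E; clear; lia.
    have nw : pvb <> w by move=> E; move: pb2; rewrite E; clear; lia.
    have [q [vq wq bq]] := side_apex e_sym e_irr emax emb vw nv nw.
    have vu : e v u by rewrite e_sym.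
    by apply: (innerP vw vq wq vu wu); rewrite bq /btw; move: pb2 wb; clear; lia.
  have t : itri u v w by apply/and5P; split=> //; apply/andP.
  (* A claimant of [uvw] can have bent only for [uvw] itself, which is not contained in [W] as [w]
     is missing. *)
  have nb z : z \in W -> cl z [set u; v; w] -> ~ bent (P z).
    move=> zW cz /(bP z zW)[t' cz' /subsetP/(_ w)]; rewrite (clP.2 _ _ _ cz' cz) !inE eqxx orbT.
    by move/(_ isT); apply/negP.
  have [[cu cv]|[cu cw]|[cv cw]] := clP.1 _ _ _ t.
  + have [L [M [N [E bN]]]] := extends_claw2 Wu Wv Ru Rv (nb u uW cu) (nb v vW cv).
    by exists L, M, N; split; [exact: weak E | exists [set u; v; w] | exists [set u; v;
      w] | move/bN].
  + have [L [N E]] := extends_claw1 Wu Wv Ru Rv (nb u uW cu).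
    exists L, (scale (P v)), N; split; [exact: weak E | by exists [set u; v;
      w] | by move/bent_scale | by exists [set u; v; w]].
  + have [M [N E]] := extends_claw1 Wv Wu Rv Ru (nb v vW cv).
    exists (scale (P u)), M, N; split;
      [exact: weak (extends_sym E) | by move/bent_scale | by exists [set u; v;
        w] | by exists [set u; v; w]].
- have [M' [N [E [bM bN]]]] := extends_one Wu Wv Ru Rv.
  exists (scale (P u)), M', N; split; [exact: weak E|by move/bent_scale|by move/bM|by move/bN].
- have [M' [N [E [bM bN]]]] := extends_one Wv Wu Rv Ru.
  exists M', (scale (P v)), N; split;
    [exact: weak (extends_sym E)|by move/bM|by move/bent_scale|by move/bN].
have [N [E bN]] := extends_none Wu Wv Ru Rv.
by exists (scale (P u)), (scale (P v)), N; split;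
  [exact: weak E|move/bent_scale|move/bent_scale|move/bN].
Qed.

Lemma grow P (W : {set T}) u v : represents P W -> gap W u v ->
  (exists2 z, z \in W & z <> u /\ z <> v) ->
  exists P' w, w \notin W /\ represents P' (w |: W).
Proof.
move=> RP guv [z0 z0W [z0u z0v]].
have [_ _ _ /(_ u v guv)[euv [s [f [x [y [Ru Rv ex]]]]]]] := RP.
exact: (grow_right (represents_act s f RP) guv euv z0W z0u z0v Ru Rv ex).
Qed.

(** As [a] and [b] have the extreme positions, a missing vertex always lies in the gap between the
    closest vertices of [W] before and after it. *)
Lemma exhaust P (W : {set T}) a b : represents P W -> a \in W -> b \in W ->
  (forall z, pos a <= pos z <= pos b)%N -> (2 < #|W|)%N ->
  exists P', represents P' [set: T].
Proof.
have [n] := ubnP #|~: W|; elim: n P W => // n IH P W Wn RP aW bW ab W3.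
have [WT|/set0Pn[p]] := eqVneq (~: W) set0.
  by exists P; rewrite -setC0 -WT setCK.
rewrite inE => pW.
have pa : a != p by apply/eqP => E; rewrite E (negPf pW) in aW.
have pb : b != p by apply/eqP => E; rewrite E (negPf pW) in bW.
have Aa : (a \in W) && (pos a < pos p)%N.
  by rewrite aW; move/eqP/(pos_neq emb): pa; have := ab p; clear; lia.
have Bb : (b \in W) && (pos p < pos b)%N.
  by rewrite bW; move/eqP/(pos_neq emb): pb; have := ab p; clear; lia.
have [u /andP[uW up] umax] := @arg_maxnP _ a (fun z => (z \in W) && (pos z < pos p)%N) pos Aa.
have [v /andP[vW pv] vmin] := @arg_minnP _ b (fun z => (z \in W) && (pos p < pos z)%N) pos Bb.
have guv : gap W u v.
  split=> //; [exact: ltn_trans pv | | by exists p; rewrite up].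
  move=> z zW; have zp : pos z <> pos p by apply: (pos_neq emb) => E; rewrite E (negPf pW) in zW.
  have := umax z; have := vmin z; rewrite zW /=; move: zp; clear; lia.
have [|P' [w [wW RP']]] := grow RP guv.
  have : (0 < #|W :\: [set u; v]|)%N.
    have := cardsID [set u; v] W; have := subset_leq_card (subsetIr W [set u; v]).
    by have := cards2 u v; case: (u != v) => /=; move: W3; clear; lia.
  case/card_gt0P=> z; rewrite !inE negb_or => /andP[/andP[zu zv] zW].
  by exists z => //; split; apply/eqP.
apply: (IH P' (w |: W)) => //; rewrite ?in_setU1 ?aW ?bW ?orbT //.
  have : (#|~: (w |: W)| < #|~: W|)%N.
    apply: proper_card; rewrite properE; apply/andP; split.
      by apply/subsetP => z; rewrite !inE negb_or => /andP[].
    by apply/subsetPn; exists w; rewrite !inE ?eqxx.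
  by move: Wn; clear; lia.
by rewrite cardsU1 wW; move: W3; clear; lia.
Qed.

Lemma B1_of_represents P : represents P [set: T] -> in_B1 e.
Proof.
move=> [wP aP _ _].
have /fin_all_exists[S PS] v : exists p : seq gpoint, [/\ grid_path p,
  (nbends p <= 1)%N & traces p (P v)].
  by apply: seq_of_lpath; apply: wP.
exists S; split=> [v|u v /eqP uv]; first by case: (PS v).
rewrite aP ?inE //; case: (PS u) (PS v) => [gu _ tu] [gv _ tv].
by rewrite (share_traces gu gv tu tv).
Qed.

Lemma B1_of_complete : (forall u v, u <> v -> e u v) -> in_B1 e.
Proof.
move=> K; pose L := hline 0 0 1.
have [|p [gp bp tp]] := @seq_of_lpath L; first by rewrite /wf /=; lia.
exists (fun=> p); split=> // u v /eqP uv; rewrite (share_traces gp gp tp tp).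
by split=> _; [rewrite /ladj /hadj /=; lia | exact: K].
Qed.

Lemma B1_of_claiming : in_B1 e.
Proof.
have [/existsP[u0 /existsP[v0 /existsP[w0 /and3P[/eqP n1 /eqP n2 /eqP n3]]]]|small] :=
  boolP [exists u, exists v, exists w, [&& u != v :> T, u != w & v != w]]; last first.
  apply: B1_of_complete => u v uv; apply/negPn/negP => nuv.
  have [c [d [_ [cu cv] _ _]]] := crossing_edge e_sym emax emb uv nuv.
  case/negP: small; apply/existsP; exists u; apply/existsP; exists v; apply/existsP; exists c.
  by apply/and3P; split; apply/eqP => // E; [apply: cu | apply: cv].
have [a _ amin] := @arg_minnP _ u0 xpredT pos isT.
have [b _ bmax] := @arg_maxnP _ u0 xpredT pos isT.
have ab z : (pos a <= pos z <= pos b)%N by apply/andP; split; [exact: amin | exact: bmax].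
have [p pa pb] : exists2 p, p <> a & p <> b.
  have [/eqP n1' [/eqP n2' /eqP n3']] : v0 != u0 /\ w0 != u0 /\ w0 != v0.
    by rewrite !(eq_sym w0) (eq_sym v0); do !split; apply/eqP.
  have [->|/eqP au] := eqVneq a u0; have [->|/eqP bu] := eqVneq b u0.
  - by exists v0.
  - by have [->|/eqP bv] := eqVneq b v0; [exists w0 | exists v0 => //; exact: nesym].
  - by have [->|/eqP av] := eqVneq a v0; [exists w0 | exists v0 => //; exact: nesym].
  - by exists u0; exact: nesym.
have pab : (pos a < pos p < pos b)%N.
  by have := ab p; move/(pos_neq emb): pa; move/(pos_neq emb): pb; clear; lia.
have nab : a <> b by move=> E; move: pab; rewrite E; clear; lia.
(* No edge can cross the chord [ab], since every other vertex has its position between those of [a]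
   and [b]. *)
have eab : e a b.
  apply/negPn/negP => nab'; have [c [d [_ _ [da db] [_]]]] := crossing_edge e_sym emax emb nab nab'.
  by have := ab d; move/(pos_neq emb): da; move/(pos_neq emb): db; rewrite /btw; clear; lia.
have [w [wb aw bw]] := inside_apex e_sym emax emb eab pab.
have wa : (w == a) = false by apply/eqP => E; move: wb; rewrite E; clear; lia.
have wb2 : (w == b) = false by apply/eqP => E; move: wb; rewrite E; clear; lia.
have ba : (b == a) = false by apply/eqP => E; apply: nab; rewrite E.
(* All on one row: [a] from 0 to 3, [b] from 2 to 5, [w] from 0 to 5. The three meet between 2 and
   3, the left end is free for the gap [aw] and the right end for [wb]. *)
have [|||||P] := @exhaust (fun z =>
  if z == a then hline 0 0 3 else if z == b then hline 0 2 5 else hline 0 0 5) [set a; b; w] a b;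
  last exact: B1_of_represents.
- have eba : e b a by rewrite e_sym. have ewa : e w a by rewrite e_sym. have ewb : e w b by
  rewrite e_sym.
  split.
  + by move=> u _; case: ifP => _; [|case: ifP => _]; rewrite /wf /=; lia.
  + move=> u v; rewrite !inE => /orP[/orP[]|] /eqP-> /orP[/orP[]|] /eqP-> // _;
    rewrite ?eqxx ?wa ?wb2 ?ba; (split=> _; [by rewrite /ladj /hadj /=; lia | by []]).
  + by move=> u _; case: ifP => _; [|case: ifP => _]; rewrite /bent /=; lia.
  move=> u v [uW vW uv none [q puv]].
  have nw := none w; have {}nw : ~ (pos u < pos w < pos v)%N by apply: nw; rewrite !inE eqxx orbT.
  move: uW vW uv nw; rewrite !inE => /orP[/orP[]|] /eqP-> /orP[/orP[]|] /eqP-> uv nw;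
    try (by exfalso; move: uv nw wb; clear; lia).
  + split=> //; exists false, true, (-1), 0; rewrite /= eqxx wa wb2; split.
    * by split=> /=; lia.
    * by split=> /=; lia.
    move=> z; rewrite !inE => /orP[/orP[]|] /eqP->; [by left | | by right].
    by rewrite ba eqxx /hE /=; lia.
  split; first by rewrite e_sym.
  exists false, false, 4, 0; rewrite /= eqxx ba wa wb2; split.
  + by split=> /=; lia.
  + by split=> /=; lia.
  move=> z; rewrite !inE => /orP[/orP[]|] /eqP->; [|by right|by left].
  by rewrite eqxx /hE /=; lia.
- by rewrite !inE eqxx.
- by rewrite !inE eqxx orbT.
- exact: ab.
by rewrite -setUA cardsU1 cards2 !inE (eq_sym a b) ba (eq_sym a w) wa (eq_sym b w) wb2.
Qed.

End Construction.

(** * Blocks of the reduced graph *)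

Section Blocks.
Variables (T : finType) (e : rel T) (pos : T -> nat).
Hypotheses (e_sym : symmetric e) (e_irr : irreflexive e) (emb : embedding e pos).
Local Notation itri := (itri e pos).
Local Notation ired := (ired e pos).

Lemma induced_of_seq (n : nat) (h : rel 'I_n) (F : nat -> T) :
  (forall i j, (i < n)%N -> (j < n)%N -> F i = F j -> i = j) ->
  (forall i, (i < n)%N -> exists z, ired (F i) z) ->
  (forall i j : 'I_n, i != j -> h i j = ired (F i) (F j)) ->
  induced_in_reduced e h.
Proof.
move=> inj nb hE; exists (fun i => F i); split=> [i j /inj E|].
  by apply: val_inj; apply: E.
split=> [i|i j ij].
  have [z /existsP[w t]] := nb i (ltn_ord i).
  by apply/(colored_vertexP e_sym e_irr emb); exists z, w.
by rewrite hE // (colored_edgeP e_sym e_irr emb).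
Qed.

Hypotheses (emax : maximal_outerplanar e) (free : M_free e).

(** Otherwise [z'], [x], [y], [z], [q] in this order induce M_1 with centre [x], since any further
    edge would give a K_4 or a 4-wheel. *)
Lemma no_M1 x y z z' q : itri x y z -> itri x y z' -> z <> z' -> itri x z q -> q = y.
Proof.
move=> t1 t2 zz' t3; have [//|/eqP qy] := eqVneq q y; case: free => F _; case: F.
have [xy xz yz] := itri_edges t1; have [_ xz' yz'] := itri_edges t2;
  have [_ xq zq] := itri_edges t3.
have H12 := ired_itri t1; have H13 := ired_itri (itri_swap23 e_sym t1).
have H23 := ired_itri (itri_swap23 e_sym (itri_swap12 e_sym t1)).
have H1' := ired_itri (itri_swap23 e_sym t2).
have H2' := ired_itri (itri_swap23 e_sym (itri_swap12 e_sym t2)).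
have H1q := ired_itri (itri_swap23 e_sym t3).
have H3q := ired_itri (itri_swap23 e_sym (itri_swap12 e_sym t3)).
have n1 : ~~ e z' z.
  by apply/negP => c; apply: (no_K4 e_sym e_irr emb xy xz' xz yz' yz c).
have n2 : ~~ e y q.
  by apply/negP => c; apply: (no_K4 e_sym e_irr emb xy xz xq yz c zq).
have n3 : ~~ e z' q.
  apply/negP => c; apply: (@no_W4 _ e e_sym e_irr pos emb x z' y z q) => //; try exact: nesym.
  - by rewrite e_sym.
  - by rewrite e_sym.
have nr a b : ~~ e a b -> ired a b = false by move=> n; apply: contraNF n; exact: ired_edge.
have irC a b : ired a b = ired b a := iredC pos e_sym a b.
have ne a b : e a b -> a <> b := @edge_neq _ e e_irr a b.
have z'q : z' <> q by move=> E; move: n1; rewrite E e_sym zq.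
pose s := [:: z'; x; y; z; q].
have us : uniq s.
  rewrite /= !inE !negb_or; do ?[apply/andP; split] => //; apply/eqP; auto;
    try (by apply/nesym; auto).
apply: (@induced_of_seq 5 M1 (nth x s)) => [i j il jl /eqP|i|i j ij].
- by rewrite nth_uniq // => /eqP.
- case: i => [|[|[|[|[|//]]]]] _ /=.
  + by exists x; rewrite irC.
  + by exists y.
  + by exists x; rewrite irC.
  + by exists x; rewrite irC.
  + by exists x; rewrite irC.
move: ij; rewrite -(inj_eq val_inj) /M1 /rel_of_edges /=.
have : (i < 5)%N && (j < 5)%N by rewrite !ltn_ord.
case: (nat_of_ord i) => [|[|[|[|[|//]]]]]; case: (nat_of_ord j) => [|[|[|[|[|//]]]]] //= _ _;
 by rewrite ?H12 ?H13 ?H23 ?H1' ?H2' ?H1q ?H3q ?(nr _ _ n1) ?(nr _ _ n2) ?(nr _ _ n3) //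
    irC ?H12 ?H13 ?H23 ?H1' ?H2' ?H1q ?H3q ?(nr _ _ n1) ?(nr _ _ n2) ?(nr _ _ n3).
Qed.

Lemma apex_of_two u v w z q : itri u v w -> itri u v z -> w <> z -> itri u v q -> q = w \/ q = z.
Proof.
move=> t1 t2 wz t3; have [uv uw vw] := itri_edges t1; have [_ uz vz] := itri_edges t2.
have [_ uq vq] := itri_edges t3.
have U a b := @apex_uniq _ e e_sym e_irr pos emb u v a b uv.
have [E|E] := eqVneq (btw pos u v q) (btw pos u v w); first by left; exact: U.
have [E'|E'] := eqVneq (btw pos u v q) (btw pos u v z); first by right; exact: U.
by case: wz; apply: U => //; move: E E'; do 3 case: (btw _ _ _ _).
Qed.

Definition isolated (u v w : T) : Prop :=
  [/\ itri u v w, forall z, itri u v z -> z = w, forall z, itri u w z -> z = v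
    & forall z, itri v w z -> z = u].
Definition diamond (u v w z : T) : Prop := [/\ itri u v w, itri u v z & w <> z].

(** Without M_1 an internal triangle shares sides with at most one other, so isolated triangles and
    diamonds cover all of them. *)
Definition isoblock (b : {set T}) : Prop := exists u v w, b = [set u; v; w] /\ isolated u v w.
Definition diablock (b : {set T}) : Prop := exists u v w z, b = [set u; v; w; z] /\ diamond u v w z.
Definition block (b : {set T}) : Prop := isoblock b \/ diablock b.

Lemma isolated_swap12 u v w : isolated u v w -> isolated v u w.
Proof.
case=> t a b c; split=> // [|z t']; first exact: itri_swap12.
by apply: a; apply: itri_swap12.
Qed.

Lemma isolated_swap23 u v w : isolated u v w -> isolated u w v.
Proof.
case=> t a b c; split=> // [|z t']; first exact: itri_swap23.
by apply: c; apply: itri_swap12.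
Qed.

Lemma diamond_swap12 u v w z : diamond u v w z -> diamond v u w z.
Proof. by case=> a b c; split=> //; apply: itri_swap12. Qed.

Lemma diamond_swap34 u v w z : diamond u v w z -> diamond u v z w.
Proof. by case=> a b c; split=> //; apply: nesym. Qed.

Lemma diamond_side u v w z q : diamond u v w z -> itri u w q -> q = v.
Proof. by case=> t1 t2 wz t3; apply: (no_M1 t1 t2 wz t3). Qed.

Lemma diamond_apex u v w z q : diamond u v w z -> itri u v q -> q = w \/ q = z.
Proof. by case=> t1 t2 wz t3; apply: (apex_of_two t1 t2 wz t3). Qed.

Lemma diamond_tips u v w z : diamond u v w z -> ~~ e w z.
Proof.
case=> /itri_edges[uv uw vw] /itri_edges[_ uz vz] _.
by apply/negP => c; apply: (no_K4 e_sym e_irr emb uv uw uz vw vz c).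
Qed.

Lemma itri_block u v w : itri u v w -> exists b, [/\ block b, u \in b, v \in b & w \in b].
Proof.
move=> t.
have other a b c : itri a b c -> (forall q, itri a b q -> q = c) \/ exists z, diamond a b c z.
  move=> t'; have [/existsP[z /andP[tz zc]]|no] := boolP [exists z, itri a b z && (z != c)].
    by right; exists z; split=> //; apply/nesym/eqP.
  left=> q tq; apply/eqP/negPn/negP => qc; case/negP: no; apply/existsP; exists q.
  by rewrite tq qc.
case: (other _ _ _ t) => [o1|[z d]]; last first.
  by exists [set u; v; w; z]; split; [right; exists u, v, w, z | rewrite !inE eqxx ?orbT..].
case: (other _ _ _ (itri_swap23 e_sym t)) => [o2|[z d]]; last first.
  by exists [set u; w; v; z]; split; [right; exists u, w, v, z | rewrite !inE eqxx ?orbT..].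
case: (other _ _ _ (itri_swap23 e_sym (itri_swap12 e_sym t))) => [o3|[z d]]; last first.
  by exists [set v; w; u; z]; split; [right; exists v, w, u, z | rewrite !inE eqxx ?orbT..].
by exists [set u; v; w]; split; [left; exists u, v, w | rewrite !inE eqxx ?orbT..].
Qed.

Lemma edge_block x y : ired x y -> exists b, [/\ block b, x \in b & y \in b].
Proof. by case/existsP=> w /itri_block[b [B xb yb _]]; exists b. Qed.

(* The only block containing the edge xy, see block_edge_closure. *)
Definition edge_closure (x y : T) : {set T} :=
  [set p | [|| p == x, p == y, itri x y p |
             [exists q, itri x y q && (itri x q p || itri y q p)]]].

Lemma edge_closureC x y : edge_closure x y = edge_closure y x.
Proof.
have C a b c : itri a b c = itri b a c by apply/idP/idP; apply: itri_swap12.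
apply/setP => p; rewrite !inE orbCA C; congr [|| _, _, _ | _].
by apply: eq_existsb => q; rewrite C orbC.
Qed.

Lemma edge_closureP x y p : reflect
  [\/ p = x \/ p = y, itri x y p | exists2 q, itri x y q & itri x q p \/ itri y q p]
  (p \in edge_closure x y).
Proof.
rewrite inE; apply: (iffP or4P) =>
  [[/eqP->|/eqP->|t|/existsP[q /andP[t /orP o]]]|[[->|->]|t|[q t /orP o]]].
- by apply: Or31; left.
- by apply: Or31; right.
- exact: Or32.
- by apply: Or33; exists q.
- exact: Or41.
- exact: Or42.
- exact: Or43.
- by apply: Or44; apply/existsP; exists q; rewrite t o.
Qed.

(** A block is thereby determined by any of its edges. From the common side of a diamond one step
    reaches both apexes; from an outer side a second step, across the common side, reaches the far
    one. *)
Lemma block_edge_closure b x y : block b -> x \in b -> y \in b -> ired x y -> b = edge_closure x y.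
Proof.
have iso u v w : isolated u v w -> [set u; v; w] = edge_closure u v.
  case=> t a1 a2 a3; apply/setP => p; apply/idP/edge_closureP; rewrite !inE.
    case/orP=> [/orP[]|] /eqP->; [by apply: Or31; left | by apply: Or31; right | exact: Or32].
  case=> [[->|->]|/a1->|[q /a1-> [/a2->|/a3->]]]; by rewrite eqxx ?orbT.
have dia1 u v w z : diamond u v w z -> [set u; v; w; z] = edge_closure u v.
  move=> d; have [t1 t2 wz] := d; apply/setP => p; apply/idP/edge_closureP; rewrite !inE.
    by case/orP=> [/orP[/orP[]|]|] /eqP->;
      [apply: Or31; left | apply: Or31; right | exact: Or32 | exact: Or32].
  have d' := diamond_swap12 d.
  case=> [[->|->]|/(diamond_apex d)[]->|[q /(diamond_apex d)[]-> []]]; rewrite ?eqxx ?orbT //.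
  - by move/(diamond_side d)->; rewrite eqxx ?orbT.
  - by move/(diamond_side d')->; rewrite eqxx ?orbT.
  - by move/(diamond_side (diamond_swap34 d))->; rewrite eqxx ?orbT.
  - by move/(diamond_side (diamond_swap34 d'))->; rewrite eqxx ?orbT.
have dia2 u v w z : diamond u v w z -> [set u; v; w; z] = edge_closure u w.
  move=> d; have [t1 t2 wz] := d; have t3 := itri_swap23 e_sym t1.
  apply/setP => p; apply/idP/edge_closureP; rewrite !inE.
    case/orP=> [/orP[/orP[]|]|] /eqP->;
      [by apply: Or31; left | exact: Or32 | by apply: Or31; right |].
    by apply: Or33; exists v => //; left.
  case=> [[->|->]|/(diamond_side d)->|[q /(diamond_side d)-> []]]; rewrite ?eqxx ?orbT //.
    by case/(diamond_apex d)=> ->; rewrite eqxx ?orbT.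
  by move/(itri_swap12 e_sym)/(diamond_side (diamond_swap12 d))->; rewrite eqxx.
have r4 (u v w z : T) : [set u; v; w; z] = [set v; u; w; z] by rewrite (setUC [set u]).
have r3 (u v w z : T) : [set u; v; w; z] = [set u; v; z; w] by rewrite setUAC.
have no a : ired a a -> False by move/ired_edge; rewrite e_irr.
case=> [[u [v [w [-> i]]]]|[u [v [w [z [-> d]]]]]].
  have i2 := isolated_swap23 i; have i1 := isolated_swap12 i.
  rewrite !inE => /orP[/orP[]|] /eqP-> /orP[/orP[]|] /eqP-> r; try by case: (no _ r).
  - exact: iso.
  - by rewrite set3_swap23; apply: iso.
  - by rewrite set3_swap12; apply: iso.
  - by rewrite set3_swap12 set3_swap23; apply: iso; apply: isolated_swap23.
  - by rewrite edge_closureC set3_swap23; apply: iso.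
  - by rewrite edge_closureC set3_swap12 set3_swap23; apply: iso; apply: isolated_swap23.
have d1 := diamond_swap12 d; have d2 := diamond_swap34 d; have d3 := diamond_swap34 d1.
have n1 : ired w z -> False by move/ired_edge; apply/negP/(diamond_tips d).
have n2 : ired z w -> False by move/ired_edge; apply/negP/(diamond_tips d2).
rewrite !inE => /orP[/orP[/orP[]|]|] /eqP-> /orP[/orP[/orP[]|]|] /eqP-> r;
  try by [case: (no _ r) | case: (n1 r) | case: (n2 r)].
- exact: dia1.
- exact: dia2.
- by rewrite r3; exact: dia2.
- by rewrite edge_closureC; exact: dia1.
- by rewrite r4; exact: dia2.
- by rewrite r4 r3; exact: dia2.
- by rewrite edge_closureC; exact: dia2.
- by rewrite edge_closureC r4; exact: dia2.
- by rewrite edge_closureC r3; exact: dia2.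
- by rewrite edge_closureC r4 r3; exact: dia2.
Qed.

Lemma edge_block_uniq b b' x y : block b -> block b' -> x \in b -> y \in b ->
  x \in b' -> y \in b' -> ired x y -> b = b'.
Proof. by move=> B B' xb yb xb' yb' r;
  rewrite (block_edge_closure B xb yb r) (block_edge_closure B' xb' yb' r). Qed.

Definition off (b : {set T}) : rel T := fun x y => ired x y && ~~ ((x \in b) && (y \in b)).

Lemma offE b x y : off b x y = ired x y && ~~ ((x \in b) && (y \in b)).
Proof. by []. Qed.

Lemma off_sym b : connect_sym (off b).
Proof.
apply: sym_connect_sym => x y; rewrite /off (iredC pos e_sym) andbC.
by rewrite [RHS]andbC [(y \in b) && _]andbC.
Qed.

Lemma connect_inv (R : rel T) (K : T -> Prop) x y :
  K x -> (forall p q, K p -> R p q -> K q) -> connect R x y -> K y.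
Proof.
move=> Kx KR /connectP[s + ->] {y}; elim: s x Kx => //= z s IH x Kx /andP[xz].
by apply: IH; apply: KR xz.
Qed.

(* Every vertex off b lies across one of the sides of b, and across each side at most
   one end of this side has further edges of the reduced graph. *)
Lemma block_cut_sides (b : {set T}) (sides : seq (T * T * T)) :
  (forall p, p \notin b -> exists u w v, (u, w, v) \in sides /\ btw pos u w p != btw pos u w v) ->
  (forall u w v, (u, w, v) \in sides ->
     [/\ u \in b, w \in b, inner e pos u w, v <> u /\ v <> w &
       forall z, z \in b -> z <> u -> z <> w -> btw pos u w z = btw pos u w v] /\
     forall q, itri u w q -> btw pos u w q = btw pos u w v) ->
  forall x y, x \in b -> y \in b -> connect (off b) x y -> x = y.
Proof.
move=> out sideP x y xb yb.
have nb p z : z \in b -> p \notin b -> p <> z by move=> zb + E; rewrite E zb.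
(* Invariant of a walk avoiding the edges of [b]: it is at [x], or beyond a side of [b] that ends at
   [x] and beyond which [x] has an edge [xr] of the reduced graph. *)
pose K p := p = x \/ p \notin b /\ exists u w v r, [/\ (u, w, v) \in sides, x = u \/ x = w,
   btw pos u w p != btw pos u w v & [/\ r \notin b, ired x r & btw pos u w r != btw pos u w v]].
suff KK : connect (off b) x y -> K y.
  by move/KK=> [//|]; rewrite yb => -[].
apply: connect_inv; first by left.
move=> p p' [->|[pnb [u [w [v [r [S xuw bp [rb xr br]]]]]]]] /andP[pp'].
  rewrite xb /= => p'b; right; split=> //.
  have [u [w [v [S bp']]]] := out p' p'b; have [[ub wb iuw _ same] _] := sideP _ _ _ S.
  exists u, w, v, p'; split=> //.
  have [->|/eqP xu] := eqVneq x u; first by left.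
  have [->|/eqP xw] := eqVneq x w; first by right.
  case/eqP: bp'; rewrite -(same x xb xu xw); apply/esym.
  by apply: (same_side e_sym emb (inner_edge iuw) (ired_edge pp')) => //; apply: nb.
move=> _; have [[ub wb iuw [vu vw] same] notri] := sideP _ _ _ S.
have pu := nb _ _ ub pnb; have pw := nb _ _ wb pnb.
have SS := same_side e_sym emb (inner_edge iuw) (ired_edge pp') pu pw.
have [p'b|p'b] := boolP (p' \in b); last first.
  by right; split=> //; exists u, w, v, r; split=> //; rewrite -SS //; apply: nb.
left; have [//|/eqP p'x] := eqVneq p' x; exfalso.
have p'uw : p' = u \/ p' = w.
  have [->|/eqP p'u] := eqVneq p' u; first by left.
  have [->|/eqP p'w] := eqVneq p' w; first by right.
  by case/eqP: bp; rewrite SS // same.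
have p'p : ired p' p by rewrite (iredC pos e_sym).
have ru := nb _ _ ub rb; have rw := nb _ _ wb rb.
(* A return to [b] at the other end of the side gives both ends edges beyond it, hence by
   [one_owner] an internal triangle there, against [notri]. *)
have [q [tq bq]] : exists q, itri u w q /\ btw pos u w q != btw pos u w v.
  case: xuw p'uw => E1 [] E2; subst; try by case: p'x.
    by case: (one_owner e_sym e_irr emb emax iuw vu vw xr p'p rw pu br bp) => q; exists q.
  by case: (one_owner e_sym e_irr emb emax iuw vu vw p'p xr pw ru bp br) => q; exists q.
by rewrite (notri _ tq) eqxx in bq.
Qed.

(** Three chords forming a triangle cut off one piece of the disc behind each side, and every other
    vertex lies in one of these pieces. *)
Lemma outside_triangle u v w p : v <> u -> w <> u -> w <> v -> p <> u -> p <> v -> p <> w ->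
  [|| btw pos u v p != btw pos u v w, btw pos u w p != btw pos u w v
    | btw pos v w p != btw pos v w u].
Proof.
move=> /(pos_neq emb) vu /(pos_neq emb) wu /(pos_neq emb) wv /(pos_neq emb) pu /(pos_neq emb) pv.
by move=> /(pos_neq emb) pw; move: vu wu wv pu pv pw; rewrite /btw; clear; lia.
Qed.

(** The relevant sides are those of the triangle, or the four outer sides of the diamond; no
    internal triangle lies beyond them, by isolation or by [diamond_side]. *)
Lemma block_cut b x y : block b -> x \in b -> y \in b -> connect (off b) x y -> x = y.
Proof.
case=> [[u [v [w [-> i]]]]|[u [v [w [z [-> d]]]]]].
  have [t a1 a2 a3] := i; have [uv uw vw] := itri_edges t; have [iuv iuw ivw] := itri_inner t.
  have ne a c : e a c -> c <> a by move/(edge_neq e_irr)/nesym.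
  have nuv := ne _ _ uv; have nuw := ne _ _ uw; have nvw := ne _ _ vw.
  apply: (block_cut_sides (sides := [:: (u, v, w); (u, w, v); (v, w, u)])).
    move=> p; rewrite !inE !negb_or => /andP[/andP[/eqP pu /eqP pv] /eqP pw].
    case/or3P: (outside_triangle nuv nuw nvw pu pv pw) => h;
      [exists u, v, w | exists u, w, v | exists v, w, u]; by rewrite !inE eqxx ?orbT.
  move=> a0 b0 c0; rewrite !inE => /or3P[] /eqP[-> -> ->];
    (split; [split; [by rewrite ?inE eqxx ?orbT | by rewrite ?inE eqxx ?orbT | by []
       | by split=> //; apply: nesym | by move=> r; rewrite ?inE => /orP[/orP[]|] /eqP->] |]) => q.
  - by move/a1->.
  - by move/a2->.
  - by move/a3->.
have [t1 t2 wz] := d; have [uv uw vw] := itri_edges t1; have [iuv iuw ivw] := itri_inner t1.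
have [_ uz vz] := itri_edges t2; have [_ iuz ivz] := itri_inner t2.
have d1 := diamond_swap12 d; have d2 := diamond_swap34 d; have d3 := diamond_swap34 d1.
have ne a c : e a c -> c <> a by move/(edge_neq e_irr)/nesym.
have nuv := ne _ _ uv; have nuw := ne _ _ uw; have nvw := ne _ _ vw; have nuz := ne _ _ uz;
  have nvz := ne _ _ vz.
have opp : btw pos u v w != btw pos u v z.
  by apply/eqP => bb; apply: wz; apply: (apex_uniq e_sym e_irr emb uv).
have SS a a1 c r : e a a1 -> e c r -> a <> c -> a <> r -> a1 <> c -> a1 <> r ->
  btw pos a a1 r = btw pos a a1 c.
  move=> ab cr *; apply/esym.
  by apply: (same_side e_sym emb ab cr); apply: nesym.
apply: (block_cut_sides (sides := [:: (u, w, v); (v, w, u); (u, z, v); (v, z, u)])).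
  move=> p; rewrite !inE !negb_or => /andP[/andP[/andP[/eqP pu /eqP pv] /eqP pw] /eqP pz].
  have [E|E] := eqVneq (btw pos u v p) (btw pos u v w).
    have := outside_triangle nuv nuw nvw pu pv pw; rewrite E eqxx /= => /orP[] h;
      [exists u, w, v | exists v, w, u]; by rewrite !inE eqxx ?orbT.
  have E' : btw pos u v p = btw pos u v z by move: E opp; do 3 case: (btw _ _ _ _).
  have := outside_triangle nuv nuz nvz pu pv pz; rewrite E' eqxx /= => /orP[] h;
    [exists u, z, v | exists v, z, u]; by rewrite !inE eqxx ?orbT.
move=> a0 b0 c0; rewrite !inE => /or4P[] /eqP[-> -> ->];
  (split; [split; [by rewrite ?inE eqxx ?orbT | by rewrite ?inE eqxx ?orbT | by []
    | by split=> //; apply: nesym |] |]).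
- move=> r; rewrite ?inE => /orP[/orP[/orP[]|]|] /eqP-> // _ _; apply: SS => //; exact: nesym.
- by move=> q /(diamond_side d)->.
- move=> r; rewrite ?inE => /orP[/orP[/orP[]|]|] /eqP-> // _ _; apply: SS => //; exact: nesym.
- by move=> q /(diamond_side d1)->.
- move=> r; rewrite ?inE => /orP[/orP[/orP[]|]|] /eqP-> // _ _; apply: SS => //; exact: nesym.
- by move=> q /(diamond_side d2)->.
- move=> r; rewrite ?inE => /orP[/orP[/orP[]|]|] /eqP-> // _ _; apply: SS => //; exact: nesym.
- by move=> q /(diamond_side d3)->.
Qed.

End Blocks.

(** * Chains of triangles *)

Opaque ired.

Section Chains.
Variables (T : finType) (e : rel T) (pos : T -> nat).
Hypotheses (e_sym : symmetric e) (e_irr : irreflexive e) (emb : embedding e pos).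
Hypotheses (emax : maximal_outerplanar e) (free : M_free e).
Local Notation itri := (itri e pos).
Local Notation ired := (ired e pos).
Local Notation off := (off e pos).
Local Notation block := (block e pos).
Local Notation isoblock := (isoblock e pos).
Local Notation diablock := (diablock e pos).

Definition chain_edges (l : nat) : seq (nat * nat) :=
  flatten [seq [:: (cidx (2 * i - 2), cidx (2 * i - 1));
                   (cidx (2 * i - 1), cidx (2 * i));
                   (cidx (2 * i - 2), cidx (2 * i))]%N | i <- iota 1 l].

Definition pan_edges (l : nat) (ca : bool) : seq (nat * nat) :=
  [:: (0,1); (1,2); (2,3); (3,0); (if ca then (0,2) else (1,3))]%N ++ chain_edges l.

(* The indices of M1l outside 4, 5, 6, the vertices of its second diamond. *)
Definition pan_index (l i : nat) : bool := (i < 4)%N || (6 < i < 2 * l + 7)%N.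

Lemma cidx2E l : cidx (2 * l) = if l == 0%N then 0%N else (2 * l + 6)%N.
Proof. by rewrite /cidx; case: l => [|l]; rewrite ?muln0 // (_ : (2 * l.+1 == 0)%N = false);
  lia. Qed.

Lemma pan_edgesS l ca i j : linked (pan_edges l.+1 ca) i j =
  linked (pan_edges l ca) i j ||
  linked [:: (cidx (2 * l), 2 * l + 7); (2 * l + 7, 2 * l + 8); (cidx (2 * l), 2 * l + 8)]%N i j.
Proof.
have -> : pan_edges l.+1 ca = pan_edges l ca ++
    [:: (cidx (2 * l), 2 * l + 7); (2 * l + 7, 2 * l + 8); (cidx (2 * l), 2 * l + 8)]%N.
  rewrite /pan_edges /chain_edges -catA; congr (_ ++ _).
  have -> : iota 1 l.+1 = iota 1 l ++ [:: (1 + l)%N] by rewrite -(addn1 l) iotaD.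
  rewrite map_cat flatten_cat; congr (_ ++ _); rewrite [LHS]/=.
  have -> : (2 * (1 + l) - 2 = 2 * l)%N by lia.
  have -> : cidx (2 * (1 + l) - 1) = (2 * l + 7)%N.
    by rewrite /cidx (_ : (2 * (1 + l) - 1 == 0)%N = false); lia.
  have -> : cidx (2 * (1 + l)) = (2 * l + 8)%N by rewrite cidx2E add1n /=; lia.
  by [].
by rewrite /linked !mem_cat orbACA.
Qed.

Lemma pan_edges_index l ca i j : linked (pan_edges l ca) i j -> pan_index l i && pan_index l j.
Proof.
elim: l => [|l IH].
  by rewrite /linked /pan_edges /chain_edges cats0; case: ca; rewrite !inE /pan_index;
     case/orP=> /or4P[|||/orP[]] /eqP[-> ->].
rewrite pan_edgesS => /orP[/IH|]; rewrite /pan_index; first lia.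
have := cidx2E l; case: eqP => /= l0 c.
  by rewrite /linked !inE c !xpair_eqE; lia.
by rewrite /linked !inE c !xpair_eqE; lia.
Qed.

Lemma pan_index_end l : pan_index l (cidx (2 * l)).
Proof. by rewrite cidx2E /pan_index; case: eqP; lia. Qed.

Lemma pan_indexS l i :
  pan_index l.+1 i -> [\/ i = (2 * l + 7)%N, i = (2 * l + 8)%N | pan_index l i].
Proof.
rewrite /pan_index => il.
have [|[|]] : i = (2 * l + 7)%N \/ i = (2 * l + 8)%N \/ (i < 4)%N || (6 < i < 2 * l + 7)%N by lia.
- by apply: Or31.
- by apply: Or32.
- by apply: Or33.
Qed.

Lemma M1l_index l i : (i < 2 * l + 7)%N -> [\/ i = 4%N, i = 5%N, i = 6%N | pan_index l i].
Proof.
rewrite /pan_index => il.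
have [|[|[|]]] : i = 4%N \/ i = 5%N \/ i = 6%N \/ (i < 4)%N || (6 < i < 2 * l + 7)%N by lia.
- by apply: Or41.
- by apply: Or42.
- by apply: Or43.
- by apply: Or44.
Qed.

(* S is the vertex set of the part of M_1^l consisting of the first diamond and the l
   triangles, embedded by F and ending at y in the block b; by pan_cut it does not meet
   the part of the reduced graph lying beyond y. *)
Record pan (b : {set T}) (y : T) (l : nat) (ca : bool) (F : nat -> T) (S : {set T}) : Prop := Pan {
  pan_inj : forall i j, pan_index l i -> pan_index l j -> F i = F j -> i = j;
  pan_adj : forall i j, pan_index l i -> pan_index l j -> i != j ->
    linked (pan_edges l ca) i j = ired (F i) (F j);
  pan_end : F (cidx (2 * l)) = y;
  pan_set : forall x, x \in S <-> exists2 i, pan_index l i & F i = x;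
  pan_block : block b /\ y \in b;
  pan_cut : forall x, x \in S -> connect (off b) y x -> x = y;
  pan_conn : forall x, x \in S -> connect (fun p q => [&& ired p q, p \in S & q \in S]) x y;
  pan_nbr : forall x, x \in S -> exists z, ired x z }.

Lemma frame (A : {set T}) y : diablock A -> y \in A -> exists (c : bool) a2 a3 a4,
  [/\ A = [set y; a2; a3; a4], uniq [:: y; a2; a3; a4],
      [/\ ired y a2, ired a2 a3, ired a3 a4 & ired a4 y] & ired y a3 = c /\ ired a2 a4 = ~~ c].
Proof.
move=> [u [v [w [z [-> d]]]]].
have irC a b : ired a b = ired b a := iredC pos e_sym a b.
have base u' v' w' z' : diamond e pos u' v' w' z' ->
   [/\ ired u' v', ired u' w', ired v' w',
     ired u' z' & ired v' z'] /\ ired w' z' = false /\ uniq [:: u'; w'; v'; z'].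
  move=> d'; have := diamond_tips e_sym e_irr emb d' => /negP n; have [t1 t2 wz] := d'.
  have [uv uw vw] := itri_edges t1; have [_ uz vz] := itri_edges t2.
  split; first split.
  - exact: ired_itri t1.
  - exact: ired_itri (itri_swap23 e_sym t1).
  - exact: ired_itri (itri_swap23 e_sym (itri_swap12 e_sym t1)).
  - exact: ired_itri (itri_swap23 e_sym t2).
  - exact: ired_itri (itri_swap23 e_sym (itri_swap12 e_sym t2)).
  split; first by apply/idP => /ired_edge.
  have ne a c : e a c -> a <> c by exact: edge_neq.
  have ne' a c : e a c -> c <> a by move/(edge_neq e_irr)/nesym.
  by rewrite /= !inE !negb_or; do ?[apply/andP; split] => //; apply/eqP; auto.
have hub u' v' w' z' : diamond e pos u' v' w' z' -> exists (c : bool) a2 a3 a4,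
  [/\ [set u'; v'; w'; z'] = [set u'; a2; a3; a4], uniq [:: u'; a2; a3; a4],
      [/\ ired u' a2, ired a2 a3, ired a3 a4 & ired a4 u'] & ired u' a3 = c /\ ired a2 a4 = ~~ c].
  move/base=> [[uv uw vw uz vz] [wz un]]; exists true, w', v', z'; split=> //.
    by rewrite -(setUA [set u']) (setUC [set v']) setUA.
  by split=> //; rewrite irC.
have tip u' v' w' z' : diamond e pos u' v' w' z' -> exists (c : bool) a2 a3 a4,
  [/\ [set u'; v'; w'; z'] = [set w'; a2; a3; a4], uniq [:: w'; a2; a3; a4],
      [/\ ired w' a2, ired a2 a3, ired a3 a4 & ired a4 w'] & ired w' a3 = c /\ ired a2 a4 = ~~ c].
  move/base=> [[uv uw vw uz vz] [wz un]]; exists false, u', z', v'; split=> //.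
  - apply/setP => x; rewrite !inE; do 4 case: (x == _) => //.
  - move: un; rewrite /= !inE !negb_or !andbT => /and3P[/and3P[p1 p2 p3] /andP[p4 p5] p6].
    by rewrite (eq_sym w' u') p1 p5 p4 p3 p2 (eq_sym z' v') p6.
  by split=> //; rewrite irC.
have s12 (a b c f : T) : [set a; b; c; f] = [set b; a; c; f] by rewrite (setUC [set a]).
have s34 (a b c f : T) : [set a; b; c; f] = [set a; b; f; c] by rewrite setUAC.
rewrite !inE => /orP[/orP[/orP[]|]|] /eqP->.
- exact: hub.
- by rewrite s12; apply: hub; apply: diamond_swap12.
- exact: tip.
- by rewrite s34; apply: tip; apply: diamond_swap34.
Qed.

(** The block [b'] is connected by its own edges, none of which lies in [b], since an edge belongs
    to a single block. *)
Lemma block_connected b b' y p : block b -> block b' -> b <> b' -> y \in b' -> p \in b' ->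
  connect (off b) y p.
Proof.
move=> B B' bb' yb' pb'.
have step q r : q \in b' -> r \in b' -> ired q r -> connect (off b) q r.
  move=> qb rb qr; apply: connect1; rewrite offE qr /=; apply/negP => /andP[qb' rb'].
  by apply: bb'; apply: (edge_block_uniq e_sym e_irr emb free B B' qb' rb' qb rb qr).
have [->|/eqP py] := eqVneq p y; first exact: connect0.
have irC a c : ired a c = ired c a := iredC pos e_sym a c.
case: B' => [[u [v [w [E [t _ _ _]]]]]|D].
  have r1 := ired_itri t; have r2 := ired_itri (itri_swap23 e_sym t).
  have r3 := ired_itri (itri_swap23 e_sym (itri_swap12 e_sym t)).
  apply: step => //; move: yb' pb'; rewrite E !inE => /orP[/orP[]|] /eqP E1 /orP[/orP[]|] /eqP E2;
    subst y p; rewrite // irC //.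
have [c [a2 [a3 [a4 [E _ [r1 r2 r3 r4] _]]]]] := frame D yb'.
have mem x : x \in [:: y; a2; a3; a4] -> x \in b' by rewrite E !inE -!orbA.
move: pb'; rewrite {1}E !inE => /orP[/orP[/orP[]|]|] /eqP pE; first by rewrite pE in py.
- by rewrite pE; apply: step => //; apply: mem; rewrite !inE eqxx ?orbT.
- rewrite pE; apply: (@connect_trans _ _ a2); apply: step => //; apply: mem;
  rewrite !inE eqxx ?orbT //.
- by rewrite pE; apply: step; rewrite 1?irC //; apply: mem; rewrite !inE eqxx ?orbT.
Qed.

(** The block [b'] can be reached from [y] off [b], while [pan_cut] keeps the rest of [S] out of
    reach: a contact between [p] and [S] other than at [y] would open a detour. *)
Lemma pan_attach b y l ca F S b' p : pan b y l ca F S -> block b' -> b <> b' -> y \in b' ->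
  p \in b' -> p <> y -> p \notin S /\ forall s, s \in S -> s <> y -> ired p s = false.
Proof.
move=> H B' bb' yb' pb' py; have [B yb] := pan_block H.
have cyp := block_connected B B' bb' yb' pb'.
split; first by apply/negP => pS; apply: py; exact: (pan_cut H pS).
move=> s sS sy; apply/idP => ps; have [pb|pb] := boolP (p \in b).
  by apply: py; apply/esym; apply: (block_cut e_sym e_irr emb emax free B).
apply: sy; apply: (pan_cut H sS); apply: (connect_trans cyp); apply: connect1.
by rewrite offE ps (negPf pb).
Qed.

Lemma pan_start A y : diablock A -> y \in A -> exists ca F, pan A y 0 ca F A.
Proof.
move=> D yA; have [c [a2 [a3 [a4 [E un [r1 r2 r3 r4] [rc rc']]]]]] := frame D yA.
have irC a b : ired a b = ired b a := iredC pos e_sym a b.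
exists c, (nth y [:: y; a2; a3; a4]).
have idx i : pan_index 0 i = (i < 4)%N by rewrite /pan_index; lia.
have setP x : reflect (exists2 i, pan_index 0 i & nth y [:: y; a2; a3; a4] i = x) (x \in A).
  have -> : (x \in A) = (x \in [:: y; a2; a3; a4]) by rewrite E !inE -!orbA.
  apply: (iffP (nthP y)) => -[i il ix]; exists i => //; first by rewrite idx.
  by rewrite -idx.
have adjs x : x \in A ->
  x = y \/ connect (fun p q => [&& ired p q, p \in A & q \in A]) x y /\ exists z, ired x z.
  have mA z : z \in [:: y; a2; a3; a4] -> z \in A by rewrite E !inE -!orbA.
  have st p q : ired p q -> p \in [:: y; a2; a3; a4] -> q \in [:: y; a2; a3; a4] ->
     connect (fun p q => [&& ired p q, p \in A & q \in A]) p q.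
    by move=> pq /mA pA /mA qA; apply: connect1; rewrite pq pA qA.
  rewrite {1}E !inE => /orP[/orP[/orP[]|]|] /eqP->; first by left.
  - by right; split; [apply: st; rewrite 1?irC ?inE ?eqxx ?orbT | exists a3].
  - right; split; [apply: (@connect_trans _ _ a4); apply: st;
    rewrite ?inE ?eqxx ?orbT // | by exists a4].
  - by right; split; [apply: st; rewrite ?inE ?eqxx ?orbT | exists y].
split=> //.
- by move=> i j; rewrite !idx => il jl /eqP; rewrite nth_uniq // => /eqP.
- move=> i j; rewrite !idx /linked /pan_edges /chain_edges cats0.
  by case: c rc rc' => rc rc'; case: i => [|[|[|[|//]]]]; case: j => [|[|[|[|//]]]] //= _ _ _;
    rewrite ?r1 ?r2 ?r3 ?r4 ?rc ?rc' // irC ?r1 ?r2 ?r3 ?r4 ?rc ?rc'.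
- by move=> x; split=> /setP.
- by split=> //; right.
- move=> x xA c'; apply/esym; apply: (block_cut e_sym e_irr emb emax free _ yA xA c').
  by right.
- by move=> x /adjs[->|[]//]; exact: connect0.
- by move=> x /adjs[->|[]//]; exists a2.
Qed.

Lemma pan_grow b y l ca F S b' x : pan b y l ca F S -> isoblock b' -> b <> b' -> y \in b' ->
  x \in b' -> x <> y -> exists F' S', pan b' x l.+1 ca F' S'.
Proof.
move=> H I bb' yb' xb' xy; have B' : block b' by left.
have irC a c : ired a c = ired c a := iredC pos e_sym a c.
have [q [E [yq yx qx] [qy qx']]] : exists q, [/\ b' = [set y; q; x],
    [/\ ired y q, ired y x & ired q x] & q <> y /\ q <> x].
  case: I => u [v [w [E [t _ _ _]]]].
  have r1 := ired_itri t; have r2 := ired_itri (itri_swap23 e_sym t).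
  have r3 := ired_itri (itri_swap23 e_sym (itri_swap12 e_sym t)).
  have ne a c : ired a c -> a <> c by move/ired_edge; exact: edge_neq.
  have ne' a c : ired a c -> c <> a by move/ne/nesym.
  have r1' := r1; have r2' := r2; have r3' := r3; rewrite irC in r1'; rewrite irC in r2';
    rewrite irC in r3'.
  move: yb' xb'; rewrite E !inE => /orP[/orP[]|] /eqP E1 /orP[/orP[]|] /eqP E2; subst y x;
    try by case: xy.
  - by exists w; split=> //; [rewrite set3_swap23 | auto].
  - by exists v; split=> //; auto.
  - by exists w; split=> //; [rewrite set3_swap12 set3_swap23 | auto].
  - by exists u; split=> //; [rewrite set3_swap12 | auto].
  - by exists v; split=> //; [rewrite set3_swap23 set3_swap12 set3_swap23 | auto].
  - by exists u; split=> //; [rewrite set3_swap23 set3_swap12 | auto].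
have qb' : q \in b' by rewrite E !inE eqxx orbT.
have [xS xno] := pan_attach H B' bb' yb' xb' xy.
have [qS qno] := pan_attach H B' bb' yb' qb' qy.
have [B yb] := pan_block H.
have ix0 := pan_index_end l.
have yS : y \in S by apply/(pan_set H); exists (cidx (2 * l)); rewrite // (pan_end H).
(* The new triangle takes the next two numbers: [2 * l + 7] for its middle vertex and [2 * l + 8]
   for the new end of the chain. *)
pose F' i := if i == (2 * l + 7)%N then q else if i == (2 * l + 8)%N then x else F i.
have F7 : F' (2 * l + 7)%N = q by rewrite /F' eqxx.
have F8 : F' (2 * l + 8)%N = x by rewrite /F' (_ : (2 * l + 8 == 2 * l + 7)%N = false) ?eqxx //;
  clear; lia.
have Fo i : pan_index l i -> F' i = F i.
  move=> il; rewrite /F'.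
  by do 2 (case: eqP => [E'|_]; first by move: il; rewrite E' /pan_index; clear; lia).
have idxS i := @pan_indexS l i.
have idx7 : pan_index l.+1 (2 * l + 7) by rewrite /pan_index; clear; lia.
have idx8 : pan_index l.+1 (2 * l + 8) by rewrite /pan_index; clear; lia.
have idxo i : pan_index l i -> pan_index l.+1 i by rewrite /pan_index; clear; lia.
have FS i : pan_index l i -> F i \in S by move=> il; apply/(pan_set H); exists i.
have old_no i j : ~~ pan_index l i -> linked (pan_edges l ca) i j = false.
  by move=> n; apply: contraNF n => /pan_edges_index/andP[].
have n7 : ~~ pan_index l (2 * l + 7) by rewrite /pan_index; clear; lia.
have n8 : ~~ pan_index l (2 * l + 8) by rewrite /pan_index; clear; lia.
have linkC s i j : linked s i j = linked s j i by rewrite /linked orbC.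
have new7 j : pan_index l j -> linked (pan_edges l.+1 ca) (2 * l + 7) j = ired q (F j).
  move=> jl; rewrite pan_edgesS old_no //=.
  have -> : linked [:: (cidx (2 * l), 2 * l + 7); (2 * l + 7, 2 * l + 8);
    (cidx (2 * l), 2 * l + 8)]%N
       (2 * l + 7) j = (j == cidx (2 * l)).
    rewrite /linked !inE !xpair_eqE; move: jl ix0; rewrite /pan_index; move: (cidx (2 * l)) => k;
      clear; lia.
  have [->|/eqP jn] := eqVneq j (cidx (2 * l)); first by rewrite (pan_end H) irC yq.
  apply/esym/qno; first exact: FS.
  by move=> E'; apply: jn; apply: (pan_inj H) => //; rewrite (pan_end H).
have new8 j : pan_index l j -> linked (pan_edges l.+1 ca) (2 * l + 8) j = ired x (F j).
  move=> jl; rewrite pan_edgesS old_no //=.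
  have -> : linked [:: (cidx (2 * l), 2 * l + 7); (2 * l + 7, 2 * l + 8);
    (cidx (2 * l), 2 * l + 8)]%N
       (2 * l + 8) j = (j == cidx (2 * l)).
    rewrite /linked !inE !xpair_eqE; move: jl ix0; rewrite /pan_index; move: (cidx (2 * l)) => k;
      clear; lia.
  have [->|/eqP jn] := eqVneq j (cidx (2 * l)); first by rewrite (pan_end H) irC yx.
  apply/esym/xno; first exact: FS.
  by move=> E'; apply: jn; apply: (pan_inj H) => //; rewrite (pan_end H).
have new78 : linked (pan_edges l.+1 ca) (2 * l + 7) (2 * l + 8) by rewrite pan_edgesS /linked
  !inE !eqxx ?orbT.
exists F', (x |: (q |: S)).
have setP z : reflect (exists2 i, pan_index l.+1 i & F' i = z) (z \in x |: (q |: S)).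
  apply: (iffP idP) => [|[i /idxS[->|->|il] <-]]; rewrite ?F7 ?F8 ?Fo // ?inE ?eqxx ?orbT //;
    last first.
    by rewrite FS ?orbT.
  case/orP=> [/eqP->|/orP[/eqP->|/(pan_set H)[i il <-]]].
  - by exists (2 * l + 8)%N.
  - by exists (2 * l + 7)%N.
  - by exists i; [exact: idxo | exact: Fo].
have sub z : z \in S -> z \in x |: (q |: S) by move=> zS; rewrite !inE zS !orbT.
have cz z : z \in S -> connect (fun p q0 => [&& ired p q0,
  p \in x |: (q |: S) & q0 \in x |: (q |: S)]) z y.
  move=> zS; apply: connect_sub (pan_conn H zS) => p r /and3P[pr pS rS].
  by apply: connect1; rewrite pr !sub.
have yx' : connect (fun p q0 => [&& ired p q0, p \in x |: (q |: S) & q0 \in x |: (q |: S)]) y x.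
  by apply: connect1; rewrite yx (sub _ yS) !inE eqxx.
split=> //.
- move=> i j /idxS[->|->|il] /idxS[->|->|jl]; rewrite ?F7 ?F8 ?Fo // => E'.
  + by rewrite E' FS in qS.
  + by case: qx'.
  + by rewrite E' FS in xS.
  + by rewrite -E' FS in qS.
  + by rewrite -E' FS in xS.
  + exact: (pan_inj H).
- move=> i j /idxS[->|->|il] /idxS[->|->|jl]; rewrite ?F7 ?F8 ?Fo // ?eqxx // => ij.
  + by rewrite new78 qx.
  + exact: new7.
  + by rewrite linkC new78 irC qx.
  + exact: new8.
  + by rewrite linkC new7 // irC.
  + by rewrite linkC new8 // irC.
  rewrite pan_edgesS (pan_adj H) //.
  rewrite [X in _ || X](_ : _ = false) ?orbF // /linked !inE !xpair_eqE.
  by move: il jl; rewrite /pan_index; clear; lia.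
- by rewrite (_ : cidx (2 * l.+1) = 2 * l + 8)%N // cidx2E /=; clear; lia.
- by move=> z; split=> /setP.
- move=> z; rewrite !inE => /orP[/eqP-> //|/orP[/eqP->|zS] c].
    by apply/esym; apply: (block_cut e_sym e_irr emb emax free B' xb' qb' c).
  (* The old vertices are connected among themselves off [b'], so reaching one of them from [x]
     would mean reaching [y], against [block_cut]. *)
  exfalso; apply: xy; apply: (block_cut e_sym e_irr emb emax free B' xb' yb').
  apply: (connect_trans c); apply: connect_sub (pan_conn H zS) => p r /and3P[pr pS rS].
  apply: connect1; rewrite offE pr /=; apply/negP => /andP[pb rb].
  have onlyy t : t \in S -> t \in b' -> t = y.
    move=> tS tb; have [//|/eqP ty] := eqVneq t y.
    by have [] := pan_attach H B' bb' yb' tb ty; rewrite tS.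
  by move: pr; rewrite (onlyy p) // (onlyy r) // => /ired_edge; rewrite e_irr.
- move=> z; rewrite !inE => /orP[/eqP->|/orP[/eqP->|zS]]; first exact: connect0.
    by apply: connect1; rewrite qx !inE !eqxx ?orbT.
  exact: connect_trans (cz z zS) yx'.
- move=> z; rewrite !inE => /orP[/eqP->|/orP[/eqP->|/(pan_nbr H)//]].
    by exists y; rewrite irC.
  by exists y; rewrite irC.
Qed.

(** A second diamond attached at the end of the chain would complete an induced M_1^l. *)
Lemma pan_two_diamonds b y l ca F S A : pan b y l ca F S -> diablock A -> y \in A -> b = A.
Proof.
move=> H D yA; have [//|/eqP bA] := eqVneq b A; exfalso.
have B' : block A by right.
have irC a c : ired a c = ired c a := iredC pos e_sym a c.
have [c [a2 [a3 [a4 [E un [r1 r2 r3 r4] [rc rc']]]]]] := frame D yA.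
have mA z : z \in [:: y; a2; a3; a4] -> z \in A by rewrite E !inE -!orbA.
have [n2 n3 n4] : [/\ a2 <> y, a3 <> y & a4 <> y].
  by move: un; rewrite /= !inE !negb_or => /andP[/and3P[/eqP ? /eqP ? /eqP ?] _]; split;
    apply: nesym.
have [S2 no2] := pan_attach H B' bA yA (mA a2 ltac:(by rewrite !inE eqxx ?orbT)) n2.
have [S3 no3] := pan_attach H B' bA yA (mA a3 ltac:(by rewrite !inE eqxx ?orbT)) n3.
have [S4 no4] := pan_attach H B' bA yA (mA a4 ltac:(by rewrite !inE eqxx ?orbT)) n4.
have ix0 := pan_index_end l.
have FS i : pan_index l i -> F i \in S by move=> il; apply/(pan_set H); exists i.
pose F' i := if (3 < i < 7)%N then nth y [:: a2; a3; a4] (i - 4) else F i.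
have Fo i : pan_index l i -> F' i = F i.
  by rewrite /F' /pan_index => il; rewrite (_ : (3 < i < 7)%N = false) //; move: il; clear; lia.
have idx i := @M1l_index l i.
have M1lE i j : linked (M1l_edges l ca c) i j = linked (pan_edges l ca) i j ||
    linked [:: (cidx (2 * l), 4); (4,5); (5,6); (6, cidx (2 * l));
      (if c then (cidx (2 * l),5) else (4,6))]%N i j.
  have aux (A0 B0 C0 A1 B1 C1 : bool) :
      A0 || (B0 || C0) || (A1 || (B1 || C1)) = A0 || C0 || (A1 || C1) || (B0 || B1).
    by case: A0; case: B0; case: C0; case: A1; case: B1; case: C1.
  by rewrite /linked /M1l_edges /pan_edges !mem_cat; exact: aux.
have old_no i j : ~~ pan_index l i -> linked (pan_edges l ca) i j = false.
  by move=> n; apply: contraNF n => /pan_edges_index/andP[].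
have linkC s i j : linked s i j = linked s j i by rewrite /linked orbC.
have nk k : (3 < k < 7)%N -> ~~ pan_index l k by rewrite /pan_index; clear; lia.
have eqy j : pan_index l j -> F j = y -> j = cidx (2 * l).
  by move=> jl Ej; apply: (pan_inj H) => //; rewrite (pan_end H).
have new k a s : (3 < k < 7)%N -> (forall s, s \in S -> s <> y -> ired a s = false) ->
   (forall j, pan_index l j -> linked [:: (cidx (2 * l), 4); (4,5); (5,6); (6, cidx (2 * l));
     (if c then (cidx (2 * l),5) else (4,6))]%N k j = (j == cidx (2 * l)) && s) -> s = ired a y ->
   forall j, pan_index l j -> linked (M1l_edges l ca c) k j = ired a (F j).
  move=> k47 no lk sE j jl; rewrite M1lE (old_no k) ?nk //= lk //.
  have [->|/eqP jn] := eqVneq j (cidx (2 * l)); first by rewrite (pan_end H) -sE.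
  by apply/esym; apply: no; [exact: FS | move/(eqy j jl)].
have new4 j : pan_index l j -> linked (M1l_edges l ca c) 4 j = ired a2 (F j).
  apply: (new 4%N a2 true) => //; last by rewrite irC r1.
  move=> {}j jl; rewrite andbT /linked; move: jl ix0; rewrite /pan_index; move: (cidx _) => k.
  by case: (c); rewrite !inE !xpair_eqE; clear; lia.
have new5 j : pan_index l j -> linked (M1l_edges l ca c) 5 j = ired a3 (F j).
  apply: (new 5%N a3 c) => //; last by rewrite irC rc.
  move=> {}j jl; rewrite /linked; move: jl ix0; rewrite /pan_index; move: (cidx _) => k.
  by case: (c); rewrite !inE !xpair_eqE; clear; lia.
have new6 j : pan_index l j -> linked (M1l_edges l ca c) 6 j = ired a4 (F j).
  apply: (new 6%N a4 true) => //.
  move=> {}j jl; rewrite andbT /linked; move: jl ix0; rewrite /pan_index; move: (cidx _) => k.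
  by case: (c); rewrite !inE !xpair_eqE; clear; lia.
have E4 : F' 4%N = a2 by []. have E5 : F' 5%N = a3 by []. have E6 : F' 6%N = a4 by [].
have un2 : [/\ a2 <> a3, a2 <> a4 & a3 <> a4].
  by move: un; rewrite /= !inE !negb_or => /andP[_ /andP[/andP[/eqP ? /eqP ?] /andP[/eqP ? _]]].
case: un2 => d23 d24 d34.
have nF a i : a \notin S -> pan_index l i -> F i <> a.
  by move=> aS /FS iS Ea; rewrite -Ea iS in aS.
case: (free) => _ /(_ l ca c); apply.
apply: (@induced_of_seq _ e pos e_sym e_irr emb _ (M1l l ca c) F').
- move=> i j /idx[->|->|->|il] /idx[->|->|->|jl]; rewrite ?E4 ?E5 ?E6 ?Fo // => EE;
    try (by [case: d23 | case: d24 | case: d34]);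
    try (by [case: (nF _ _ S2 il) | case: (nF _ _ S3 il) | case: (nF _ _ S4 il)]);
    try (by [case: (nF _ _ S2 jl) | case: (nF _ _ S3 jl) | case: (nF _ _ S4 jl)]).
  exact: (pan_inj H).
- move=> i /idx[->|->|->|il]; rewrite ?E4 ?E5 ?E6 ?Fo //; last by apply: (pan_nbr H); exact: FS.
  + by exists a3.
  + by exists a4.
  + by exists y.
move=> i j ij; have {}ij : nat_of_ord i <> nat_of_ord j by move=> EE; case/eqP: ij; exact: val_inj.
rewrite /M1l /rel_of_edges -[LHS]/(linked (M1l_edges l ca c) i j).
have small i0 j0 : (3 < i0 < 7)%N -> linked (M1l_edges l ca c) i0 j0 =
    linked [:: (cidx (2 * l), 4); (4,5); (5,6); (6, cidx (2 * l));
      (if c then (cidx (2 * l),5) else (4,6))]%N i0 j0.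
  by move=> k47; rewrite M1lE old_no ?nk.
have k45 : linked (M1l_edges l ca c) 4 5 by rewrite small // /linked !inE !eqxx ?orbT.
have k56 : linked (M1l_edges l ca c) 5 6 by rewrite small // /linked !inE !eqxx ?orbT.
have k46 : linked (M1l_edges l ca c) 4 6 = ~~ c.
  rewrite small // /linked; move: ix0; rewrite /pan_index; move: (cidx _) => k.
  by case: (c); rewrite !inE !xpair_eqE; clear; lia.
move: ij; case: (idx i (ltn_ord i)) => [->|->|->|il];
  case: (idx j (ltn_ord j)) => [->|->|->|jl] ij //;
  rewrite ?E4 ?E5 ?E6 ?Fo //.
- by rewrite k45 r2.
- by rewrite k46 rc'.
- exact: new4.
- by rewrite linkC k45 irC r2.
- by rewrite k56 r3.
- exact: new5.
- by rewrite linkC k46 irC rc'.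
- by rewrite linkC k56 irC r3.
- exact: new6.
- by rewrite linkC irC new4.
- by rewrite linkC irC new5.
- by rewrite linkC irC new6.
rewrite M1lE (pan_adj H) //; last exact/eqP.
rewrite [X in _ || X](_ : _ = false) ?orbF // /linked.
move: il jl; rewrite /pan_index; move: (cidx _) => k.
by case: (c); rewrite !inE !xpair_eqE; clear; lia.
Qed.

End Chains.

(** * From M-freeness to a claiming *)

Section ClaimingOfFree.
Variables (T : finType) (e : rel T) (pos : T -> nat).
Hypotheses (e_sym : symmetric e) (e_irr : irreflexive e) (emb : embedding e pos).
Hypotheses (emax : maximal_outerplanar e) (free : M_free e).
Local Notation itri := (itri e pos).
Local Notation ired := (ired e pos).
Local Notation off := (off e pos).
Local Notation block := (block e pos).
Local Notation isoblock := (isoblock e pos).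
Local Notation diablock := (diablock e pos).

(* A chain of isolated triangles starting at the block A; b is its last block and y
   the vertex of b where it ends. *)
Inductive reach (A : {set T}) : {set T} -> T -> Prop :=
| ReachStart y : y \in A -> reach A A y
| ReachStep b y b' x : reach A b y -> isoblock b' -> b <> b' -> y \in b' -> x \in b' -> x <> y ->
    reach A b' x.

Lemma reach_pan A b y : diablock A -> reach A b y -> exists l ca F S, pan e pos b y l ca F S.
Proof.
move=> D; elim=> [{}y yA|{}b {}y b' x _ [l [ca [F [S H]]]] I bb' yb' xb' xy].
  by have [ca [F H]] := pan_start e_sym e_irr emb emax free D yA; exists 0%N, ca, F, A.
have [F' [S' H']] := pan_grow e_sym e_irr emb emax free H I bb' yb' xb' xy.
by exists l.+1, ca, F', S'.
Qed.

Lemma reach_block A b y : diablock A -> reach A b y -> block b /\ y \in b.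
Proof. by move=> D; case=> [{}y yA|{}b {}y b' x _ I *]; split=> //; [right | left]. Qed.

Lemma reach_diamond A b y B : diablock A -> reach A b y -> diablock B -> y \in B -> b = B.
Proof.
move=> D /(reach_pan D)[l [ca [F [S H]]]] D' yB.
exact: (pan_two_diamonds e_sym e_irr emb emax free H D' yB).
Qed.

Lemma iso_not_dia b : isoblock b -> diablock b -> False.
Proof.
move=> [u [v [w [-> [t a1 a2 a3]]]]] [u' [v' [w' [z' [E d]]]]].
have : (#|[set u; v; w]| <= 3)%N.
  by rewrite -(setUA [set u]) (leq_trans (leq_card_setU _ _)) // cards1 cards2; case: (_ != _).
have un : uniq [:: u'; v'; w'; z'].
  have [t1 t2 /eqP wz] := d.
  have [uv uw vw] := itri_edges t1; have [_ uz vz] := itri_edges t2.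
  have ne a c : e a c -> a != c by move/(edge_neq e_irr)/eqP.
  by rewrite /= !inE !negb_or (ne _ _ uv) (ne _ _ uw) (ne _ _ uz) (ne _ _ vw) (ne _ _ vz) wz.
have -> : [set u; v; w] = [set x in [:: u'; v'; w'; z']].
  by apply/setP => x; rewrite E !inE -!orbA.
by rewrite cardsE (card_uniqP un).
Qed.

(** A chain of blocks follows a walk from [a]: a step within the last block moves the end, a step
    into another isolated triangle lengthens the chain, and a step into another diamond is excluded
    by [reach_diamond]. *)
Lemma connected_diamonds A B a a' : diablock A -> diablock B -> a \in A -> a' \in B ->
  connect ired a a' -> A = B.
Proof.
move=> DA DB aA a'B.
have K : connect ired a a' -> exists b, reach A b a'.
  apply: (connect_inv (K := fun x => exists b, reach A b x)); first by exists A; constructor.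
  move=> x x' [b R] xx'; have [Bb xb] := reach_block DA R.
  have [b' [Bb' xb' x'b']] := edge_block e_sym xx'.
  have ne := edge_neq e_irr (ired_edge xx').
  have [bb'|/eqP bb'] := eqVneq b b'.
    subst b'; case: R xb' x'b' xx' ne {Bb xb Bb'} =>
      [{}x xA|{}b {}y {}b' {}x R I bb' yb' xb' xy] _ x'b' xx' ne.
      by exists A; constructor.
    (* A step back to the vertex [y] where the last block was entered removes this block from the
       chain. *)
    have [->|/eqP x'y] := eqVneq x' y; first by exists b.
    by exists b'; apply: ReachStep R I bb' yb' x'b' x'y.
  case: Bb' => [I|D].
    by exists b'; apply: ReachStep R I bb' xb' x'b' (nesym ne).
  by case: bb'; exact: (reach_diamond DA R D xb').
move=> /K[b R]; have E := reach_diamond DA R DB a'B; subst b.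
by case: R DB => [//|b y b' x _ I *]; case: (iso_not_dia I).
Qed.

Definition in_diamond (x : T) : bool := [exists u, exists v, exists w, exists z,
  [&& itri u v w, itri u v z, w != z & x \in [set u; v; w; z]]].

Lemma in_diamondP x : reflect (exists2 A, diablock A & x \in A) (in_diamond x).
Proof.
apply: (iffP existsP) => [[u /existsP[v /existsP[w /existsP[z /and4P[t1 t2 /eqP wz xA]]]]]|].
  by exists [set u; v; w; z] => //; exists u, v, w, z.
move=> [_ [u [v [w [z [-> [t1 t2 /eqP wz]]]]]] xA].
by exists u; apply/existsP; exists v; apply/existsP; exists w; apply/existsP; exists z; apply/and4P.
Qed.

(* The root of the component of x in the reduced graph, taken in a diamond if there is one. *)
Definition croot (x : T) : T :=
  odflt (fingraph.root ired x) [pick y | connect ired x y && in_diamond y].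

Lemma ired_connect_sym : connect_sym ired.
Proof. by apply: sym_connect_sym => x y; exact: iredC. Qed.

Lemma croot_eq x y : connect ired x y -> croot x = croot y.
Proof.
move=> xy; rewrite /croot (fingraph.rootP ired_connect_sym xy).
congr (odflt _ _); apply: eq_pick => z; rewrite (same_connect ired_connect_sym xy) //.
Qed.

Lemma croot_connect x : connect ired x (croot x).
Proof. by rewrite /croot; case: pickP => [y /andP[]|_] //=; exact: connect_root. Qed.

Lemma croot_diamond x A : diablock A -> x \in A -> croot x \in A.
Proof.
move=> D xA; rewrite /croot; case: pickP => [y /andP[xy /in_diamondP[B DB yB]]|/(_ x)] /=.
  by rewrite (connected_diamonds D DB xA yB xy).
rewrite connect0 /= => /in_diamondP[]; by exists A.
Qed.

(* Within an isolated triangle the vertex leading to the root is left out; the two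
   triangles of a diamond share its four vertices. *)
Definition free_claim (x : T) (t : {set T}) : Prop :=
  isoblock t /\ x \in t /\ ~~ connect (off t) x (croot x) \/
  exists u v w z, [/\ (pos u < pos v)%N, diamond e pos u v w z, t = [set u; v; w] &
    x = w \/ x = (if btw pos u v w then u else v)].

Lemma diamond_connected u v w z x y b : diamond e pos u v w z -> isoblock b ->
  x \in [set u; v; w; z] -> y \in [set u; v; w; z] -> connect (off b) x y.
Proof.
move=> d I; set A := [set u; v; w; z] => xA yA.
have D : diablock A by exists u, v, w, z.
apply: (block_connected e_sym e_irr emb free (b' := A)) => //; [by left | by right |].
by move=> E; apply: (iso_not_dia I); rewrite E.
Qed.

(** A return to [b] at a vertex other than [x] is excluded by [block_cut], and the path does not
    pass through [x] again. *)
Lemma off_path b x z s : block b -> x \in b -> z \notin b -> ired x z -> path ired z s ->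
  x \notin s -> connect (off b) x (last z s).
Proof.
move=> B xb zb xz ps; have : connect (off b) x z by apply: connect1;
  rewrite offE xz negb_and zb orbT.
elim: s z zb ps {xz} => //= z' s IH z zb /andP[zz' ps] xz; rewrite in_cons negb_or => /andP[xz' xs].
have c : connect (off b) x z'.
  by apply: (connect_trans xz); apply: connect1; rewrite offE zz' negb_and zb.
apply: IH => //; apply/negP => z'b; case/eqP: xz'.
exact: (block_cut e_sym e_irr emb emax free B xb z'b c).
Qed.

(** The tips are recognized as the non-adjacent pair, and [pos] orders the two ends of the common
    side. *)
Lemma diamond_eq u v w z u' v' w' z' : diamond e pos u v w z -> diamond e pos u' v' w' z' ->
  (pos u < pos v)%N -> (pos u' < pos v')%N -> [set u; v; w; z] = [set u'; v'; w'; z'] ->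
  u = u' /\ v = v' /\ (w = w' /\ z = z' \/ w = z' /\ z = w').
Proof.
move=> d d' uv uv' /setP E.
have [t1 t2 wz] := d; have [_ uw vw] := itri_edges t1; have [_ uz vz] := itri_edges t2.
have [t1' t2' wz'] := d'; have [euv' uw' vw'] := itri_edges t1'; have [_ uz' vz'] := itri_edges t2'.
have n := diamond_tips e_sym e_irr emb d.
have ne a c : e a c -> a <> c by exact: edge_neq.
have mem x : x \in [set u; v; w; z] -> [\/ x = u', x = v', x = w' | x = z'].
  rewrite E !inE => /orP[/orP[/orP[]|]|] /eqP->;
    by [apply: Or41 | apply: Or42 | apply: Or43 | apply: Or44].
have mu : u \in [set u; v; w; z] by rewrite !inE eqxx.
have mv : v \in [set u; v; w; z] by rewrite !inE eqxx orbT.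
have mw : w \in [set u; v; w; z] by rewrite !inE eqxx orbT.
have mz : z \in [set u; v; w; z] by rewrite !inE eqxx orbT.
have tips : w = w' /\ z = z' \/ w = z' /\ z = w'.
  case: (mem w mw) => Ew; case: (mem z mz) => Ez; auto; exfalso; move: n wz; rewrite Ew Ez => n wz;
    by [apply: wz | case/negP: n => //; rewrite e_sym].
have hubs x : x \in [set u; v; w; z] -> x <> w -> x <> z -> x = u' \/ x = v'.
  by case/mem=> ->; auto; case: tips => -[-> ->].
have := hubs u mu (ne _ _ uw) (ne _ _ uz); have := hubs v mv (ne _ _ vw) (ne _ _ vz).
case=> Ev [] Eu; first by move: uv; rewrite Eu Ev ltnn.
- by move: uv; rewrite Eu Ev => uv; have := ltn_trans uv uv'; rewrite ltnn.
- by split.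
- by move: uv; rewrite Eu Ev ltnn.
Qed.

(** By [block_cut] at most one vertex of an isolated triangle is joined to the root off this
    triangle, so at least two claim it. *)
Lemma free_claiming : claiming e pos free_claim.
Proof.
split.
  move=> u v w t.
  have dia a b c z : itri a b c -> itri a b z -> c <> z ->
      free_claim c [set a; b; c] /\ (free_claim a [set a; b; c] \/ free_claim b [set a; b; c]).
    move=> t1 t2 cz; have ab : a <> b by case: (itri_edges t1) => /(edge_neq e_irr).
    have [lt|lt] : (pos a < pos b)%N \/ (pos b < pos a)%N by move/(pos_neq emb): ab; clear; lia.
      split; first by right; exists a, b, c, z; split=> //; left.
      case: (boolP (btw pos a b c)) => h; [left | right]; right; exists a, b, c, z; split=> //;
        right;
        by rewrite ?h ?(negPf h).
    rewrite set3_swap12; split; first by right; exists b, a, c, z; split=> //;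
      [apply: diamond_swap12 | left].
    case: (boolP (btw pos b a c)) => h; [right | left]; right; exists b, a, c, z; split=> //;
      [exact: diamond_swap12 | by right; rewrite h | exact: diamond_swap12 | by right;
        rewrite (negPf h)].
  have other a b c : itri a b c -> (forall q, itri a b q ->
    q = c) \/ exists2 z, itri a b z & c <> z.
    move=> t'; have [/existsP[z /andP[tz zc]]|no] := boolP [exists z, itri a b z && (z != c)].
      by right; exists z => //; apply/nesym/eqP.
    left=> q tq; apply/eqP/negPn/negP => qc; case/negP: no; apply/existsP; exists q.
    by rewrite tq qc.
  have t2 := itri_swap23 e_sym t; have t3 := itri_swap23 e_sym (itri_swap12 e_sym t).
  case: (other _ _ _ t) => [o1|[z tz wz]]; last first.
    by have [c1 [c2|c2]] := dia _ _ _ _ t tz wz; [apply: Or32 | apply: Or33].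
  case: (other _ _ _ t2) => [o2|[z tz wz]]; last first.
    have [] := dia _ _ _ _ t2 tz wz; rewrite -set3_swap23 => c1 [c2|c2];
      [apply: Or31 | apply: Or33]; by split.
  case: (other _ _ _ t3) => [o3|[z tz wz]]; last first.
    have [] := dia _ _ _ _ t3 tz wz; rewrite set3_swap23 set3_swap12 => c1 [c2|c2];
      rewrite -?(set3_swap23 u v w) in c1 c2 *; [apply: Or31 | apply: Or32]; by split.
  have I : isoblock [set u; v; w] by exists u, v, w.
  have Ub : u \in [set u; v; w] by rewrite !inE eqxx.
  have Vb : v \in [set u; v; w] by rewrite !inE eqxx orbT.
  have Wb : w \in [set u; v; w] by rewrite !inE eqxx orbT.
  have ruv : croot u = croot v by apply: croot_eq; apply: connect1; exact: ired_itri t.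
  have ruw : croot u = croot w by apply: croot_eq; apply: connect1; exact: ired_itri t2.
  have [uv uw vw] := itri_edges t.
  have cut x y : x \in [set u; v; w] -> y \in [set u; v; w] -> croot x = croot y -> x <> y ->
     free_claim x [set u; v; w] \/ free_claim y [set u; v; w].
    move=> xb yb r xy; have [cx|cx] := boolP (connect (off [set u; v; w]) x (croot x)).
      right; left; split=> //; split=> //; rewrite -r; apply/negP => cy; apply: xy.
      apply: (block_cut e_sym e_irr emb emax free (b := [set u; v; w])) => //; first by left.
      by apply: (connect_trans cx); rewrite off_sym.
    by left; left.
  case: (cut u v Ub Vb ruv (edge_neq e_irr uv)) => c1.
    case: (cut v w Vb Wb _ (edge_neq e_irr vw)) => [|c2|c2]; first by rewrite -ruv.
      by apply: Or31.
    by apply: Or32.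
  case: (cut u w Ub Wb ruw (edge_neq e_irr uw)) => c2; [apply: Or31 | apply: Or33]; by split.
move=> x t t'.
(* The root of a component with a diamond lies in the diamond, so a vertex of the diamond is joined
   to it off every isolated triangle. *)
have iso_dia s s' : isoblock s -> x \in s -> ~~ connect (off s) x (croot x) ->
    (exists u v w z, [/\ (pos u < pos v)%N, diamond e pos u v w z, s' = [set u; v; w] &
      x = w \/ x = (if btw pos u v w then u else v)]) -> False.
  move=> I xs /negP n [u [v [w [z [_ d _ xE]]]]]; apply: n.
  have xA : x \in [set u; v; w; z].
    by case: xE => ->; [|case: (btw _ _ _ _)]; rewrite !inE eqxx ?orbT.
  apply: (diamond_connected d I xA); apply: croot_diamond xA.
  by exists u, v, w, z.
case=> [[I [xt n]]|D] [[I' [xt' n']]|D'].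
- have [//|/eqP tt'] := eqVneq t t'; exfalso.
  have B : block t by left. have B' : block t' by left.
  (* A simple path from [x] to the root starts with an edge that lies in at most one of the two
     triangles; by [off_path] it avoids the edges of the other one altogether. *)
  have /connectP[s ps ls] := croot_connect x.
  case/shortenP: ps ls => s' ps us _ ls.
  case: s' ps us ls => [|z s'] /=; first by move=> _ _ ls; case/negP: n; rewrite ls connect0.
  case/andP=> xz ps /andP[xs _] ls; rewrite in_cons negb_or in xs; case/andP: xs => _ xs.
  have [zt|zt] := boolP (z \in t).
    have zt' : z \notin t'.
      by apply/negP => zt'; apply: tt';
        apply: (edge_block_uniq e_sym e_irr emb free B B' xt zt xt' zt' xz).
    by case/negP: n'; rewrite ls; apply: off_path.
  by case/negP: n; rewrite ls; apply: off_path.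
- by case: (iso_dia t t').
- by case: (iso_dia t' t).
move: D D' => [u [v [w [z [uv d -> xE]]]]] [u' [v' [w' [z' [uv' d' -> xE']]]]].
have xA : x \in [set u; v; w; z].
  by case: xE => ->; [|case: (btw _ _ _ _)]; rewrite !inE eqxx ?orbT.
have xA' : x \in [set u'; v'; w'; z'].
  by case: xE' => ->; [|case: (btw _ _ _ _)]; rewrite !inE eqxx ?orbT.
have E : [set u; v; w; z] = [set u'; v'; w'; z'].
  by apply: (connected_diamonds _ _ xA xA' (connect0 _ _));
    [exists u, v, w, z | exists u', v', w', z'].
case: (diamond_eq d d' uv uv' E) => [? [? [[? ?]|[? ?]]]]; subst u' v' w' z' => //; exfalso.
have [t1 t2 wz] := d; have [evu euw evw] := itri_edges t1; have [_ euz evz] := itri_edges t2.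
have ne a c : e a c -> a <> c by exact: edge_neq.
(* The apexes lie on opposite sides of the common side [uv], so the rule by [btw] gives [u] and [v]
   to different triangles. *)
have opp : btw pos u v w != btw pos u v z.
  by apply/eqP => bb; apply: wz; apply: (apex_uniq e_sym e_irr emb evu).
case: xE xE' => -> [].
- exact: wz.
- by case: ifP => _ E'; [apply: (ne _ _ euw) | apply: (ne _ _ evw)].
- by case: ifP => _; [apply: (ne _ _ euz) | apply: (ne _ _ evz)].
- by move: opp; case: ifP; case: ifP => // _ _ _; [|move/esym]; apply: ne.
Qed.

End ClaimingOfFree.

Theorem theorem4p26 (T : finType) (e : rel T) :
  symmetric e -> irreflexive e -> maximal_outerplanar e ->
  (in_B1 e <-> M_free e).
Proof.
move=> e_sym e_irr emax; have [[pos emb] _] := emax.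
split=> [/(claiming_of_B1 e_sym e_irr emb)[cl clP]|free].
  exact: (claiming_M_free e_sym e_irr emb clP).
exact: (B1_of_claiming e_sym e_irr emb emax (free_claiming e_sym e_irr emb emax free)).
Qed.
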